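(* Let $(M,\omega,I)$ be a (pseudo-)Kähler manifold, let $\star$ be a star product of Wick type on $(M,\omega,I)$ with Karabegov's characterizing form $K(\star)$, and let $X$ be a (complex-valued) smooth vector field on $M$. Then $X$ (acting $\nu$-linearly on $C^\infty(M)[[\nu]]$ by Lie derivative) is a derivation of $\star$, i.e. $X(a\star b)=X(a)\star b+a\star X(b)$ for all $a,b\in C^\infty(M)[[\nu]]$, if and only if $$\mathcal L_XI=0\quad\text{and}\quad \mathcal L_XK(\star)=0 .$$
   Context: Conventions. Kähler manifolds $(M,\omega,I)$ (symplectic form $\omega$, complex structure $I$) include pseudo-Kähler manifolds: no positivity of $\omega(\cdot,I\cdot)$ is assumed. $C^\infty(M)$ denotes complex-valued smooth functions; vector fields and forms are complex-valued as well. $\nu$ is a formal parameter; operations on functions, forms etc. are extended $\nu$-linearly to formal power series. Summation convention is used. $\mathcal L_X$ denotes the Lie derivative. Hamiltonian vector fields and Poisson bracket: $i_{X^\omega_f}\omega=df$ and $\{f,g\}=-X^\omega_f(g)$. A star product on $(M,\omega)$ is an associative $\mathbb C[[\nu]]$-bilinear product $a\star b=\sum_{r\ge 0}\nu^rC_r(a,b)$ on $C^\infty(M)[[\nu]]$ with bidifferential operators $C_r$, $C_0(a,b)=ab$, $C_1(a,b)-C_1(b,a)=\{a,b\}$ and $1\star a=a\star 1=a$. Being given by bidifferential operators, $\star$ restricts to open subsets of $M$. A star product is of Wick type on $(M,\omega,I)$ if in local holomorphic coordinates, for $r\ge1$, $C_r(a,b)=\sum_{K,\bar L}C_r^{K;\bar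 L}\frac{\partial^{|K|}a}{\partial z^K}\frac{\partial^{|\bar L|}b}{\partial \bar z^L}$ with local coefficient functions $C_r^{K;\bar L}$ (only holomorphic derivatives of the first argument and only anti-holomorphic derivatives of the second). Karabegov's characterizing form: write $Z_k=\partial_{z^k}$, $\bar Z_l=\partial_{\bar z^l}$. On every contractible domain $U$ of a holomorphic chart $(z,U)$ there exist $u_k,\bar v_l\in C^\infty(U)[[\nu]]$ such that $a\star u_k=au_k+\nu Z_k(a)$ and $\bar v_l\star a=\bar v_l a+\nu\bar Z_l(a)$ for all $a\in C^\infty(U)[[\nu]]$. The form $K(\star)$ is defined by $K(\star)|_U=\bar\partial(-u_k\,dz^k)=\partial(\bar v_l\,d\bar z^l)$; by Karabegov this is a globally well-defined formal series of closed two-forms of type $(1,1)$ on $M$ with $K(\star)=\omega+O(\nu)$. *)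

(* Defs.v *)
From mathcomp Require Import all_boot all_order all_algebra.
From mathcomp Require Import all_classical all_reals all_analysis.
From mathcomp Require Import complex.

Set Implicit Arguments.
Unset Strict Implicit.
Unset Printing Implicit Defensive.

Import Order.TTheory GRing.Theory Num.Theory.
Import numFieldNormedType.Exports.

Local Open Scope classical_set_scope.
Local Open Scope complex_scope.
Local Open Scope ring_scope.

(* The coordinate space C^n is the real normed module of pairs (x, y) with
   z = x + i y.  The index [inl k] stands for z^k and [inr l] for the conjugate
   coordinate of z^l; tensor components are taken in the frame
   Z_1, .., Z_n, conj Z_1, .., conj Z_n of the complexified tangent bundle. *)
Notation cspace R n := ('rV[R]_n * 'rV[R]_n)%type.
Notation cindex n := ('I_n + 'I_n)%type.

Definition cindex_conj (n : nat) (j : cindex n) : cindex n :=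
  match j with inl k => inr k | inr k => inl k end.

Definition is_antiholomorphic_index (n : nat) (j : cindex n) : bool :=
  if j is inr _ then true else false.

Section CoordinateSpace.
Variables (R : realType) (n : nat).
Local Notation E := (cspace R n).

Fixpoint Ck (k : nat) (O : set E) (f : E -> R) : Prop :=
  (forall x, O x -> {for x, continuous f}) /\
  (if k is k'.+1 then
     forall v : E, (forall x, O x -> derivable f x v) /\ Ck k' O ('D_v f)
   else True).

Definition smooth_in (O : set E) (g : E -> R[i]) : Prop :=
  forall k, Ck k O (fun x => complex.Re (g x)) /\
            Ck k O (fun x => complex.Im (g x)).

Definition cderive (v : E) (g : E -> R[i]) (x : E) : R[i] :=
  ('D_v (fun y => complex.Re (g y)) x) +i* ('D_v (fun y => complex.Im (g y)) x).

Definition dir_x (k : 'I_n) : E := (delta_mx 0 k, 0).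
Definition dir_y (k : 'I_n) : E := (0, delta_mx 0 k).

Definition wirtinger (j : cindex n) (g : E -> R[i]) (x : E) : R[i] :=
  match j with
  | inl k => 2^-1 * (cderive (dir_x k) g x - 'i%C * cderive (dir_y k) g x)
  | inr k => 2^-1 * (cderive (dir_x k) g x + 'i%C * cderive (dir_y k) g x)
  end.

Definition zcoord (j : cindex n) (x : E) : R[i] :=
  match j with
  | inl k => (x.1 0 k) +i* (x.2 0 k)
  | inr k => (x.1 0 k) -i* (x.2 0 k)
  end.

End CoordinateSpace.

Section Charts.
Variables (R : realType) (n : nat) (T : topologicalType).
Local Notation E := (cspace R n).

(* Only the values of [cmap] on [cdom], and of [cinv] on the image of [cdom],
   are meaningful. *)
Record chart := Chart {
  cdom : set T;
  cmap : T -> E;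
  cinv : E -> T;
  chart_dom_open : open cdom;
  chart_img_open : open (cmap @` cdom);
  chart_cancel : forall p, cdom p -> cinv (cmap p) = p;
  chart_map_continuous : forall p, cdom p -> {for p, continuous cmap};
  chart_inv_continuous :
    forall x, (cmap @` cdom) x -> {for x, continuous cinv} }.

Definition holomorphic_transition (c c' : chart) : Prop :=
  let O := cmap c @` (cdom c `&` cdom c') in
  forall k : 'I_n,
    let w := fun x => zcoord (inl k) (cmap c' (cinv c x)) in
    smooth_in O w /\ forall (l : 'I_n) x, O x -> wirtinger (inr l) w x = 0.

Definition holomorphically_compatible (c c' : chart) : Prop :=
  holomorphic_transition c c' /\ holomorphic_transition c' c.

End Charts.

(* [holo] is the maximal holomorphic atlas. *)
Record complexManifold (R : realType) (n : nat) := ComplexManifold {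
  cm_space :> topologicalType;
  cm_hausdorff : hausdorff_space cm_space;
  cm_second_countable : @second_countable cm_space;
  holo : set (chart R n cm_space);
  holo_cover : forall p : cm_space, exists2 c, holo c & cdom c p;
  holo_compatible :
    forall c c', holo c -> holo c' -> holomorphically_compatible c c';
  holo_maximal :
    forall c, (forall c', holo c' -> holomorphically_compatible c c') ->
      holo c }.

Definition contractible_set (R : realType) (T : topologicalType) (U : set T) :=
  exists (p0 : T) (H : R * T -> T),
    [/\ U p0,
        {within `[0, 1]%classic `*` U, continuous H},
        forall t p, t \in `[0, 1] -> U p -> U (H (t, p)),
        forall p, U p -> H (0, p) = p &
        forall p, U p -> H (1, p) = p0].

Section ComplexManifold.
Variables (R : realType) (n : nat) (M : complexManifold R n).
Local Notation C := (R[i]).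
(* A function on an open subset of M is encoded by a total function whose
   values off that subset are irrelevant. *)
Local Notation fn := (M -> C).
Local Notation chart := (chart R n M).
Local Notation index := (cindex n).

Definition smooth_on (U : set M) (f : fn) : Prop :=
  forall c : chart, holo c ->
    smooth_in (cmap c @` (cdom c `&` U)) (fun x => f (cinv c x)).

Definition smooth_near (p : M) (f : fn) : Prop :=
  exists U : set M, [/\ open U, U p & smooth_on U f].

Definition partial (c : chart) (j : index) (f : fn) : fn :=
  fun p => wirtinger j (fun x => f (cinv c x)) (cmap c p).

Definition coordf (c : chart) (j : index) : fn := fun p => zcoord j (cmap c p).

(* A smooth complex vector field is encoded by its action on (locally defined)
   smooth functions; its components in a chart are its values on the coordinate
   functions, and the required local formula X f = X^j d_j f contains the
   transformation law of the components. *)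
Record vfield := VField {
  vact :> fn -> fn;
  vfield_smooth : forall (c : chart) (j : index),
    holo c -> smooth_on (cdom c) (vact (coordf c j));
  vfield_local : forall (c : chart) (p : M) (f : fn),
    holo c -> cdom c p -> smooth_near p f ->
    vact f p = \sum_(j : index) vact (coordf c j) p * partial c j f p }.

Definition vcomp (X : vfield) (c : chart) (j : index) : fn := X (coordf c j).

(* Components T_{ij} or T^i_j of a tensor field with two indices in each chart,
   meaningful on the domain of that chart.  A two-form has components
   alpha_{ij} = alpha(d_i, d_j). *)
Definition tensor2 := chart -> index -> index -> fn.

Definition two_form (alpha : tensor2) : Prop :=
  [/\ forall c i j, holo c -> smooth_on (cdom c) (alpha c i j),
      forall c i j p, holo c -> cdom c p -> alpha c i j p = - alpha c j i p &
      forall c c' i j p, holo c -> holo c' -> cdom c p -> cdom c' p ->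
        alpha c i j p =
          \sum_(k : index) \sum_(l : index)
            alpha c' k l p * partial c i (coordf c' k) p
                           * partial c j (coordf c' l) p].

Definition closed_form (alpha : tensor2) : Prop :=
  forall c i j k p, holo c -> cdom c p ->
    partial c i (alpha c j k) p + partial c j (alpha c k i) p
      + partial c k (alpha c i j) p = 0.

Definition nondegenerate (alpha : tensor2) : Prop :=
  forall c p, holo c -> cdom c p ->
    forall v : index -> C,
      (forall j, \sum_(i : index) v i * alpha c i j p = 0) ->
      forall i, v i = 0.

Definition real_form (alpha : tensor2) : Prop :=
  forall c i j p, holo c -> cdom c p ->
    alpha c (cindex_conj i) (cindex_conj j) p = conjc (alpha c i j p).

Definition type11 (alpha : tensor2) : Prop :=
  forall c i j p, holo c -> cdom c p ->
    is_antiholomorphic_index i = is_antiholomorphic_index j ->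
    alpha c i j p = 0.

(* Type (1,1) expresses omega(I _, I _) = omega. *)
Definition pseudo_kahler (omega : tensor2) : Prop :=
  [/\ two_form omega, closed_form omega, nondegenerate omega,
      real_form omega & type11 omega].

(* I^i_j, where I d_j = I^i_j d_i *)
Definition complex_structure : tensor2 :=
  fun _ i j _ =>
    if i == j then (if is_antiholomorphic_index j then - 'i%C else 'i%C) else 0.

Definition lie_endo (X : vfield) (A : tensor2) : tensor2 := fun c i j p =>
  X (A c i j) p
    - \sum_(k : index) A c k j p * partial c k (vcomp X c i) p
    + \sum_(k : index) A c i k p * partial c j (vcomp X c k) p.

Definition lie_form (X : vfield) (alpha : tensor2) : tensor2 := fun c i j p =>
  X (alpha c i j) p
    + \sum_(k : index) alpha c k j p * partial c i (vcomp X c k) p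
    + \sum_(k : index) alpha c i k p * partial c j (vcomp X c k) p.

Definition vanishes (A : tensor2) : Prop :=
  forall c i j p, holo c -> cdom c p -> A c i j p = 0.

(* i_X omega = df *)
Definition hamiltonian (omega : tensor2) (f : fn) (X : vfield) : Prop :=
  forall c j p, holo c -> cdom c p ->
    \sum_(i : index) vcomp X c i p * omega c i j p = partial c j f p.

(* h = {f, g}; the Hamiltonian field exists and is unique for a symplectic
   form. *)
Definition poisson_bracket (omega : tensor2) (f g h : fn) : Prop :=
  exists X : vfield, hamiltonian omega f X /\ forall p, h p = - X g p.

(* Formal power series sum_m nu^m a_m of functions are sequences (a_m). *)
Definition fseries := nat -> fn.

Definition fsmooth (U : set M) (a : fseries) : Prop :=
  forall m, smooth_on U (a m).

Definition fone : fseries := fun m _ => if m == 0%N then 1 else 0.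

Definition fadd (a b : fseries) : fseries := fun m p => a m p + b m p.

Definition fmul (a b : fseries) : fseries := fun m p =>
  \sum_(i < m.+1) a i p * b (m - i)%N p.

Definition fnu (a : fseries) : fseries := fun m p =>
  if m is m'.+1 then a m' p else 0.

Definition fmap (D : fn -> fn) (a : fseries) : fseries := fun m => D (a m).

(* The nu-bilinear product sum_r nu^r C_r. *)
Definition star (Cr : nat -> fn -> fn -> fn) (a b : fseries) : fseries :=
  fun m p =>
    \sum_(r < m.+1) \sum_(i < (m - r).+1) Cr r (a i) (b (m - r - i)%N) p.

(* The iterated derivative along the coordinates e t, t in T, with
   multiplicities given by the multi-index K. *)
Definition mpartial (c : chart) (T : finType) (e : T -> index) (N : nat)
    (K : {ffun T -> 'I_N}) (f : fn) : fn :=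
  foldr (fun t g => iter (K t) (partial c (e t)) g) f (enum T).

(* In every chart, D(a, b) is locally a finite sum of smooth coefficients times
   d^K a d^L b, where a is differentiated only along the coordinates e1 and b
   only along the coordinates e2.  The formula is required for all a and b
   that are smooth near the point, so that D also encodes its restrictions to
   open subsets of M. *)
Definition bidifferential_along (T : finType) (e1 e2 : T -> index)
    (D : fn -> fn -> fn) : Prop :=
  forall (c : chart) (p : M), holo c -> cdom c p ->
    exists (U : set M) (N : nat)
           (coef : {ffun T -> 'I_N} -> {ffun T -> 'I_N} -> fn),
      [/\ open U, U p, U `<=` cdom c,
          forall K L, smooth_on U (coef K L) &
          forall (a b : fn) (q : M),
            U q -> smooth_near q a -> smooth_near q b ->
            D a b q = \sum_K \sum_L
              coef K L q * mpartial c e1 K a q * mpartial c e2 L b q].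

Definition bidifferential (D : fn -> fn -> fn) : Prop :=
  bidifferential_along (T := index) id id D.

Record star_product (omega : tensor2) (Cr : nat -> fn -> fn -> fn) : Prop :=
  StarProduct {
    star_bidifferential : forall r, bidifferential (Cr r);
    star_assoc : forall a b c : fseries,
      fsmooth setT a -> fsmooth setT b -> fsmooth setT c ->
      forall m p, star Cr (star Cr a b) c m p = star Cr a (star Cr b c) m p;
    star_C0 : forall a b : fn, smooth_on setT a -> smooth_on setT b ->
      forall p, Cr 0%N a b p = a p * b p;
    star_C1 : forall a b : fn, smooth_on setT a -> smooth_on setT b ->
      poisson_bracket omega a b (fun p => Cr 1%N a b p - Cr 1%N b a p);
    star_1l : forall a : fseries, fsmooth setT a ->
      forall m p, star Cr fone a m p = a m p;
    star_1r : forall a : fseries, fsmooth setT a ->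
      forall m p, star Cr a fone m p = a m p }.

Definition wick_type (Cr : nat -> fn -> fn -> fn) : Prop :=
  forall r, (0 < r)%N ->
    bidifferential_along (T := 'I_n) (fun k => inl k) (fun l => inr l) (Cr r).

(* One-forms on a chart domain, by components. *)
Definition form10 (u : 'I_n -> fn) (j : index) : fn :=
  if j is inl k then u k else fun _ => 0.

Definition form01 (v : 'I_n -> fn) (j : index) : fn :=
  if j is inr l then v l else fun _ => 0.

Definition del (c : chart) (theta : index -> fn) (i j : index) : fn := fun p =>
  (if is_antiholomorphic_index i then 0 else partial c i (theta j) p)
  - (if is_antiholomorphic_index j then 0 else partial c j (theta i) p).

Definition delbar (c : chart) (theta : index -> fn) (i j : index) : fn :=
  fun p =>
  (if is_antiholomorphic_index i then partial c i (theta j) p else 0)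
  - (if is_antiholomorphic_index j then partial c j (theta i) p else 0).

Definition left_potentials (Cr : nat -> fn -> fn -> fn) (c : chart)
    (u : 'I_n -> fseries) : Prop :=
  forall k, fsmooth (cdom c) (u k) /\
    forall a : fseries, fsmooth (cdom c) a -> forall m p, cdom c p ->
      star Cr a (u k) m p =
        fadd (fmul a (u k)) (fnu (fmap (partial c (inl k)) a)) m p.

Definition right_potentials (Cr : nat -> fn -> fn -> fn) (c : chart)
    (v : 'I_n -> fseries) : Prop :=
  forall l, fsmooth (cdom c) (v l) /\
    forall a : fseries, fsmooth (cdom c) a -> forall m p, cdom c p ->
      star Cr (v l) a m p =
        fadd (fmul (v l) a) (fnu (fmap (partial c (inr l)) a)) m p.

(* K is a formal series of two-forms given by delbar(- u_k dz^k) and by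
   del(v_l dzbar^l) on every contractible chart domain carrying such potentials.
   By Karabegov's theorem these charts cover M, so that K is determined; this is
   the last clause. *)
Record karabegov_form (Cr : nat -> fn -> fn -> fn) (K : nat -> tensor2) : Prop :=
  KarabegovForm {
    karabegov_two_form : forall m, two_form (K m);
    karabegov_left : forall (c : chart) (u : 'I_n -> fseries),
      holo c -> contractible_set R (cdom c) -> left_potentials Cr c u ->
      forall m i j p, cdom c p ->
        K m c i j p = delbar c (form10 (fun k q => - u k m q)) i j p;
    karabegov_right : forall (c : chart) (v : 'I_n -> fseries),
      holo c -> contractible_set R (cdom c) -> right_potentials Cr c v ->
      forall m i j p, cdom c p ->
        K m c i j p = del c (form01 (fun l => v l m)) i j p;
    karabegov_cover : forall p : M, exists c : chart,
      [/\ holo c, cdom c p, contractible_set R (cdom c),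
          exists u, left_potentials Cr c u &
          exists v, right_potentials Cr c v] }.

Definition star_derivation (Cr : nat -> fn -> fn -> fn) (X : vfield) : Prop :=
  forall a b : fseries, fsmooth setT a -> fsmooth setT b ->
    forall m p, fmap X (star Cr a b) m p =
      fadd (star Cr (fmap X a) b) (star Cr a (fmap X b)) m p.

End ComplexManifold.

(* Main.v *)
(** A vector field [X] is a derivation of the star product iff for every order
    [r] the defect [D_r(a, b) = X C_r(a, b) - C_r(X a, b) - C_r(a, X b)]
    vanishes; by cutting off, this may be tested on germs.

    Necessity.  If [a] is antiholomorphic then [C_r(a, _) = 0] for [r >= 1], so
    [D_1 = 0] gives [{X zbar^l, zbar^j} = 0]; as [omega] has type (1,1), [X zbar^l]
    is antiholomorphic, and symmetrically [X z^k] is holomorphic, i.e. [L_X I = 0].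
    Then [w_k = X u_k + u_l d_k X^l] satisfies [a * w_k = a w_k] for all [a], which
    by induction on the order in [nu] forces [w_k] to be holomorphic, and
    [dbar_l w_k] is the [(k, lbar)] component of [L_X K].

    Sufficiency.  Conversely [L_X K = 0] makes [w_k] holomorphic, and this yields
    [sum_r D_r(a, u_k,m-r) = 0].  If [D_s = 0] for [s < r], then [D_r] is a
    Hochschild cocycle, [D_r(a, u_k,0) = 0], and hence [b |-> D_r(a, b)(p)] is a
    functional of finite order killing the ideal generated by [z^k - z^k(p)] and
    [u_k,0 - u_k,0(p)].  These functions span the cotangent space at [p] because
    [dbar_l u_k,0 = omega_(k, lbar)] is invertible, so the functional vanishes. *)

From HB Require Import structures.
Require Import Defs.
From mathcomp Require Import all_boot all_order all_algebra.
From mathcomp Require Import all_classical all_reals all_analysis.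
From mathcomp Require Import complex.
From mathcomp Require Import ring lra.

Set Implicit Arguments.
Unset Strict Implicit.
Unset Printing Implicit Defensive.

Import Order.TTheory GRing.Theory Num.Theory.
Import numFieldNormedType.Exports.

Local Open Scope classical_set_scope.
Local Open Scope complex_scope.
Local Open Scope ring_scope.

(** * Differential calculus on the coordinate space *)

(** Both directions rest on one identity. Applying $X$ to $a \star u_k = a u_k + \nu\,\partial_k a$
    leaves the commutator $[X,\partial_k]a = -(\partial_k X^l)\,\partial_l a$ at order $\nu$,
    together with the defects $D_r$. Once $\mathcal L_X I = 0$, the factors $\partial_k X^l$ are
    holomorphic and pass through the second argument of $\star$, so adding $u_l\,\partial_k X^l$
    cancels the commutator. This dictates the form of $w_k$ and gives $a \star w_k - a w_k =
    -\sum_{r\ge1} \nu^r D_r(a, u_k)$ for any such $X$. Necessity reads it with a vanishing right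
    side, sufficiency with a vanishing left side. Three obstacles shape the rest. The axioms of a
    star product concern globally smooth functions, while coordinates and potentials live in charts:
    bump functions carry the axioms over to germs. Smooth functions are not determined by Taylor
    coefficients, so a functional killing an ideal is shown to vanish through its finite order. And
    [Ck] is built from directional derivatives, so total differentiability, the chain rule and
    Schwarz symmetry must be derived. *)

Section DirectionalDerivatives.
Variables (R : realType) (V : normedModType R).
Implicit Types (f : V -> R) (x v w : V).

(** The two difference quotients coincide as functions of the increment, so everything transfers
    without a chain rule. *)
Lemma is_derive_line f x v (s : R) : derivable f (x + s *: v) v ->
  is_derive s 1 (fun t : R => f (x + t *: v)) ('D_v f (x + s *: v)).
Proof.
move=> df.
have e : (fun h : R => h^-1 *: (((fun t : R => f (x + t *: v)) \o shift s) (h *: (1 : R))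
    - f (x + s *: v))) =
  (fun h : R => h^-1 *: ((f \o shift (x + s *: v)) (h *: v) - f (x + s *: v))).
  apply/funext => h /=; congr (_ *: (f _ - _)).
  by rewrite [h *: 1]mulr1 scalerDl addrCA.
by split; rewrite /derivable /derive /= e.
Qed.

(** Bounding the intermediate parameter by $|s| \le |t|$ gives both signs of [t] the same form, on
    $[0,t]$ or on $[t,0]$. *)
Lemma MVT_line f x v (t : R) :
  (forall s : R, `|s| <= `|t| -> derivable f (x + s *: v) v) ->
  exists2 s : R, `|s| <= `|t| & f (x + t *: v) - f x = t * 'D_v f (x + s *: v).
Proof.
move=> df.
have d (s : R) : `|s| <= `|t| ->
    is_derive s (1 : R) (fun t : R => f (x + t *: v)) ('D_v f (x + s *: v)).
  by move=> st; apply: is_derive_line; apply: df.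
have cont (a b : R) : `|a| <= `|t| -> `|b| <= `|t| ->
    {within `[a, b], continuous (fun t : R => f (x + t *: v))}.
  move=> ha hb; apply: derivable_within_continuous => s; rewrite in_itv /= => /andP[h1 h2].
  suff /d[] : `|s| <= `|t| by [].
  move: ha hb; rewrite !ler_norml => /andP[? ?] /andP[? ?]; apply/andP; lra.
have [t0|t0] := leP 0 t.
- have d0 (s : R) : s \in `]0, t[%R ->
      is_derive s (1 : R) (fun t : R => f (x + t *: v)) ('D_v f (x + s *: v)).
    by rewrite in_itv /= => /andP[h1 h2]; apply: d; rewrite !ger0_norm// ltW.
  have [|c] := MVT_segment t0 d0; first by apply: cont; rewrite ?normr0.
  rewrite in_itv /= => /andP[h1 h2]; rewrite scale0r addr0 subr0 mulrC => ->.
  by exists c => //; rewrite !ger0_norm.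
- have d0 (s : R) : s \in `]t, 0[%R ->
      is_derive s (1 : R) (fun t : R => f (x + t *: v)) ('D_v f (x + s *: v)).
    by rewrite in_itv /= => /andP[h1 h2]; apply: d; rewrite !ler0_norm ?lerN2 ?ltW.
  have [|c] := MVT_segment (ltW t0) d0; first by apply: cont; rewrite ?normr0.
  rewrite in_itv /= => /andP[h1 h2]; rewrite scale0r addr0 sub0r => e.
  exists c; first by rewrite !ler0_norm ?(ltW t0)// lerN2.
  by apply: oppr_inj; rewrite opprB e mulrN mulrC.
Qed.

(** The increment is travelled one direction at a time; on each leg the mean value theorem produces
    a derivative at a nearby point, which continuity compares with the derivative at [x]. *)
Lemma seq_linear_approximation (I : Type) (e : I -> V) (r : seq I) f x :
  (forall i, {for x, continuous ('D_(e i) f)}) ->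
  (forall i, \forall y \near x, derivable f y (e i)) ->
  forall eps : R, 0 < eps -> exists2 d : R, 0 < d & forall t : I -> R,
    (forall i, `|t i| < d) ->
    `|f (x + \sum_(i <- r) t i *: e i) - f x - \sum_(i <- r) t i * 'D_(e i) f x|
       <= eps * \sum_(i <- r) `|t i|.
Proof.
move=> cD dD eps eps0; elim: r => [|i r [d d0 IH]].
  by exists 1 => // t _; rewrite !big_nil addr0 !subrr normr0 mulr0.
have cDi : \forall y \near x, `|'D_(e i) f x - 'D_(e i) f y| <= eps.
  by move/cvgrPdist_le : (cD i); apply.
have [d1 /= d10 Hd1] := (nbhs_ballP _ _).1 (filterI (dD i) cDi).
pose S := \sum_(j <- i :: r) `|e j|.
have S0 : 0 <= S by apply: sumr_ge0 => j _.
(* [S] bounds the displacement per unit size of the coefficients, so the path stays within $d_1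
   S/(S+1) < d_1$ of [x]; the summand 1 keeps the quotient meaningful when all directions are 0. *)
exists (Num.min d (d1 / (S + 1))).
  by rewrite lt_min d0 divr_gt0// ltr_wpDl.
move=> t Ht.
have H (s : R) : `|s| <= `|t i| ->
    ball x d1 (x + \sum_(j <- r) t j *: e j + s *: e i).
  move=> st; rewrite -ball_normE /ball_/= -addrA opprD addNKr normrN.
  apply: le_lt_trans (_ : (d1 / (S + 1)) * S < _); last first.
    rewrite -mulrA gtr_pMr// mulrC ltr_pdivrMr ?mul1r; lra.
  rewrite /S big_cons mulrDr [leRHS]addrC.
  apply: le_trans (ler_normD _ _) _; apply: lerD.
    apply: le_trans (ler_norm_sum _ _ _) _; rewrite mulr_sumr; apply: ler_sum => j _.
    rewrite normrZ ler_wpM2r// ltW//.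
    by have := Ht j; rewrite lt_min /S big_cons => /andP[].
  rewrite normrZ ler_wpM2r//; apply: le_trans st _; apply: ltW.
  by have := Ht i; rewrite lt_min /S big_cons => /andP[].
have [s st es] := @MVT_line f (x + \sum_(j <- r) t j *: e j) (e i) (t i)
  (fun s st => (Hd1 _ (H s st)).1).
have [_ Hs] := Hd1 _ (H s st).
rewrite !big_cons [t i *: _ + _]addrC addrA.
have {}IH : `|f (x + \sum_(j <- r) t j *: e j) - f x - \sum_(j <- r) t j * 'D_(e j) f x|
    <= eps * \sum_(j <- r) `|t j|.
  by apply: IH => j; have := Ht j; rewrite lt_min => /andP[].
set A := f (x + _ + _) in es *; set B := f (x + _) in es IH *.
have -> : A - f x - (t i * 'D_(e i) f x + \sum_(j <- r) t j * 'D_(e j) f x) =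
  (A - B - t i * 'D_(e i) f x) + (B - f x - \sum_(j <- r) t j * 'D_(e j) f x) by ring.
apply: le_trans (ler_normD _ _) _; rewrite mulrDr lerD//.
rewrite es -mulrBr normrM mulrC ler_wpM2r//.
by rewrite distrC.
Qed.

Lemma is_derive_translate f a x v : derivable f (x + a) v ->
  is_derive x v (fun y => f (y + a)) ('D_v f (x + a)).
Proof.
move=> df.
have e : (fun h : R => h^-1 *: (((fun y => f (y + a)) \o shift x) (h *: v) - f (x + a))) =
  (fun h : R => h^-1 *: ((f \o shift (x + a)) (h *: v) - f (x + a))).
  by apply/funext => h /=; rewrite addrA.
by split; rewrite /derivable /derive /= e.
Qed.

(** The mean value theorem is used twice: along [v] for the difference $f(y + hw) - f(y)$, then
    along [w] for $D_v f$. *)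
Lemma second_difference_MVT f x v w (h : R) :
  (forall s t : R, `|s| <= `|h| -> `|t| <= `|h| ->
     derivable f (x + s *: v + t *: w) v /\
     derivable ('D_v f) (x + s *: v + t *: w) w) ->
  exists s t : R, [/\ `|s| <= `|h|, `|t| <= `|h| &
    f (x + h *: v + h *: w) - f (x + h *: v) - (f (x + h *: w) - f x) =
      h * (h * 'D_w ('D_v f) (x + s *: v + t *: w))].
Proof.
move=> H.
have dF (s : R) : `|s| <= `|h| ->
    is_derive (x + s *: v) v (fun y => f (y + h *: w) - f y)
      ('D_v f (x + s *: v + h *: w) - 'D_v f (x + s *: v)).
  move=> sh; apply: is_deriveB.
    by apply: is_derive_translate; have [] := H s h sh (lexx _).
  by have := (H s 0 sh); rewrite normr0 scale0r addr0 => /(_ (normr_ge0 _))[/derivableP].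
have [s|s sh] := @MVT_line (fun y => f (y + h *: w) - f y) x v h.
  by move=> /dF[].
rewrite -/(GRing.add _) => e.
have [t|t th] := @MVT_line ('D_v f) (x + s *: v) w h.
  by move=> th; have [] := H s t sh th.
move=> e2; exists s, t; split => //.
have [_ d] := dF s sh.
by rewrite -e2 -d -e.
Qed.

(** The second difference is symmetric in [v] and [w], so the two mixed derivatives take a common
    value at points arbitrarily close to [x]; continuity moves both points to [x]. *)
Lemma schwarz_symmetry f x v w :
  (\forall y \near x, derivable f y v /\ derivable f y w) ->
  (\forall y \near x, derivable ('D_v f) y w /\ derivable ('D_w f) y v) ->
  {for x, continuous ('D_w ('D_v f))} -> {for x, continuous ('D_v ('D_w f))} ->
  'D_w ('D_v f) x = 'D_v ('D_w f) x.
Proof.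
move=> d1 d2 c1 c2.
apply/eqP; rewrite -subr_eq0 -normr_le0; apply/ler_addgt0Pr => e e0; rewrite add0r.
have n1 : \forall y \near x, `|'D_w ('D_v f) x - 'D_w ('D_v f) y| <= e / 2.
  by move/cvgrPdist_le : c1; apply; exact: divr_gt0.
have n2 : \forall y \near x, `|'D_v ('D_w f) x - 'D_v ('D_w f) y| <= e / 2.
  by move/cvgrPdist_le : c2; apply; exact: divr_gt0.
have [r /= r0 Hr] := (nbhs_ballP _ _).1 (filterI (filterI d1 d2) (filterI n1 n2)).
have N0 : 0 < `|v| + `|w| + 1 by rewrite ltr_wpDl// addr_ge0.
(* Parallelograms with steps at most [h] stay within $h(|v|+|w|+1) = r/2$ of [x], where all
   derivatives exist and the mixed ones oscillate by at most $e/2$. *)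
pose h := r / (`|v| + `|w| + 1) / 2.
have h0 : 0 < h by rewrite !divr_gt0.
have inB (s t : R) : `|s| <= `|h| -> `|t| <= `|h| -> ball x r (x + s *: v + t *: w).
  rewrite (gtr0_norm h0) => sh th.
  rewrite -ball_normE /ball_/= -addrA opprD addNKr normrN.
  apply: le_lt_trans (ler_normD _ _) _; rewrite !normrZ.
  apply: le_lt_trans (_ : h * (`|v| + `|w|) < _).
    by rewrite mulrDr lerD// ler_wpM2r.
  apply: le_lt_trans (_ : h * (`|v| + `|w| + 1) < _).
    by rewrite ler_wpM2l ?(ltW h0)// lerDl.
  rewrite /h mulrAC divfK ?gt_eqF//; lra.
have inB' (s t : R) : `|s| <= `|h| -> `|t| <= `|h| -> ball x r (x + s *: w + t *: v).
  by move=> sh th; rewrite (addrAC x (s *: w) (t *: v)); exact: inB.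
have [t' t th' th|s [t [sh th e1]]] := @second_difference_MVT f x v w h.
  by have [[[A1 A2] [A3 A4]] _] := Hr _ (inB _ _ th' th); split; [exact: A1|exact: A3].
have [t' t1 th' th1|s' [t' [sh' th' e2]]] := @second_difference_MVT f x w v h.
  by have [[[A1 A2] [A3 A4]] _] := Hr _ (inB' _ _ th' th1); split; [exact: A2|exact: A4].
have E : 'D_w ('D_v f) (x + s *: v + t *: w) = 'D_v ('D_w f) (x + s' *: w + t' *: v).
  apply: (mulfI (lt0r_neq0 h0)); apply: (mulfI (lt0r_neq0 h0)).
  apply: eq_trans (esym e1) _; apply: eq_trans _ e2.
  rewrite (addrAC x (h *: v) (h *: w)).
  set a := f (x + h *: w + h *: v); set b := f (x + h *: v).
  by set c := f (x + h *: w); set d := f x; clearbody a b c d; ring.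
have [_ [A _]] := Hr _ (inB _ _ sh th).
have [_ [_ B]] := Hr _ (inB' _ _ sh' th').
rewrite E in A.
rewrite -(subrKA ('D_v ('D_w f) (x + s' *: w + t' *: v))) (splitr e).
by rewrite distrC in B; exact: le_trans (ler_normD _ _) (lerD A B).
Qed.
End DirectionalDerivatives.

Lemma continuous_sumR (R : realType) (T : topologicalType) (I : Type) (r : seq I) (F : I ->
  T -> R) :
  (forall i, continuous (F i)) -> continuous (fun x => \sum_(i <- r) F i x).
Proof.
move=> cF x; elim: r => [|i r IH].
  by under eq_fun do rewrite big_nil; exact: cst_continuous.
under eq_fun do rewrite big_cons.
by apply: cvgD; [exact: cF|exact: IH].
Qed.

(** * Functions of class $C^k$ on the real coordinate space *)

Section CkCalculus.
Variables (R : realType) (n : nat).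
Local Notation E := (cspace R n).
Implicit Types (O : set E) (f g : E -> R) (x v w : E).

(** Here the index type labels the real directions $\partial/\partial x_k$ and $\partial/\partial
    y_k$, not the complex frame that it labels for tensors. *)
Definition cbasis (i : cindex n) : E :=
  match i with inl k => dir_x R k | inr k => dir_y R k end.

Definition ccoord (i : cindex n) (x : E) : R :=
  match i with inl k => x.1 0 k | inr k => x.2 0 k end.

Lemma cbasis_sum x : x = \sum_i ccoord i x *: cbasis i.
Proof.
rewrite big_sumType /=.
transitivity ((x.1, 0) + (0, x.2) : E); first by case: x => a b; congr (_, _);
  rewrite /= ?addr0 ?add0r.
congr (_ + _).
- rewrite [in LHS](row_sum_delta x.1); apply/esym.
  have -> : \sum_k x.1 0 k *: dir_x R k = \sum_k ((x.1 0 k *: delta_mx 0 k : 'rV[R]_n),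
    0 : 'rV[R]_n).
    by apply: eq_bigr => k _; rewrite /dir_x; congr (_, _); rewrite /= scaler0.
  by elim/big_rec2 : _ => // k y z _ ->; congr (_, _); rewrite /= addr0.
- rewrite [in LHS](row_sum_delta x.2); apply/esym.
  have -> : \sum_k x.2 0 k *: dir_y R k = \sum_k ((0 : 'rV[R]_n),
    (x.2 0 k *: delta_mx 0 k : 'rV[R]_n)).
    by apply: eq_bigr => k _; rewrite /dir_x; congr (_, _); rewrite /= scaler0.
  by elim/big_rec2 : _ => // k y z _ ->; congr (_, _); rewrite /= addr0.
Qed.

Lemma ccoord_linear i : linear (ccoord i : E -> R^o).
Proof. by case: i => k a x y /=; rewrite !mxE. Qed.

Lemma ccoord_le_norm i x : `|ccoord i x| <= `|x|.
Proof.
have H (y : 'rV[R]_n) k : `|y 0 k| <= `|y|.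
  by rewrite [leRHS]/Num.Def.normr/= mx_normrE; apply: (le_trans _ (le_bigmax _ _ (ord0, k))).
rewrite [leRHS]/Num.norm/= le_max; case: i => k /=; rewrite H ?orbT//.
Qed.

Lemma ccoord_continuous i : continuous (ccoord i).
Proof.
move=> x; apply/cvgrPdist_le => e e0; near=> y.
have -> : ccoord i x - ccoord i y = ccoord i (x - y).
  by case: i => k /=; rewrite !mxE.
apply: le_trans (ccoord_le_norm _ _) _.
near: y; exact: cvgr_dist_le.
Unshelve. all: by end_near. Qed.

Lemma ccoord_differentiable i x : differentiable (ccoord i) x.
Proof.
pose sM := GRing.isLinear.Build _ _ _ _ _ (ccoord_linear i).
pose L : {linear E -> R^o} := HB.pack (ccoord i : E -> R^o) sM.
have := @linear_differentiable R E R^o L x; apply; exact: ccoord_continuous.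
Qed.

Lemma is_derive_ccoord i x v : is_derive x v (ccoord i) (ccoord i v).
Proof.
pose sM := GRing.isLinear.Build _ _ _ _ _ (ccoord_linear i).
pose L : {linear E -> R^o} := HB.pack (ccoord i : E -> R^o) sM.
have d := ccoord_differentiable i x.
split; first exact: diff_derivable.
rewrite deriveE//.
have /= -> := @diff_lin R E R^o L x; last exact: ccoord_continuous.
by [].
Qed.

(** The candidate differential is assembled from the derivatives along the real basis, and the
    approximation along a sequence of directions supplies the little-o estimate. *)
Lemma differentiable_continuous_partials f x :
  (forall v, {for x, continuous ('D_v f)}) ->
  (forall v, \forall y \near x, derivable f y v) -> differentiable f x.
Proof.
move=> cD dD.
pose L0 (h : E) : R^o := \sum_i ccoord i h * 'D_(cbasis i) f x.
have lin : linear L0.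
  move=> a u v; rewrite /L0 scaler_sumr -big_split /=; apply: eq_bigr => i _.
  by rewrite (ccoord_linear i a u v) mulrDl -scalerAl.
pose sM := GRing.isLinear.Build _ _ _ _ _ lin.
pose L : {linear E -> R^o} := HB.pack L0 sM.
have Lc : continuous (L0 : E -> R).
  apply: continuous_sumR => i h; apply: cvgM; [exact: ccoord_continuous|exact: cvg_cst].
have Lo : f \o shift x = cst (f x) + L +o_ (0 : E) id.
  apply/eqaddoP => eps eps0.
  (* The error is controlled by a sum of coordinates of [h], each at most $|h|$; dividing [eps] by
     their number plus one absorbs the sum and stays meaningful for $n = 0$. *)
  have N0 : 0 < #|{: cindex n}|%:R + 1 :> R by rewrite ltr_wpDl.
  have [d d0 Hd] := @seq_linear_approximation R E _ cbasis (index_enum _) f x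
    (fun i => cD _) (fun i => dD _) (eps / (#|{: cindex n}|%:R + 1)) (divr_gt0 eps0 N0).
  have N1 : \forall h \near (0 : E), `|h| < d by exact: nbhs0_lt.
  apply: filterS N1 => h hd.
  have := Hd (ccoord^~ h).
  rewrite -cbasis_sum => H.
  have -> : (f \o shift x - (cst (f x) + L)) h =
    f (x + h) - f x - \sum_i ccoord i h * 'D_(cbasis i) f x.
    by rewrite -addrA -opprD [x + h]addrC.
  apply: le_trans (H _) _.
    move=> i; exact: le_lt_trans (ccoord_le_norm _ _) hd.
  apply: le_trans (_ : eps / (#|{: cindex n}|%:R + 1) * \sum_(i : cindex n) `|h| <= _).
    apply: ler_wpM2l; first by rewrite ltW// divr_gt0.
    by apply: ler_sum => i _; exact: ccoord_le_norm.
  rewrite sumr_const -[_ *+ #|_|]mulr_natr mulrCA mulrC ler_wpM2r//.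
  rewrite mulrAC ler_pdivrMr// ler_wpM2l ?ltW//; lra.
have e : 'd f x = L :> (E -> R) by exact: diff_unique.
by apply/diff_locallyP; rewrite e.
Qed.

Lemma Ck_continuous k O f x : Ck k O f -> O x -> {for x, continuous f}.
Proof. by case: k => [|k] [H _]; exact: H. Qed.

Lemma CkW k O f : Ck k.+1 O f -> Ck k O f.
Proof.
elim: k f => [|k IH] f [cf df]; split => // v.
by have [dv /IH] := df v.
Qed.

Lemma Ck_derivable k O f x v : Ck k.+1 O f -> O x -> derivable f x v.
Proof. by move=> [_ /(_ v)[H _]]; exact: H. Qed.

Lemma Ck_derive k O f v : Ck k.+1 O f -> Ck k O ('D_v f).
Proof. by move=> [_ /(_ v)[_ H]]. Qed.

(** The sets [U] may be arbitrary, even single points: continuity and derivatives in [Ck] refer to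
    the ambient space, and the set only says where they are tested. *)
Lemma Ck_local k O f :
  (forall x, O x -> exists2 U, U x & Ck k U f) -> Ck k O f.
Proof.
elim: k f => [|k IH] f H; split => //.
- by move=> x Ox; have [U Ux] := H x Ox; case=> h _; exact: h.
- by move=> x Ox; have [U Ux] := H x Ox; case=> h _; exact: h.
- move=> v; split.
    by move=> x Ox; have [U Ux] := H x Ox; case=> _ /(_ v); case=> h _; exact: h.
  by apply: IH => x Ox; have [U Ux] := H x Ox; case=> _ /(_ v); case=> _ h; exists U.
Qed.

Lemma Ck_sub k O O' f : O' `<=` O -> Ck k O f -> Ck k O' f.
Proof. by move=> sub H; apply: Ck_local => x /sub; exists O. Qed.

Lemma near_eq_continuous f g x : {near x, f =1 g} ->
  {for x, continuous f} -> {for x, continuous g}.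
Proof.
move=> e cf; rewrite /prop_for /continuous_at -(nbhs_singleton e).
exact: cvg_trans (near_eq_cvg e) cf.
Qed.

(** Openness turns equality on [O] into equality near each of its points, which is what derivatives
    can see. *)
Lemma Ck_eq k O f g : open O -> (forall x, O x -> f x = g x) -> Ck k O f -> Ck k O g.
Proof.
move=> oO; elim: k f g => [|k IH] f g e [cf df].
  split=> // x Ox; apply: near_eq_continuous (cf x Ox).
  by have := open_nbhs_nbhs (conj oO Ox); apply: filterS => y /e.
have ne x : O x -> {near x, f =1 g}.
  by move=> Ox; have := open_nbhs_nbhs (conj oO Ox); apply: filterS => y /e.
split=> [x Ox|v]; first by apply: near_eq_continuous (cf x Ox); exact: ne.
have [dv Cv] := df v; split=> [x Ox|].
  exact: near_eq_derivable (ne x Ox) (dv x Ox).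
apply: IH Cv => x Ox; exact: near_eq_derive (ne x Ox).
Qed.

Lemma Ck_cst k O (a : R) : Ck k O (cst a).
Proof.
elim: k a => [|k IH] a; split => //; try by move=> x _; exact: cst_continuous.
move=> v; split=> [x _|]; first exact: derivable_cst.
have -> : 'D_v (cst a) = cst 0 by apply/funext => x; rewrite derive_cst.
exact: IH.
Qed.

Lemma Ck_add k O f g : open O -> Ck k O f -> Ck k O g -> Ck k O (f + g).
Proof.
move=> oO; elim: k f g => [|k IH] f g Hf Hg.
  split => // x Ox; exact: cvgD (Ck_continuous Hf Ox) (Ck_continuous Hg Ox).
split=> [x Ox|v]; first by exact: cvgD (Ck_continuous Hf Ox) (Ck_continuous Hg Ox).
split=> [x Ox|]; first by exact: derivableD (Ck_derivable Hf Ox) (Ck_derivable Hg Ox).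
apply: Ck_eq oO _ (IH _ _ (Ck_derive v Hf) (Ck_derive v Hg)) => x Ox.
by rewrite deriveD//; [exact: Ck_derivable Hf Ox|exact: Ck_derivable Hg Ox].
Qed.

Lemma Ck_mul k O f g : open O -> Ck k O f -> Ck k O g -> Ck k O (f * g).
Proof.
move=> oO; elim: k f g => [|k IH] f g Hf Hg.
  split => // x Ox; exact: cvgM (Ck_continuous Hf Ox) (Ck_continuous Hg Ox).
split=> [x Ox|v]; first by exact: cvgM (Ck_continuous Hf Ox) (Ck_continuous Hg Ox).
split=> [x Ox|]; first by exact: derivableM (Ck_derivable Hf Ox) (Ck_derivable Hg Ox).
have := Ck_add oO (IH _ _ (CkW Hf) (Ck_derive v Hg)) (IH _ _ (CkW Hg) (Ck_derive v Hf)).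
apply: Ck_eq => // x Ox.
by rewrite deriveM//; [exact: Ck_derivable Hf Ox|exact: Ck_derivable Hg Ox].
Qed.

Lemma Ck_opp k O f : open O -> Ck k O f -> Ck k O (- f).
Proof.
move=> oO Hf; have := Ck_mul oO (Ck_cst k O (-1)) Hf.
by apply: Ck_eq => // x Ox; rewrite !fctE mulN1r.
Qed.

Lemma Ck_sum k O (I : Type) (r : seq I) (F : I -> E -> R) : open O ->
  (forall i, Ck k O (F i)) -> Ck k O (fun x => \sum_(i <- r) F i x).
Proof.
move=> oO H; elim: r => [|i r IH].
  have := Ck_cst k O 0; apply: Ck_eq => // x _; by rewrite big_nil.
by have := Ck_add oO (H i) IH; apply: Ck_eq => // x _; rewrite big_cons.
Qed.

Lemma Ck_ccoord k O i : Ck k O (ccoord i).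
Proof.
case: k => [|k]; split => //; try by move=> x _; exact: ccoord_continuous.
move=> v; split=> [x _|]; first by have [] := is_derive_ccoord i x v.
have -> : 'D_v (ccoord i) = cst (ccoord i v).
  by apply/funext => x; have [_] := is_derive_ccoord i x v.
exact: Ck_cst.
Qed.

Lemma Ck_differentiable O f x : open O -> Ck 1 O f -> O x -> differentiable f x.
Proof.
move=> oO Hf Ox; apply: differentiable_continuous_partials => v.
  exact: Ck_continuous (Ck_derive v Hf) Ox.
have := open_nbhs_nbhs (conj oO Ox); apply: filterS => y Oy; exact: Ck_derivable Hf Oy.
Qed.

Lemma derive_linear_combination f x (I : Type) (r : seq I) (a : I -> R) (v : I -> E) :
  differentiable f x ->
  'D_(\sum_(i <- r) a i *: v i) f x = \sum_(i <- r) a i * 'D_(v i) f x.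
Proof.
move=> df; rewrite deriveE// linear_sum; apply: eq_bigr => i _.
by rewrite linearZ deriveE.
Qed.

(** Only the directional derivatives of [phi] along [v] are given, so the composite is restricted to
    the curve $g(t) = \phi(tv + x)$. This curve is differentiable at 0 because its coordinates are,
    and the chain rule for total derivatives applies to it. *)
Lemma is_derive_chain f (phi : E -> E) x v : differentiable f (phi x) ->
  (forall i, derivable (ccoord i \o phi) x v) ->
  is_derive x v (f \o phi)
    (\sum_i 'D_v (ccoord i \o phi) x * 'D_(cbasis i) f (phi x)).
Proof.
move=> df dphi.
pose g (t : R) : E := phi (t *: v + x).
have g0 : g 0 = phi x by rewrite /g scale0r add0r.
have growth (F : E -> R) : (fun h : R =>
  h^-1 *: (((F \o phi) \o shift x) (h *: v) - (F \o phi) x)) =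
    (fun h : R => h^-1 *: (((F \o g) \o shift 0) (h *: (1 : R)) - (F \o g) 0)).
  by apply/funext => h /=; rewrite g0 /g addr0 [h *: 1]mulr1.
have Dg (F : E -> R) : 'D_v (F \o phi) x = 'D_1 (F \o g) 0.
  exact: (congr1 (fun G : R -> R => lim (G @ 0^')) (growth F)).
have dE (F : E -> R) : derivable (F \o phi) x v = derivable (F \o g) 0 1.
  exact: (congr1 (fun G : R -> R => cvg (G @ 0^')) (growth F)).
have dg i : derivable (ccoord i \o g) 0 1.
  by have := dphi i; rewrite dE.
have eg : g = (fun t => \sum_i (ccoord i \o g) t *: cbasis i).
  by apply/funext => t; rewrite [LHS]cbasis_sum.
have diffg : differentiable g 0.
  rewrite eg; elim: (index_enum _) => [|i r IH].
    by under eq_fun do rewrite big_nil; exact: differentiable_cst.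
  under eq_fun do rewrite big_cons.
  apply: differentiableD => //; apply: differentiableZl; exact/derivable1_diffP.
have dfg : differentiable (f \o g) 0.
  by apply: differentiable_comp; [exact: diffg|rewrite g0].
split; first by have := dfg; rewrite -derivable1_diffP dE.
rewrite Dg deriveE// diff_comp ?g0//= [X in 'd f _ X]cbasis_sum linear_sum.
apply: eq_bigr => i _; rewrite linearZ /= -(deriveE _ df) Dg.
have -> // : 'D_1 (ccoord i \o g) 0 = ccoord i ('d g 0 1).
rewrite deriveE; last exact/derivable1_diffP.
rewrite (diff_comp diffg (ccoord_differentiable i _)).
rewrite /= -deriveE; last exact: ccoord_differentiable.
by have [_ ->] := is_derive_ccoord i (g 0) ('d g 0 1).
Qed.

(** A derivative of the composite is a sum of products of $D_v\phi^i$ with $(D_i f)\circ\phi$, to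
    which the induction on [k] applies. Continuity of [phi] is a hypothesis at order 0 and is
    recovered from the coordinates at higher order. *)
Lemma Ck_comp k O O' f (phi : E -> E) : open O -> open O' ->
  (forall x, O' x -> O (phi x)) -> (forall i, Ck k O' (ccoord i \o phi)) ->
  (k = 0 -> forall x, O' x -> {for x, continuous phi}) ->
  Ck k O f -> Ck k O' (f \o phi).
Proof.
move=> oO oO' sub; elim: k f => [|k IH] f Cphi c0 Cf.
  split => // x O'x; apply: continuous_comp; first exact: c0.
  exact: Ck_continuous Cf (sub _ O'x).
have dchain x v : O' x -> is_derive x v (f \o phi)
    (\sum_i 'D_v (ccoord i \o phi) x * 'D_(cbasis i) f (phi x)).
  move=> O'x; apply: is_derive_chain.
    apply: (Ck_differentiable oO _ (sub _ O'x)).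
    by elim: (k) Cf {IH Cphi} => // m IHm /CkW.
  by move=> i; exact: Ck_derivable (Cphi i) O'x.
have contphi x : O' x -> {for x, continuous phi}.
  move=> O'x; rewrite /prop_for /continuous_at.
  rewrite [X in X @ _](_ : _ = fun y => \sum_i (ccoord i \o phi) y *: cbasis i); last first.
    by apply/funext => y; rewrite [LHS]cbasis_sum.
  rewrite [X in _ --> X]cbasis_sum; elim: (index_enum _) => [|i r IHr].
    by rewrite !big_nil; under eq_fun do rewrite big_nil; exact: cvg_cst.
  rewrite !big_cons; under eq_fun do rewrite big_cons.
  apply: cvgD => //; apply: cvgZr_tmp; exact: Ck_continuous (Cphi i) O'x.
split=> [x O'x|v].
  apply: continuous_comp; [exact: contphi|exact: Ck_continuous Cf (sub _ O'x)].
split=> [x O'x|]; first by have [] := dchain x v O'x.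
have : Ck k O' (fun x => \sum_i 'D_v (ccoord i \o phi) x * ('D_(cbasis i) f \o phi) x).
  apply: Ck_sum => // i; apply: Ck_mul => //; first exact: Ck_derive (Cphi i).
  by apply: IH => [j|_ x|]; [exact: CkW|exact: contphi|exact: Ck_derive].
by apply: Ck_eq => // x O'x; have [_ ->] := dchain x v O'x.
Qed.

End CkCalculus.

Section RingIdentities.
Variable K : comRingType.

(** In these three identities [h] stands for $1/2$, and [a], [b] stand for the coefficients $\mp i$
    of the Wirtinger operators. *)
Fact first_order_sum (h a x y x' y' : K) :
  h * (x + y + a * (x' + y')) = h * (x + a * x') + h * (y + a * y').
Proof. ring. Qed.

Fact first_order_product (h a p q p' q' f g : K) :
  h * (p * g + f * q + a * (p' * g + f * q')) =
  h * (p + a * p') * g + f * (h * (q + a * q')).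
Proof. ring. Qed.

Fact second_order_symmetric (h a b p q r s : K) :
  h * (h * (p + b * q) + a * (h * (r + b * s))) =
  h * (h * (p + a * r) + b * (h * (q + a * s))).
Proof. ring. Qed.

End RingIdentities.

(** * Wirtinger calculus for complex-valued functions *)

Section ComplexCalculus.
Variables (R : realType) (n : nat).
Local Notation E := (cspace R n).
Local Notation C := (R[i]).
Implicit Types (O : set E) (f g : E -> C) (x v w : E).

Definition is_cderive x v g (d : C) :=
  is_derive x v (fun y => complex.Re (g y)) (complex.Re d) /\
  is_derive x v (fun y => complex.Im (g y)) (complex.Im d).

Lemma is_cderive_val x v g d : is_cderive x v g d -> cderive v g x = d.
Proof. by rewrite /cderive => -[[_ ->] [_ ->]]; case: d. Qed.

Lemma is_cderive_eq x v g d d' : is_cderive x v g d -> d = d' -> is_cderive x v g d'.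
Proof. by move=> ? <-. Qed.

Lemma is_cderive_cst x v (a : C) : is_cderive x v (cst a) 0.
Proof. by split; exact: is_derive_cst. Qed.

Lemma is_cderiveD x v f g df dg :
  is_cderive x v f df -> is_cderive x v g dg -> is_cderive x v (fun y => f y + g y) (df + dg).
Proof.
move=> [f1 f2] [g1 g2]; split.
- rewrite [X in is_derive _ _ X _](_ : _ = (fun y => complex.Re (f y)) + (fun y =>
  complex.Re (g y))).
    by apply: is_derive_eq; case: (df) (dg) => ? ? [].
  by apply/funext => y; rewrite !fctE; case: (f y) (g y) => ? ? [].
- rewrite [X in is_derive _ _ X _](_ : _ = (fun y => complex.Im (f y)) + (fun y =>
  complex.Im (g y))).
    by apply: is_derive_eq; case: (df) (dg) => ? ? [].
  by apply/funext => y; rewrite !fctE; case: (f y) (g y) => ? ? [].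
Qed.

Lemma is_cderiveM x v f g df dg :
  is_cderive x v f df -> is_cderive x v g dg ->
  is_cderive x v (fun y => f y * g y) (df * g x + f x * dg).
Proof.
move=> [f1 f2] [g1 g2]; split.
- rewrite [X in is_derive _ _ X _](_ : _ =
    (fun y => complex.Re (f y)) * (fun y => complex.Re (g y)) -
    (fun y => complex.Im (f y)) * (fun y => complex.Im (g y))).
    have H := is_deriveB (is_deriveM f1 g1) (is_deriveM f2 g2); apply: (is_derive_eq H).
    case: (f x) (g x) df dg {H f1 f2 g1 g2} => [a b] [c d] [a' b'] [c' d'] /=.
    rewrite /GRing.scale /=; ring.
  by apply/funext => y; rewrite !fctE; case: (f y) (g y) => ? ? [].
- rewrite [X in is_derive _ _ X _](_ : _ =
    (fun y => complex.Re (f y)) * (fun y => complex.Im (g y)) +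
    (fun y => complex.Im (f y)) * (fun y => complex.Re (g y))).
    have H := is_deriveD (is_deriveM f1 g2) (is_deriveM f2 g1); apply: (is_derive_eq H).
    case: (f x) (g x) df dg {H f1 f2 g1 g2} => [a b] [c d] [a' b'] [c' d'] /=.
    rewrite /GRing.scale /=; ring.
  by apply/funext => y; rewrite !fctE; case: (f y) (g y) => ? ? [].
Qed.

Lemma is_cderiveZ x v (a : C) f df :
  is_cderive x v f df -> is_cderive x v (fun y => a * f y) (a * df).
Proof.
move=> Hf; have := is_cderiveM (is_cderive_cst x v a) Hf.
by move=> /is_cderive_eq; apply; rewrite mul0r add0r.
Qed.

Lemma near_eq_cderive x v f g : {near x, f =1 g} -> cderive v f x = cderive v g x.
Proof.
by move=> e; rewrite /cderive; congr (_ +i* _); apply: near_eq_derive;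
  apply: filterS e => y /= ->.
Qed.

Lemma near_eq_wirtinger j x f g : {near x, f =1 g} -> wirtinger j f x = wirtinger j g x.
Proof. by case: j => k e; rewrite /= !(near_eq_cderive _ e). Qed.

Lemma smooth_in_is_cderive O f x v : smooth_in O f -> O x -> is_cderive x v f (cderive v f x).
Proof.
move=> sf Ox; have [s1 s2] := sf 1%N.
by split; apply: DeriveDef => //; [exact: Ck_derivable s1 Ox|exact: Ck_derivable s2 Ox].
Qed.

Lemma smooth_in_sub O O' f : O' `<=` O -> smooth_in O f -> smooth_in O' f.
Proof. by move=> s Hf k; have [? ?] := Hf k; split; exact: Ck_sub s _. Qed.

Lemma smooth_in_local O f :
  (forall x, O x -> exists2 U, U x & smooth_in U f) -> smooth_in O f.
Proof.
by move=> H k; split; apply: Ck_local => x /H[U Ux /(_ k)[? ?]]; exists U.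
Qed.

Lemma smooth_in_eq O f g : open O -> (forall x, O x -> f x = g x) ->
  smooth_in O f -> smooth_in O g.
Proof.
move=> oO e Hf k; have [s1 s2] := Hf k.
by split; [apply: Ck_eq oO _ s1|apply: Ck_eq oO _ s2] => x /e ->.
Qed.

Lemma smooth_in_cst O (a : C) : smooth_in O (cst a).
Proof. by move=> k; split; exact: Ck_cst. Qed.

Lemma smooth_inD O f g : open O -> smooth_in O f -> smooth_in O g ->
  smooth_in O (fun x => f x + g x).
Proof.
move=> oO Hf Hg k; have [f1 f2] := Hf k; have [g1 g2] := Hg k; split.
- by apply: Ck_eq (Ck_add oO f1 g1) => // x _; rewrite !fctE; case: (f x) (g x) => ? ? [].
- by apply: Ck_eq (Ck_add oO f2 g2) => // x _; rewrite !fctE; case: (f x) (g x) => ? ? [].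
Qed.

Lemma smooth_inM O f g : open O -> smooth_in O f -> smooth_in O g ->
  smooth_in O (fun x => f x * g x).
Proof.
move=> oO Hf Hg k; have [f1 f2] := Hf k; have [g1 g2] := Hg k; split.
- apply: Ck_eq (Ck_add oO (Ck_mul oO f1 g1) (Ck_opp oO (Ck_mul oO f2 g2))) => // x _.
  by rewrite !fctE; case: (f x) (g x) => ? ? [].
- apply: Ck_eq (Ck_add oO (Ck_mul oO f1 g2) (Ck_mul oO f2 g1)) => // x _.
  by rewrite !fctE; case: (f x) (g x) => ? ? [].
Qed.

Lemma smooth_inZ O (a : C) f : open O -> smooth_in O f -> smooth_in O (fun x => a * f x).
Proof. by move=> oO; apply: smooth_inM => //; exact: smooth_in_cst. Qed.

Lemma smooth_in_cderive O v f : smooth_in O f -> smooth_in O (cderive v f).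
Proof. by move=> Hf k; have [f1 f2] := Hf k.+1; split; exact: Ck_derive. Qed.

Lemma smooth_in_wirtinger O j f : open O -> smooth_in O f -> smooth_in O (wirtinger j f).
Proof.
move=> oO Hf; case: j => k /=; apply: smooth_inZ => //.
  apply: smooth_in_eq (smooth_inD oO (smooth_in_cderive _ Hf)
    (smooth_inZ (- 'i%C) oO (smooth_in_cderive (dir_y R k) Hf))) => // x _.
  by rewrite mulNr.
exact: smooth_inD oO (smooth_in_cderive _ Hf) (smooth_inZ _ oO (smooth_in_cderive _ Hf)).
Qed.

Lemma zcoordE j (x : E) : zcoord j x =
  match j with inl k => (ccoord (inl k) x)%:C + 'i%C * (ccoord (inr k) x)%:C
             | inr k => (ccoord (inl k) x)%:C - 'i%C * (ccoord (inr k) x)%:C end.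
Proof. by case: j => k /=; apply/eqP; rewrite eq_complex /=; apply/andP; split; apply/eqP;
  ring. Qed.

Lemma smooth_in_zcoord O j : smooth_in O (@zcoord R n j).
Proof.
have H i k : Ck k [set: E] (@ccoord R n i) by exact: Ck_ccoord.
move=> k; apply: (fun P => conj (Ck_sub (@subsetT _ _) P.1) (Ck_sub (@subsetT _ _) P.2)).
case: j => l /=; split; try exact: (H (inl l)); try exact: (H (inr l)).
by apply: Ck_eq (Ck_opp openT (H (inr l) k)); first exact: openT.
Qed.

Lemma is_cderive_zcoord j x v : is_cderive x v (@zcoord R n j) (zcoord j v).
Proof.
case: j => l; split; try exact: (is_derive_ccoord (inl l));
  try exact: (is_derive_ccoord (inr l)).
exact: is_deriveN (is_derive_ccoord (inr l) x v).
Qed.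

Lemma smooth_in_comp O O' f (phi : E -> E) : open O -> open O' ->
  (forall x, O' x -> O (phi x)) ->
  (forall x, O' x -> {for x, continuous phi}) ->
  (forall k, smooth_in O' (fun x => zcoord (inl k) (phi x))) ->
  smooth_in O f -> smooth_in O' (f \o phi).
Proof.
move=> oO oO' sub cphi sphi sf k.
have Cphi i : Ck k O' (@ccoord R n i \o phi).
  by case: i => l; have [] := sphi l k.
by have [f1 f2] := sf k; split; [apply: Ck_comp f1|apply: Ck_comp f2].
Qed.

Lemma cderive_combination O f x (I : Type) (r : seq I) (a : I -> R) (v : I -> E) :
  open O -> smooth_in O f -> O x ->
  cderive (\sum_(i <- r) a i *: v i) f x = \sum_(i <- r) (a i)%:C * cderive (v i) f x.
Proof.
move=> oO sf Ox; have [f1 f2] := sf 1%N.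
rewrite /cderive !derive_linear_combination;
  [|exact: Ck_differentiable f2 Ox|exact: Ck_differentiable f1 Ox].
elim: r => [|i r IH]; first by rewrite !big_nil.
rewrite !big_cons -IH; apply/eqP; rewrite eq_complex /=.
by apply/andP; split; apply/eqP; ring.
Qed.

(** This is $dg = \partial g + \bar\partial g$ evaluated on a real vector; coordinate by coordinate
    it reduces to $i^2 = -1$. *)
Lemma cderive_wirtinger O f x v : open O -> smooth_in O f -> O x ->
  cderive v f x = \sum_j zcoord j v * wirtinger j f x.
Proof.
move=> oO sf Ox; rewrite {1}(cbasis_sum v) (cderive_combination _ _ _ oO sf Ox).
rewrite !big_sumType /= -!big_split /=; apply: eq_bigr => k _.
have z1 : v.1 0 k +i* v.2 0 k = (v.1 0 k)%:C + 'i%C * (v.2 0 k)%:C := zcoordE (inl k) v.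
have z2 : v.1 0 k -i* v.2 0 k = (v.1 0 k)%:C - 'i%C * (v.2 0 k)%:C := zcoordE (inr k) v.
rewrite z1 z2.
set a := cderive _ _ _; set b := cderive _ _ _; set s := _%:C; set t := _%:C.
have i2 : 'i%C * 'i%C = -1 :> C by exact: sqr_i.
have two : (2 : C) * 2^-1 = 1 by rewrite divff// pnatr_eq0.
transitivity ((2 * 2^-1) * (s * a) - 'i%C * 'i%C * (2 * 2^-1) * (t * b)); last by ring.
by rewrite i2 two; ring.
Qed.

Lemma is_cderive_chain O f (phi : E -> E) x v : open O -> smooth_in O f -> O (phi x) ->
  (forall i, derivable (@ccoord R n i \o phi) x v) ->
  is_cderive x v (f \o phi)
    (\sum_j cderive v (fun y => zcoord j (phi y)) x * wirtinger j f (phi x)).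
Proof.
move=> oO sf Ox dphi; have [f1 f2] := sf 1%N.
(* [w] is the velocity of [phi] along [v]: the real chain rule is the derivative of [f] along [w],
   which is then split into its Wirtinger parts. *)
pose w : E := (\row_k 'D_v (@ccoord R n (inl k) \o phi) x,
               \row_k 'D_v (@ccoord R n (inr k) \o phi) x).
have wi i : ccoord i w = 'D_v (@ccoord R n i \o phi) x by case: i => k; rewrite /= mxE.
have ws : \sum_i 'D_v (@ccoord R n i \o phi) x *: cbasis R i = w.
  by rewrite [RHS]cbasis_sum; apply: eq_bigr => i _; rewrite wi.
have -> : \sum_j cderive v (fun y => zcoord j (phi y)) x * wirtinger j f (phi x) =
  cderive w f (phi x).
  rewrite (cderive_wirtinger _ oO sf Ox); apply: eq_bigr => j _; congr (_ * _).
  have dw i : is_derive x v (@ccoord R n i \o phi) (ccoord i w) by rewrite wi;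
    exact: derivableP.
  apply: is_cderive_val; case: j => l; split; try exact: (dw (inl l)); try exact: (dw (inr l)).
  exact: is_deriveN (dw (inr l)).
have cw (g : E -> R) : differentiable g (phi x) ->
    \sum_i 'D_v (@ccoord R n i \o phi) x * 'D_(cbasis R i) g (phi x) = 'D_w g (phi x).
  by move=> dg; rewrite -ws derive_linear_combination.
split.
- have d1 := Ck_differentiable oO f1 Ox.
  by apply: is_derive_eq (is_derive_chain d1 dphi) _; rewrite cw.
- have d2 := Ck_differentiable oO f2 Ox.
  by apply: is_derive_eq (is_derive_chain d2 dphi) _; rewrite cw.
Qed.

(** A common shape with $a = -i$ or $a = i$, so that each rule is proved once for $\partial$ and
    $\bar\partial$ together. *)
Lemma wirtingerE j : exists k a, forall f x,
  wirtinger j f x = 2^-1 * (cderive (dir_x R k) f x + a * cderive (dir_y R k) f x).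
Proof.
by case: j => k; exists k; [exists (- 'i%C)|exists 'i%C] => f x; rewrite /= ?mulNr.
Qed.

Lemma wirtingerD O j f g x : smooth_in O f -> smooth_in O g -> O x ->
  wirtinger j (fun y => f y + g y) x = wirtinger j f x + wirtinger j g x.
Proof.
move=> sf sg Ox.
have H v := is_cderive_val (is_cderiveD (smooth_in_is_cderive v sf Ox) (smooth_in_is_cderive v sg Ox)).
have [k [a E]] := wirtingerE j; rewrite !E (H (dir_x R k)) (H (dir_y R k)).
exact: first_order_sum.
Qed.

Lemma wirtingerM O j f g x : smooth_in O f -> smooth_in O g -> O x ->
  wirtinger j (fun y => f y * g y) x = wirtinger j f x * g x + f x * wirtinger j g x.
Proof.
move=> sf sg Ox.
have H v := is_cderive_val (is_cderiveM (smooth_in_is_cderive v sf Ox) (smooth_in_is_cderive v sg Ox)).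
have [k [a E]] := wirtingerE j; rewrite !E (H (dir_x R k)) (H (dir_y R k)).
exact: first_order_product.
Qed.

Lemma wirtinger_cst j (a : C) x : wirtinger j (cst a) x = 0.
Proof.
have H v := is_cderive_val (is_cderive_cst x v a).
have [k [b E]] := wirtingerE j.
by rewrite E (H (dir_x R k)) (H (dir_y R k)) mulr0 addr0 mulr0.
Qed.

Lemma wirtinger_zcoord i j x : wirtinger i (@zcoord R n j) x = (i == j)%:R.
Proof.
have H v := is_cderive_val (is_cderive_zcoord j x v).
have i2 : 'i%C * 'i%C = -1 :> C by exact: sqr_i.
have two : 2^-1 + 2^-1 = 1 :> C by rewrite -mulr2n -[_ *+ 2]mulr_natr mulVf// pnatr_eq0.
have E (b : bool) : (b%:R : R)%:C = b%:R by case: b.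
have dx (k l : 'I_n) : (ccoord (inl l) (dir_x R k))%:C =
  (k == l)%:R :> C by rewrite /= mxE eqxx /= eq_sym.
have dx0 (k l : 'I_n) : (ccoord (inr l) (dir_x R k))%:C = 0 :> C by rewrite /= mxE.
have half (b c : C) : 2^-1 * (b + c) = 2^-1 * b + 2^-1 * c by rewrite mulrDr.
case: i j H => k [] l H; rewrite /wirtinger (H (dir_x R k)) (H (dir_y R k)).
  all: rewrite (zcoordE _ (dir_x R k)) (zcoordE _ (dir_y R k)).
  all: rewrite dx dx0.
- rewrite mulr0 addr0 add0r mulrA i2 mulN1r opprK half -mulrDl two mul1r; by [].
- by rewrite mulr0 subr0 sub0r mulrN mulrA i2 mulN1r opprK subrr mulr0.
- by rewrite mulr0 addr0 add0r mulrA i2 mulN1r subrr mulr0.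
- by rewrite mulr0 subr0 sub0r mulrN mulrA i2 mulN1r opprK half -mulrDl two mul1r.
Qed.

Lemma wirtinger_comm O i j f x : open O -> smooth_in O f -> O x ->
  wirtinger i (wirtinger j f) x = wirtinger j (wirtinger i f) x.
Proof.
move=> oO sf Ox.
have comm v w : cderive v (cderive w f) x = cderive w (cderive v f) x.
  have Sch (h : E -> R) : Ck 2 O h -> 'D_v ('D_w h) x = 'D_w ('D_v h) x.
    move=> Ch; have nO := open_nbhs_nbhs (conj oO Ox).
    apply: schwarz_symmetry.
    - by apply: filterS nO => y Oy; split; exact: Ck_derivable Ch Oy.
    - by apply: filterS nO => y Oy; split; exact: Ck_derivable (Ck_derive _ Ch) Oy.
    - exact: Ck_continuous (Ck_derive _ (Ck_derive _ Ch)) Ox.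
    - exact: Ck_continuous (Ck_derive _ (Ck_derive _ Ch)) Ox.
  have e u u' : cderive u (cderive u' f) x =
      ('D_u ('D_u' (fun y => complex.Re (f y))) x) +i* ('D_u ('D_u' (fun y =>
        complex.Im (f y))) x).
    by [].
  by have [f1 f2] := sf 2%N; rewrite !e (Sch _ f1) (Sch _ f2).
have dd v w := smooth_in_is_cderive v (smooth_in_cderive w sf) Ox.
have H v k a : cderive v (fun y => 2^-1 * (cderive (dir_x R k) f y +
  a * cderive (dir_y R k) f y)) x
  = 2^-1 * (cderive v (cderive (dir_x R k) f) x + a * cderive v (cderive (dir_y R k) f) x).
  apply: is_cderive_val; apply: is_cderiveZ.
  by apply: is_cderiveD; [exact: dd|apply: is_cderiveZ; exact: dd].
have [k [a Ei]] := wirtingerE i; have [l [b Ej]] := wirtingerE j.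
have Fi : wirtinger i f = (fun y => 2^-1 * (cderive (dir_x R k) f y +
  a * cderive (dir_y R k) f y)).
  by apply/funext => y; exact: Ei.
have Fj : wirtinger j f = (fun y => 2^-1 * (cderive (dir_x R l) f y +
  b * cderive (dir_y R l) f y)).
  by apply/funext => y; exact: Ej.
rewrite Ei Ej Fi Fj (H (dir_x R k)) (H (dir_y R k)) (H (dir_x R l)) (H (dir_y R l)).
rewrite (comm (dir_x R l) (dir_x R k)) (comm (dir_x R l) (dir_y R k)).
rewrite (comm (dir_y R l) (dir_x R k)) (comm (dir_y R l) (dir_y R k)).
exact: second_order_symmetric.
Qed.

Lemma wirtinger_chain O O' j f (phi : E -> E) x : open O -> smooth_in O f -> O (phi x) ->
  (forall k, smooth_in O' (fun y => zcoord (inl k) (phi y))) -> O' x ->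
  wirtinger j (f \o phi) x =
    \sum_i wirtinger j (fun y => zcoord i (phi y)) x * wirtinger i f (phi x).
Proof.
move=> oO sf Ox sphi O'x.
have dphi v i : derivable (@ccoord R n i \o phi) x v.
  by case: i => k; have [s1 s2] := sphi k 1%N;
    [exact: Ck_derivable s1 O'x|exact: Ck_derivable s2 O'x].
have H v := is_cderive_val (is_cderive_chain oO sf Ox (dphi v)).
have [k [a E]] := wirtingerE j; rewrite E (H (dir_x R k)) (H (dir_y R k)).
rewrite mulr_sumr -big_split mulr_sumr; apply: eq_bigr => i _ /=.
by rewrite E mulrA -mulrDl mulrA.
Qed.

End ComplexCalculus.

(** * Smooth bump functions *)

Section Bump.
Variable R : realType.
Implicit Types t s h : R.

(** The functions $t^{-k}e^{-1/t}$ are treated as a family because their span is closed under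
    differentiation; $k = 0$ is the classical flat function. *)
Definition flat (k : nat) (t : R) : R := if 0 < t then t ^- k * expR (- t^-1) else 0.

(** With $s = 1/t$, raising $e^{s/(k+1)} \ge s/(k+1)$ to the power $k+1$ bounds $e^{-s}$ by
    $(k+1)^{k+1}t^{k+1}$. *)
Lemma flat_le k t : `|flat k t| <= k.+1%:R ^+ k.+1 * `|t|.
Proof.
rewrite /flat; case: ifPn => [t0|_]; last by rewrite normr0 mulr_ge0// exprn_ge0.
have s0 : 0 < t^-1 by rewrite invr_gt0.
rewrite !gtr0_norm// ?mulr_gt0 ?expR_gt0 ?invr_gt0 ?exprn_gt0//.
rewrite expRN ler_pdivrMr ?expR_gt0//.
have H : (t^-1 / k.+1%:R) ^+ k.+1 <= expR t^-1.
  have -> : expR t^-1 = expR (t^-1 / k.+1%:R) ^+ k.+1.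
    by rewrite -expRM_natl mulrC divfK// pnatr_eq0.
  apply: lerXn2r; rewrite ?nnegrE ?expR_ge0 ?divr_ge0 ?ltW//.
  by apply: le_lt_trans (expR_gt1Dx _); rewrite ?lerDr// gt_eqF// divr_gt0.
apply: le_trans (_ : k.+1%:R ^+ k.+1 * t * (t^-1 / k.+1%:R) ^+ k.+1 <= _); last first.
  by rewrite ler_wpM2l// mulr_ge0 ?exprn_ge0 ?ltW.
rewrite exprMn [_ * k.+1%:R^-1 ^+ _]mulrC exprVn mulrACA divff ?expf_neq0 ?pnatr_eq0// mul1r.
by rewrite exprVn exprS invfM mulVKf ?gt_eqF.
Qed.

Lemma is_derive_flat k t : is_derive t 1 (flat k) (flat k.+2 t - k%:R * flat k.+1 t).
Proof.
have [t0|t0|->] := ltgtP t 0.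
- have E : \forall s \near t, cst 0 s = flat k s.
    have := open_nbhs_nbhs (conj (@open_lt R 0) t0).
    by apply: filterS => s /= s0; rewrite /flat ltNge (ltW s0).
  have := near_eq_is_derive E (is_derive_cst (0 : R) t (1 : R)).
  by rewrite /flat ltNge (ltW t0) /= mulr0 subr0.
- have E : \forall s \near t, ((fun s : R => s^-1) ^+ k * (expR \o - (fun s : R =>
  s^-1))) s = flat k s.
    have := open_nbhs_nbhs (conj (@open_gt R 0) t0).
    by apply: filterS => s /= s0; rewrite /flat s0 !fctE /= exprVn.
  have dV : is_derive t 1 (fun s : R => s^-1) (- t ^- 2).
    have := @is_deriveV R id t 1 1 (lt0r_neq0 t0) (is_derive_id _ _).
    by rewrite [_ *: _]mulr1.
  have := near_eq_is_derive E (is_deriveM (is_deriveX k dV)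
    (is_derive1_comp (is_derive_expR _) (is_deriveN dV))).
  move=> /is_derive_eq; apply; rewrite /flat t0 /GRing.scale /= opprK.
  rewrite !fctE /= -!exprVn; move: (expR _) => e; case: (k) => [|m] /=; first by ring.
  by rewrite !exprS; ring.
(* At 0 the difference quotient of [flat k] is exactly [flat k.+1], which tends to 0 by
   [flat_le]. *)
- rewrite /flat ltxx mulr0 subr0 -/(flat k).
  have cv : (fun h : R =>
    h^-1 *: ((flat k \o shift 0) (h *: (1 : R)) - flat k 0)) @ 0^' --> (0 : R).
    have E h : h^-1 *: ((flat k \o shift 0) (h *: (1 : R)) - flat k 0) = flat k.+1 h.
      rewrite /= addr0 [h *: 1]mulr1 /flat ltxx subr0; case: ifP => h0; last exact: mulr0.
      by rewrite exprS invfM [_ *: _]mulrA.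
    under eq_fun do rewrite E.
    apply/cvgr0Pnorm_le => e e0; near=> h.
    apply: le_trans (flat_le _ _) _; rewrite -ler_pdivlMl ?exprn_gt0//.
    near: h; apply: dnbhs0_le; by rewrite mulr_gt0// invr_gt0 exprn_gt0.
  split; first by apply/cvg_ex; exists 0.
  exact: cvg_lim.
Unshelve. all: by end_near. Qed.

Lemma flat_eq0 k t : t <= 0 -> flat k t = 0.
Proof. by move=> t0; rewrite /flat ltNge t0. Qed.

Lemma flat_gt0 k t : 0 < t -> 0 < flat k t.
Proof. by move=> t0; rewrite /flat t0 mulr_gt0 ?expR_gt0// invr_gt0 exprn_gt0. Qed.

Lemma flat0_ge1 t : 1 <= t -> flat 0 1 <= flat 0 t.
Proof.
move=> t1; have t0 : 0 < t by lra.
by rewrite /flat ltr01 t0 !expr0 !invr1 !mul1r ler_expR lerN2 invf_le1.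
Qed.

End Bump.

Section BumpE.
Variables (R : realType) (n : nat).
Local Notation E := (cspace R n).

(** Differentiation raises the index [k], so the induction on the smoothness order [m] is carried
    out for all [k] at once. *)
Lemma Ck_flat m k (O : set E) (q : E -> R) : open O -> Ck m O q -> Ck m O (flat k \o q).
Proof.
move=> oO; elim: m k => [|m IH] k Cq.
  split => // x Ox; apply: continuous_comp; first exact: Ck_continuous Cq Ox.
  apply: differentiable_continuous; apply/derivable1_diffP.
  by have [] := is_derive_flat k (q x).
have D x v : O x -> is_derive x v (flat k \o q)
    ('D_v q x * (flat k.+2 (q x) - k%:R * flat k.+1 (q x))).
  move=> Ox; have [d1 d2] := is_derive_flat k (q x).
  have dq : differentiable q x.
    apply: Ck_differentiable oO _ Ox; elim: (m) Cq {IH} => [|p IHp Cq]; first by apply.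
    by apply: IHp; exact: CkW.
  have df : differentiable (flat k) (q x) by apply/derivable1_diffP.
  split; first by apply: diff_derivable; exact: differentiable_comp.
  rewrite deriveE; last exact: differentiable_comp.
  by rewrite (diff_comp dq df) [LHS]/= -(deriveE _ dq) (diff1E df) derive1E d2.
split=> [x Ox|v].
  apply: continuous_comp; first exact: Ck_continuous Cq Ox.
  apply: differentiable_continuous; apply/derivable1_diffP.
  by have [] := is_derive_flat k (q x).
split=> [x Ox|]; first by have [] := D x v Ox.
have C2 := IH k.+2 (CkW Cq); have C1 := IH k.+1 (CkW Cq).
have := Ck_mul oO (Ck_derive v Cq) (Ck_add oO C2 (Ck_mul oO (Ck_cst m O (- k%:R)) C1)).
apply: Ck_eq => // x Ox; have [_ ->] := D x v Ox.
by rewrite !fctE mulNr.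
Qed.

Lemma cspace_norm_le (x : E) (a : R) : 0 <= a -> (forall i, `|ccoord i x| <= a) -> `|x| <= a.
Proof.
move=> a0 H; rewrite [leLHS]/Num.norm/= ge_max; apply/andP; split.
  rewrite [leLHS]/Num.Def.normr/= mx_normrE; apply: bigmax_le => // -[i j] _.
  by rewrite (ord1 i); exact: (H (inl j)).
rewrite [leLHS]/Num.Def.normr/= mx_normrE; apply: bigmax_le => // -[i j] _.
by rewrite (ord1 i); exact: (H (inr j)).
Qed.

Lemma smooth_bump (x0 : E) (O : set E) : open O -> O x0 ->
  exists (chi : E -> R) (B : set E),
    [/\ forall k, Ck k [set: E] chi, compact B, B `<=` O,
        forall x, ~ B x -> chi x = 0 & \forall x \near x0, chi x = 1].
Proof.
move=> oO Ox0.
have [r /= r0 Hr] := (nbhs_ballP _ _).1 (open_nbhs_nbhs (conj oO Ox0)).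
(* The norm of the coordinate space is a maximum and hence not smooth; the squared Euclidean
   distance takes its place. *)
pose Q (x : E) : R := \sum_i (ccoord i x - ccoord i x0) * (ccoord i x - ccoord i x0).
have Q0 x i : (ccoord i x - ccoord i x0) ^+ 2 <= Q x.
  rewrite /Q (bigD1 i)//= expr2 lerDl; apply: sumr_ge0 => j _; exact: sqr_ge0.
have CQ k : Ck k [set: E] Q.
  apply: Ck_sum openT _ => i.
  have := Ck_add openT (Ck_ccoord k setT i) (Ck_cst k setT (- ccoord i x0)).
  by move=> Hi; exact: (Ck_mul openT Hi Hi).
pose rho : R := r / 2.
have rho0 : 0 < rho by rewrite divr_gt0.
pose G := @flat R 0.
(* [q1] is at most 0 where $Q \le \rho^2/2$ and at least 1 where $Q \ge \rho^2$. Hence [q2] equals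
   [G 1] on the first region and is at most 0 on the second, and applying [G] once more, normalised,
   yields the values 1 and 0. *)
pose q1 (x : E) : R := (rho ^+ 2 / 2)^-1 * Q x - 1.
pose q2 (x : E) : R := G 1 - G (q1 x).
pose chi (x : E) : R := (G (G 1))^-1 * G (q2 x).
have G1 : 0 < G 1 by apply: flat_gt0.
have GG1 : 0 < G (G 1) by apply: flat_gt0.
(* The box of half-side [rho] is compact as a product of segments, contains every point with $Q <
   \rho^2$, and fits into the ball of radius $r = 2\rho$ for the maximum norm. *)
exists chi, [set x : E | forall i, x.1 0 i \in `[x0.1 0 i - rho, x0.1 0 i + rho]
   /\ x.2 0 i \in `[x0.2 0 i - rho, x0.2 0 i + rho]].
have c1 x : Q x <= rho ^+ 2 / 2 -> chi x = 1.
  move=> Qx; rewrite /chi /q2 [G (q1 x)]flat_eq0 ?subr0 ?mulVf ?gt_eqF//.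
  by rewrite /q1 subr_le0 mulrC ler_pdivrMr ?mul1r// divr_gt0// exprn_gt0.
have c0 x : rho ^+ 2 <= Q x -> chi x = 0.
  move=> Qx; rewrite /chi [G (q2 x)]flat_eq0 ?mulr0// /q2 subr_le0; apply: flat0_ge1.
  rewrite /q1 lerBrDr mulrC ler_pdivlMr ?divr_gt0 ?exprn_gt0//; lra.
split.
- move=> k.
  have C1 : Ck k [set: E] q1.
    exact: Ck_add openT (Ck_mul openT (Ck_cst k setT (rho ^+ 2 / 2)^-1) (CQ k)) (Ck_cst k setT (-1)).
  have C2 : Ck k [set: E] q2.
    exact: Ck_add openT (Ck_cst k setT (G 1)) (Ck_opp openT (Ck_flat 0 openT C1)).
  exact: Ck_mul openT (Ck_cst k setT _) (Ck_flat 0 openT C2).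
- pose A1 : set 'rV[R]_n := [set v | forall i, v 0 i \in `[x0.1 0 i - rho, x0.1 0 i + rho]].
  pose A2 : set 'rV[R]_n := [set v | forall i, v 0 i \in `[x0.2 0 i - rho, x0.2 0 i + rho]].
  have cA1 : compact A1.
    apply: (@rV_compact R n (fun i => `[x0.1 0 i - rho, x0.1 0 i + rho]%classic)) => i.
    exact: segment_compact.
  have cA2 : compact A2.
    apply: (@rV_compact R n (fun i => `[x0.2 0 i - rho, x0.2 0 i + rho]%classic)) => i.
    exact: segment_compact.
  rewrite [X in compact X](_ : _ = A1 `*` A2); first exact: compact_setX.
  apply/seteqP; split=> x /= => [H|[H1 H2] i]; last by split; [exact: H1|exact: H2].
  by split=> i; have [] := H i.
- move=> x Hx; apply: Hr; rewrite -ball_normE /ball_/=.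
  apply: (@le_lt_trans _ _ rho); last by rewrite /rho; lra.
  rewrite distrC; apply: cspace_norm_le; first exact: ltW.
  by move=> i; have [] := Hx (match i with inl k => k | inr k => k end); case: i => k;
    rewrite !in_itv /= !mxE ler_norml => /andP[? ?] /andP[? ?]; apply/andP; lra.
- move=> x nB; apply: c0; rewrite leNgt; apply/negP => Qx; apply: nB => i.
  have Hc j : `|ccoord j x - ccoord j x0| <= rho.
    rewrite -(@ler_pXn2r _ 2) ?nnegrE ?(ltW rho0)// real_normK ?num_real//.
    exact: le_trans (Q0 x j) (ltW Qx).
  have := Hc (inl i); have := Hc (inr i).
  by rewrite !in_itv /= !ler_norml => /andP[? ?] /andP[? ?]; split; apply/andP; lra.
- have cQ : {for x0, continuous Q} by exact: Ck_continuous (CQ 0%N) _.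
  have Qx0 : Q x0 < rho ^+ 2 / 2.
    by rewrite /Q big1 ?divr_gt0 ?exprn_gt0// => i _; rewrite subrr mul0r.
  by apply: (filterS _ (cvgr_lt (Q x0) cQ _ Qx0)) => x /ltW; exact: c1.
Qed.
End BumpE.

(** * Calculus on complex manifolds *)

Section ManifoldCalculus.
Variables (R : realType) (n : nat) (M : complexManifold R n).
Local Notation C := (R[i]).
Local Notation fn := (M -> C).
Local Notation chart := (chart R n M).
Local Notation index := (cindex n).
Local Notation E := (cspace R n).
Implicit Types (c : chart) (p q : M) (f g : fn) (U V : set M) (i j : index).

Lemma near_open p (P : set M) : (\forall q \near p, P q) ->
  exists V, [/\ open V, V p & forall q, V q -> P q].
Proof.
move=> e; have : nbhs p [set q | P q] by [].
by rewrite nbhsE => -[V [oV Vp] sV]; exists V.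
Qed.

Lemma open_near U p : open U -> U p -> \forall q \near p, U q.
Proof. by move=> oU Up; exact: open_nbhs_nbhs. Qed.

Lemma cinv_near c p (P : set M) : cdom c p -> (\forall q \near p, P q) ->
  \forall x \near cmap c p, P (cinv c x).
Proof.
move=> cp Pp; have ip : (cmap c @` cdom c) (cmap c p) by exists p.
have H := chart_inv_continuous ip.
rewrite /prop_for /continuous_at chart_cancel// in H; exact: (H _ Pp).
Qed.

Lemma cmap_near c p (P : set E) : cdom c p -> (\forall x \near cmap c p, P x) ->
  \forall q \near p, P (cmap c q).
Proof. move=> cp Px; have H := chart_map_continuous cp.
by rewrite /prop_for /continuous_at in H; exact: (H _ Px). Qed.

Lemma cdom_near c p : cdom c p -> \forall q \near p, cdom c q.
Proof. by move=> cp; exact: open_nbhs_nbhs (conj (chart_dom_open c) cp). Qed.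

Lemma chart_range_near c p : cdom c p -> \forall x \near cmap c p, (cmap c @` cdom c) x.
Proof.
by move=> cp; apply: open_nbhs_nbhs; split; [exact: chart_img_open|exists p].
Qed.

Lemma chart_image_open c U : open U -> open (cmap c @` (cdom c `&` U)).
Proof.
move=> oU; rewrite openE => _ [p [cp Up] <-].
have n2 := cinv_near cp (open_near oU Up).
apply: filterS (filterI (chart_range_near cp) n2) => y [[q cq <-]].
by rewrite chart_cancel// => Uq; exists q.
Qed.

Lemma chart_near c p (P : set M) : cdom c p -> (\forall q \near p, P q) ->
  \forall x \near cmap c p, cdom c (cinv c x) /\ P (cinv c x).
Proof. by move=> cp Pp; exact: cinv_near (filterI (cdom_near cp) Pp). Qed.

Lemma transition_smooth c c' : holo c -> holo c' -> forall k,
  smooth_in (cmap c @` (cdom c `&` cdom c')) (fun x => zcoord (inl k) (cmap c' (cinv c x))).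
Proof. by move=> hc hc' k; have [H _] := holo_compatible hc hc'; have [] := H k. Qed.

Lemma transition_continuous c c' x : (cmap c @` (cdom c `&` cdom c')) x ->
  {for x, continuous (cmap c' \o cinv c)}.
Proof.
move=> [p [cp c'p] <-]; apply: continuous_comp.
  by apply: chart_inv_continuous; exists p.
by rewrite chart_cancel//; exact: chart_map_continuous.
Qed.

Lemma smooth_on_sub U V f : V `<=` U -> smooth_on U f -> smooth_on V f.
Proof.
by move=> VU sf c hc; apply: smooth_in_sub (sf c hc) => _ [p [cp /VU Up] <-]; exists p.
Qed.

Lemma smooth_on_near U f p : open U -> U p -> smooth_on U f -> smooth_near p f.
Proof. by move=> oU Up sf; exists U. Qed.

Lemma smooth_on_local U f : (forall p, U p -> smooth_near p f) -> smooth_on U f.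
Proof.
move=> H c hc; apply: smooth_in_local => _ [p [cp Up] <-].
have [V [oV Vp sf]] := H p Up; exists (cmap c @` (cdom c `&` V)); last exact: sf.
by exists p.
Qed.

(** One chart suffices: in any other chart the function is composed with a smooth transition map. *)
Lemma smooth_near_chart c p f (O : set E) : holo c -> cdom c p -> open O -> O (cmap c p) ->
  smooth_in O (fun x => f (cinv c x)) -> smooth_near p f.
Proof.
move=> hc cp oO Ox sf.
pose U : set M := cdom c `&` (cmap c @^-1` O).
have oU : open U.
  rewrite openE => q [cq Oq].
  by apply: filterI; [exact: cdom_near|apply: cmap_near => //; exact: open_nbhs_nbhs].
exists U; split=> // c' hc'.
have o1 : open (cmap c' @` (cdom c' `&` U)) := chart_image_open oU.
have s1 : smooth_in (cmap c' @` (cdom c' `&` U))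
    ((fun x => f (cinv c x)) \o (cmap c \o cinv c')).
  apply: smooth_in_comp oO o1 _ _ _ sf.
  - by move=> _ [q [c'q [cq Oq]] <-] /=; rewrite chart_cancel.
  - by move=> x [q [c'q [cq Oq]] <-]; apply: transition_continuous; exists q.
  - move=> k; apply: smooth_in_sub (transition_smooth hc' hc k).
    by move=> _ [q [c'q [cq Oq]] <-]; exists q.
by apply: smooth_in_eq o1 _ s1 => _ [q [c'q [cq Oq]] <-] /=; rewrite !chart_cancel.
Qed.

Lemma smooth_near_eq p f g : (\forall q \near p, f q = g q) -> smooth_near p f ->
  smooth_near p g.
Proof.
move=> e [U [oU Up sf]].
have [V [oV Vp Ve]] := near_open e.
exists (U `&` V); split; [exact: openI|by []|] => c hc.
apply: smooth_in_eq (smooth_on_sub (@subIsetl _ _ _) sf hc).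
  by apply: chart_image_open; exact: openI.
by move=> _ [q [cq [Uq Vq]] <-]; rewrite chart_cancel// Ve.
Qed.

Lemma smooth_near_open p f : smooth_near p f -> \forall q \near p, smooth_near q f.
Proof.
by move=> [U [oU Up sf]]; apply: filterS (open_nbhs_nbhs (conj oU Up)) => q Uq; exists U.
Qed.

Lemma smooth_near_common p f g : smooth_near p f -> smooth_near p g ->
  exists U, [/\ open U, U p, smooth_on U f & smooth_on U g].
Proof.
move=> [U [oU Up sf]] [V [oV Vp sg]]; exists (U `&` V); split => //; first exact: openI.
  exact: smooth_on_sub (@subIsetl _ _ _) sf.
exact: smooth_on_sub (@subIsetr _ _ _) sg.
Qed.

Lemma smooth_on_cst U (a : C) : smooth_on U (fun _ => a).
Proof. by move=> c _; exact: smooth_in_cst. Qed.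

Lemma smooth_near_cst p (a : C) : smooth_near p (fun _ => a).
Proof. by exists setT; split => //; [exact: openT|exact: smooth_on_cst]. Qed.

Lemma smooth_nearD p f g : smooth_near p f -> smooth_near p g ->
  smooth_near p (fun q => f q + g q).
Proof.
move=> sf sg; have [U [oU Up {}sf {}sg]] := smooth_near_common sf sg.
exists U; split => // c hc.
exact: smooth_inD (chart_image_open oU) (sf c hc) (sg c hc).
Qed.

Lemma smooth_nearM p f g : smooth_near p f -> smooth_near p g ->
  smooth_near p (fun q => f q * g q).
Proof.
move=> sf sg; have [U [oU Up {}sf {}sg]] := smooth_near_common sf sg.
exists U; split => // c hc.
exact: smooth_inM (chart_image_open oU) (sf c hc) (sg c hc).
Qed.

Lemma smooth_nearN p f : smooth_near p f -> smooth_near p (fun q => - f q).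
Proof.
move=> sf; have := smooth_nearM (smooth_near_cst p (-1)) sf.
by apply: smooth_near_eq; apply: nearW => q; rewrite mulN1r.
Qed.

Lemma smooth_near_sum p (I : Type) (r : seq I) (P : pred I) (F : I -> fn) :
  (forall k, P k -> smooth_near p (F k)) -> smooth_near p (fun q => \sum_(k <- r | P k) F k q).
Proof.
move=> H; elim: r => [|k r IH].
  by apply: smooth_near_eq (smooth_near_cst p 0); apply: nearW => q; rewrite big_nil.
case: (boolP (P k)) => Pk.
  apply: smooth_near_eq (smooth_nearD (H k Pk) IH).
  by apply: nearW => q; rewrite big_cons Pk.
by apply: smooth_near_eq IH; apply: nearW => q; rewrite big_cons (negbTE Pk).
Qed.

Lemma smooth_near_in c p f : holo c -> cdom c p -> smooth_near p f ->
  exists O : set E, [/\ open O, O (cmap c p), smooth_in O (fun x => f (cinv c x)) &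
    O `<=` cmap c @` cdom c].
Proof.
move=> hc cp [U [oU Up sf]]; exists (cmap c @` (cdom c `&` U)).
split; [exact: chart_image_open|by exists p|exact: sf|by move=> _ [q [? _] <-]; exists q].
Qed.

Lemma smooth_near_in2 c p f g : holo c -> cdom c p -> smooth_near p f -> smooth_near p g ->
  exists O : set E, [/\ open O, O (cmap c p), smooth_in O (fun x => f (cinv c x)) &
    smooth_in O (fun x => g (cinv c x))].
Proof.
move=> hc cp sf sg; have [U [oU Up {}sf {}sg]] := smooth_near_common sf sg.
exists (cmap c @` (cdom c `&` U)).
by split; [exact: chart_image_open|exists p|exact: sf|exact: sg].
Qed.

Lemma partial_eq c p i f g : cdom c p -> (\forall q \near p, f q = g q) ->
  partial c i f p = partial c i g p.
Proof.
move=> cp e; apply: near_eq_wirtinger.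
by apply: filterS (chart_near cp e) => x [].
Qed.

Lemma partial_eq_near c p i f g : cdom c p -> (\forall q \near p, f q = g q) ->
  \forall q \near p, partial c i f q = partial c i g q.
Proof.
move=> cp /near_open[V [oV Vp sV]].
apply: filterS (filterI (cdom_near cp) (open_near oV Vp)) => q [cq Vq].
by apply: partial_eq => //; apply: filterS sV (open_near oV Vq).
Qed.

Lemma partial_cst c i (a : C) p : partial c i (fun _ => a) p = 0.
Proof. exact: wirtinger_cst. Qed.

Lemma partialD c p i f g : holo c -> cdom c p -> smooth_near p f -> smooth_near p g ->
  partial c i (fun q => f q + g q) p = partial c i f p + partial c i g p.
Proof.
move=> hc cp sf sg; have [W [oO Ox s1 s2]] := smooth_near_in2 hc cp sf sg.
exact: wirtingerD s1 s2 Ox.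
Qed.

Lemma partialM c p i f g : holo c -> cdom c p -> smooth_near p f -> smooth_near p g ->
  partial c i (fun q => f q * g q) p = partial c i f p * g p + f p * partial c i g p.
Proof.
move=> hc cp sf sg; have [W [oO Ox s1 s2]] := smooth_near_in2 hc cp sf sg.
by rewrite /partial (wirtingerM _ s1 s2 Ox) chart_cancel.
Qed.

Lemma partialZ c p i (a : C) f : holo c -> cdom c p -> smooth_near p f ->
  partial c i (fun q => a * f q) p = a * partial c i f p.
Proof.
move=> hc cp sf; rewrite partialM ?partial_cst ?mul0r ?add0r//; exact: smooth_near_cst.
Qed.

Lemma partialN c p i f : holo c -> cdom c p -> smooth_near p f ->
  partial c i (fun q => - f q) p = - partial c i f p.
Proof.
move=> hc cp sf; rewrite -[RHS]mulN1r -(partialZ i (-1) hc cp sf).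
by apply: partial_eq => //; apply: nearW => q; rewrite mulN1r.
Qed.

Lemma partial_sum c p i (I : Type) (r : seq I) (P : pred I) (F : I -> fn) : holo c ->
  cdom c p ->
  (forall k, P k -> smooth_near p (F k)) ->
  partial c i (fun q => \sum_(k <- r | P k) F k q) p = \sum_(k <- r | P k) partial c i (F k) p.
Proof.
move=> hc cp H; elim: r => [|k r IH].
  rewrite big_nil -[RHS](partial_cst c i 0 p); apply: partial_eq => //.
  by apply: nearW => q; rewrite big_nil.
rewrite big_cons; case: ifPn => Pk.
  rewrite -IH -partialD//; [|exact: H|exact: smooth_near_sum].
  by apply: partial_eq => //; apply: nearW => q; rewrite big_cons Pk.
rewrite -IH; apply: partial_eq => //.
by apply: nearW => q; rewrite big_cons (negbTE Pk).
Qed.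

Lemma smooth_near_partial c p i f : holo c -> cdom c p -> smooth_near p f ->
  smooth_near p (partial c i f).
Proof.
move=> hc cp sf; have [W [oO Ox s1 sub]] := smooth_near_in hc cp sf.
apply: (smooth_near_chart hc cp oO Ox).
apply: smooth_in_eq oO _ (smooth_in_wirtinger i oO s1) => x /sub[q cq <-].
by rewrite /partial chart_cancel.
Qed.

Lemma partial_comm c p i j f : holo c -> cdom c p -> smooth_near p f ->
  partial c i (partial c j f) p = partial c j (partial c i f) p.
Proof.
move=> hc cp sf; have [W [oO Ox s1 sub]] := smooth_near_in hc cp sf.
have e k : {near cmap c p, (fun x => partial c k f (cinv c x)) =1 wirtinger k (fun x =>
  f (cinv c x))}.
  apply: filterS (open_nbhs_nbhs (conj oO Ox)) => x /sub[q cq <-].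
  by rewrite /partial chart_cancel.
rewrite [LHS](near_eq_wirtinger _ (e j)) [RHS](near_eq_wirtinger _ (e i)).
exact: wirtinger_comm oO s1 Ox.
Qed.

Lemma smooth_near_coordf c p i : holo c -> cdom c p -> smooth_near p (coordf c i).
Proof.
move=> hc cp; have oO := @chart_img_open _ _ _ c.
have Ox : (cmap c @` cdom c) (cmap c p) by exists p.
apply: (smooth_near_chart hc cp oO Ox).
apply: smooth_in_eq oO _ (smooth_in_zcoord _ i) => _ [q cq <-].
by rewrite /coordf chart_cancel.
Qed.

Lemma partial_coordf c p i j : cdom c p -> partial c i (coordf c j) p = (i == j)%:R.
Proof.
move=> cp; rewrite -(wirtinger_zcoord i j (cmap c p)); apply: near_eq_wirtinger.
have Ox : (cmap c @` cdom c) (cmap c p) by exists p.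
apply: filterS (chart_range_near cp) => _ [q cq <-].
by rewrite /coordf chart_cancel.
Qed.

Lemma partial_chain c c' p i f : holo c -> holo c' -> cdom c p -> cdom c' p ->
  smooth_near p f ->
  partial c i f p = \sum_j partial c i (coordf c' j) p * partial c' j f p.
Proof.
move=> hc hc' cp c'p sf.
have [W [oO Ox s1 sub]] := smooth_near_in hc' c'p sf.
have e1 : {near cmap c p, (fun x => f (cinv c x)) =1
    (fun x => f (cinv c' x)) \o (cmap c' \o cinv c)}.
  have := chart_near cp (open_nbhs_nbhs (conj (chart_dom_open c') c'p)).
  by apply: filterS => x [cx c'x] /=; rewrite chart_cancel.
rewrite [LHS](near_eq_wirtinger _ e1).
have Ox' : W ((cmap c' \o cinv c) (cmap c p)) by rewrite /= chart_cancel.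
have px : (cmap c @` (cdom c `&` cdom c')) (cmap c p) by exists p.
rewrite (wirtinger_chain i oO s1 Ox' (transition_smooth hc hc') px).
by apply: eq_bigr => j _; rewrite /partial /= chart_cancel.
Qed.

(** A bump function of the chart image is pulled back and extended by zero, and multiplication by it
    extends functions given on [U] only. *)
Lemma cutoff U p : open U -> U p -> exists chi : fn,
  [/\ smooth_on setT chi, \forall q \near p, chi q = 1 &
    forall f, smooth_on U f -> smooth_on setT (fun q => chi q * f q)].
Proof.
move=> oU Up; have [c hc cp] := holo_cover p.
pose O := cmap c @` (cdom c `&` U).
have oO : open O by exact: chart_image_open.
have Ox : O (cmap c p) by exists p.
have [psi [B [Cpsi cB BO psi0 psi1]]] := smooth_bump oO Ox.
pose S := cinv c @` B.
have SU q : S q -> cdom c q /\ U q.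
  by move=> [_ /BO [q' [cq' Uq'] <-] <-]; rewrite chart_cancel.
have cS : compact S.
  apply: continuous_compact cB; apply: continuous_in_subspaceT => x.
  rewrite inE => /BO [q [cq Uq] <-]; apply: chart_inv_continuous; by exists q.
(* Hausdorff separation makes the compact set [S] closed in the whole manifold, so each point
   outside it has a neighbourhood on which [chi] vanishes. This gives smoothness beyond the
   chart. *)
have clS : closed S := compact_closed (@cm_hausdorff _ _ M) cS.
pose chi : fn := fun q => if asbool (cdom c q) then (psi (cmap c q))%:C else 0.
have chi0 q : ~ S q -> chi q = 0.
  move=> nS; rewrite /chi; case: ifP => // /asboolP cq; rewrite psi0//.
  by move=> Bq; apply: nS; exists (cmap c q) => //; rewrite chart_cancel.
have schi q : cdom c q -> smooth_near q chi.
  move=> cq; have oI := @chart_img_open _ _ _ c.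
  have Iq : (cmap c @` cdom c) (cmap c q) by exists q.
  apply: (smooth_near_chart hc cq oI Iq).
  apply: (@smooth_in_eq _ _ _ (fun x => (psi x)%:C)) => //.
    by move=> _ [q' cq' <-]; rewrite chart_cancel// /chi ifT//; exact/asboolP.
  by move=> k; split; [exact: Ck_sub (@subsetT _ _) (Cpsi k)|exact: Ck_cst].
have zero q f : ~ S q -> smooth_near q (fun q => chi q * f q).
  move=> nS; apply: smooth_near_eq (smooth_near_cst q 0).
  have oS : open (~` S) by exact: closed_openC.
  by apply: filterS (open_nbhs_nbhs (conj oS nS)) => q' /chi0 ->; rewrite mul0r.
exists chi; split.
- apply: smooth_on_local => q _; have [Sq|nSq] := pselect (S q).
    by apply: schi; have [] := SU q Sq.
  apply: smooth_near_eq (zero q (fun _ => 1) nSq).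
  by apply: nearW => q'; rewrite mulr1.
- have n1 := open_nbhs_nbhs (conj (chart_dom_open c) cp).
  have n2 : \forall q \near p, psi (cmap c q) = 1.
    exact: (@cmap_near c p (fun x => psi x = 1)).
  apply: filterS (filterI n1 n2) => q [cq e].
  by rewrite /chi e ifT//; exact/asboolP.
- move=> f sf; apply: smooth_on_local => q _; have [Sq|nSq] := pselect (S q).
    have [cq Uq] := SU q Sq.
    by apply: smooth_nearM; [exact: schi|exact: smooth_on_near sf].
  exact: zero.
Qed.

End ManifoldCalculus.

(** * Vector fields acting on germs *)

Section VectorFields.
Variables (R : realType) (n : nat) (M : complexManifold R n) (X : vfield M).
Local Notation C := (R[i]).
Local Notation fn := (M -> C).
Implicit Types (c : chart R n M) (p q : M) (f g : fn).

Lemma vfield_chart c p f : holo c -> cdom c p -> smooth_near p f ->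
  X f p = \sum_j vcomp X c j p * partial c j f p.
Proof. by move=> hc cp sf; rewrite (vfield_local _ hc cp sf). Qed.

Lemma smooth_near_vcomp c p j : holo c -> cdom c p -> smooth_near p (vcomp X c j).
Proof.
by move=> hc cp; exists (cdom c); split => //; [exact: chart_dom_open|exact: vfield_smooth].
Qed.

Lemma vfield_eq p f g : smooth_near p f -> (\forall q \near p, f q = g q) -> X f p = X g p.
Proof.
move=> sf e; have [c hc cp] := holo_cover p.
rewrite (vfield_chart hc cp sf) (vfield_chart hc cp (smooth_near_eq e sf)).
by apply: eq_bigr => j _; rewrite (partial_eq j cp e).
Qed.

Lemma smooth_near_vfield p f : smooth_near p f -> smooth_near p (X f).
Proof.
move=> sf; have [c hc cp] := holo_cover p.
apply: (@smooth_near_eq _ _ _ _ (fun q => \sum_j vcomp X c j q * partial c j f q)).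
  apply: filterS (filterI (cdom_near cp) (smooth_near_open sf)) => q [cq sq].
  by rewrite (vfield_chart hc cq sq).
apply: smooth_near_sum => j _; apply: smooth_nearM; first exact: smooth_near_vcomp.
exact: smooth_near_partial.
Qed.

Lemma vfieldD p f g : smooth_near p f -> smooth_near p g ->
  X (fun q => f q + g q) p = X f p + X g p.
Proof.
move=> sf sg; have [c hc cp] := holo_cover p.
rewrite !(vfield_chart hc cp)//; last exact: smooth_nearD.
by rewrite -big_split; apply: eq_bigr => j _; rewrite (partialD j hc cp sf sg) mulrDr.
Qed.

Lemma vfieldM p f g : smooth_near p f -> smooth_near p g ->
  X (fun q => f q * g q) p = X f p * g p + f p * X g p.
Proof.
move=> sf sg; have [c hc cp] := holo_cover p.
rewrite !(vfield_chart hc cp)//; last exact: smooth_nearM.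
rewrite mulr_suml mulr_sumr -big_split; apply: eq_bigr => j _.
by rewrite (partialM j hc cp sf sg) mulrDr mulrA [vcomp X c j p * (f p * _)]mulrCA.
Qed.

Lemma vfield_cst p (a : C) : X (fun _ => a) p = 0.
Proof.
have [c hc cp] := holo_cover p; rewrite (vfield_chart hc cp); last exact: smooth_near_cst.
by apply: big1 => j _; rewrite partial_cst mulr0.
Qed.

Lemma vfield_near p f g : smooth_near p f -> (\forall q \near p, f q = g q) ->
  \forall q \near p, X f q = X g q.
Proof.
move=> sf /near_open[V [oV Vp sV]].
apply: filterS (filterI (smooth_near_open sf) (open_near oV Vp)) => q [sq Vq].
by apply: vfield_eq => //; apply: filterS sV (open_near oV Vq).
Qed.

Lemma vfieldN p f : smooth_near p f -> X (fun q => - f q) p = - X f p.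
Proof.
move=> sf; have s1 := smooth_near_cst p (-1 : C).
have := vfieldM s1 sf; rewrite vfield_cst mul0r add0r mulN1r => <-.
by apply: vfield_eq; [exact: smooth_nearN|apply: nearW => q; rewrite mulN1r].
Qed.

Lemma vfield_sum p (I : Type) (r : seq I) (P : pred I) (F : I -> fn) :
  (forall k, P k -> smooth_near p (F k)) ->
  X (fun q => \sum_(k <- r | P k) F k q) p = \sum_(k <- r | P k) X (F k) p.
Proof.
move=> H; elim: r => [|k r IH].
  rewrite big_nil -[RHS](vfield_cst p 0); apply: vfield_eq; last by apply: nearW => q;
    rewrite big_nil.
  by apply: smooth_near_eq (smooth_near_cst p 0); apply: nearW => q; rewrite big_nil.
have sr := smooth_near_sum r H.
rewrite big_cons; case: ifPn => Pk.
  rewrite -IH -(vfieldD (H k Pk) sr); apply/esym/vfield_eq;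
    first exact: smooth_nearD (H k Pk) sr.
  by apply: nearW => q; rewrite big_cons Pk.
rewrite -IH; apply/esym/vfield_eq; first exact: sr.
by apply: nearW => q; rewrite big_cons (negbTE Pk).
Qed.

(** This is $[\partial_k, X] = (\partial_k X^j)\,\partial_j$, from the Leibniz rule in the local
    formula for [X] and the symmetry of second derivatives. *)
Lemma partial_vfield c p k f : holo c -> cdom c p -> smooth_near p f ->
  partial c k (X f) p = X (partial c k f) p +
    \sum_j partial c k (vcomp X c j) p * partial c j f p.
Proof.
move=> hc cp sf.
have sv j := smooth_near_vcomp j hc cp.
have sp j := smooth_near_partial j hc cp sf.
rewrite [LHS](@partial_eq _ _ _ _ _ _ _ (fun q =>
  \sum_j vcomp X c j q * partial c j f q))//; last first.
  apply: filterS (filterI (cdom_near cp) (smooth_near_open sf)) => q [cq sq].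
  by rewrite (vfield_chart hc cq sq).
rewrite partial_sum//; last by move=> j _; exact: smooth_nearM (sv j) (sp j).
rewrite (vfield_chart hc cp (sp k)) -big_split; apply: eq_bigr => j _.
by rewrite (partialM k hc cp (sv j) (sp j)) addrC (partial_comm _ _ hc cp sf).
Qed.

End VectorFields.

(** * Iterated partial derivatives *)

Section MultiPartial.
Variables (R : realType) (n : nat) (M : complexManifold R n).
Local Notation C := (R[i]).
Local Notation fn := (M -> C).
Variables (c : chart R n M) (T : finType) (e : T -> cindex n) (N : nat).
Implicit Types (p q : M) (f g h : fn) (K : {ffun T -> 'I_N}).

(** An iterated derivative is a composite of single ones. Below, [Q] speaks of a neighbourhood of
    the point and not of the point alone, because the next derivative must still be taken. *)
Lemma mpartial_ind (Q : (fn -> fn) -> Prop) K : Q id ->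
  (forall t D, Q D -> Q (partial c (e t) \o D)) -> Q (mpartial c e K).
Proof.
move=> Q0 QS; rewrite /mpartial; elim: (enum T) => [|t r IH] //=.
by elim: (K t : nat) => [|m IHm] //=; exact: (QS t _ IHm).
Qed.

Variable p : M.
Hypotheses (hc : holo c) (cp : cdom c p).

Lemma smooth_near_mpartial K f : smooth_near p f -> smooth_near p (mpartial c e K f).
Proof.
apply: (@mpartial_ind (fun D => smooth_near p f -> smooth_near p (D f))) => // t D IH /IH.
exact: smooth_near_partial.
Qed.

Lemma mpartial_eq K f g : (\forall q \near p, f q = g q) ->
  \forall q \near p, mpartial c e K f q = mpartial c e K g q.
Proof.
move=> fg; apply: (@mpartial_ind (fun D => \forall q \near p, D f q = D g q)) => // t D.
exact: partial_eq_near.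
Qed.

Lemma mpartialD K f g : smooth_near p f -> smooth_near p g ->
  \forall q \near p, mpartial c e K (fun q => f q + g q) q = mpartial c e K f q +
    mpartial c e K g q.
Proof.
move=> sf sg.
have [] : [/\ smooth_near p (mpartial c e K f), smooth_near p (mpartial c e K g) &
  \forall q \near p, mpartial c e K (fun q => f q + g q) q = mpartial c e K f q +
    mpartial c e K g q] => //.
apply: (@mpartial_ind (fun D => [/\ smooth_near p (D f), smooth_near p (D g) &
  \forall q \near p, D (fun q => f q + g q) q = D f q + D g q])).
  by split => //; exact: nearW.
move=> t D [s1 s2 e1]; split; [exact: smooth_near_partial|exact: smooth_near_partial|].
apply: filterS (filterI (filterI (smooth_near_open s1) (smooth_near_open s2))
   (filterI (partial_eq_near (e t) cp e1) (cdom_near cp))) => q [[sq1 sq2] [/= -> cq]].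
exact: partialD.
Qed.

(** [h] is a constant for every derivative in the family [e]. For $\bar z$-derivatives and
    holomorphic [h] this is the mechanism behind the Wick condition. *)
Lemma mpartialM_killed K h f : smooth_near p h -> smooth_near p f ->
  (forall t, \forall q \near p, partial c (e t) h q = 0) ->
  \forall q \near p, mpartial c e K (fun q => h q * f q) q = h q * mpartial c e K f q.
Proof.
move=> sh sf kh.
have [] : smooth_near p (mpartial c e K f) /\
  \forall q \near p, mpartial c e K (fun q => h q * f q) q = h q * mpartial c e K f q => //.
apply: (@mpartial_ind (fun D => smooth_near p (D f) /\
  \forall q \near p, D (fun q => h q * f q) q = h q * D f q)).
  by split => //; exact: nearW.
move=> t D [s1 e1]; split; first exact: smooth_near_partial.
apply: filterS (filterI (filterI (smooth_near_open s1) (smooth_near_open sh))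
   (filterI (filterI (partial_eq_near (e t) cp e1) (kh t)) (cdom_near cp))).
move=> q [[sq1 sq2] [[/= -> k0] cq]].
by rewrite partialM// k0 mul0r add0r.
Qed.

End MultiPartial.

(** * Locality and Wick type of the operators $C_r$ *)

Section StarLocal.
Variables (R : realType) (n : nat) (M : complexManifold R n).
Local Notation C := (R[i]).
Local Notation fn := (M -> C).
Variables (omega : tensor2 M) (Cr : nat -> fn -> fn -> fn).
Hypotheses (Hstar : star_product omega Cr) (Hwick : wick_type Cr).
Implicit Types (p q : M) (a b f g h : fn) (c : chart R n M).

(** Every germ has a globally smooth representative; this is the bridge from the global axioms to
    chart functions. *)
Lemma smooth_near_extend p f : smooth_near p f ->
  exists2 F : fn, smooth_on setT F & \forall q \near p, F q = f q.
Proof.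
move=> [U [oU Up sf]]; have [chi [s1 e1 H]] := cutoff oU Up.
exists (fun q => chi q * f q); first exact: H.
by apply: filterS e1 => q ->; rewrite mul1r.
Qed.

Lemma smooth_onT_near f p : smooth_on setT f -> smooth_near p f.
Proof. by move=> sf; apply: smooth_on_near sf; [exact: openT|]. Qed.

Lemma Cr_formula r c p : holo c -> cdom c p ->
  exists (N : nat) (coef : {ffun cindex n -> 'I_N} -> {ffun cindex n -> 'I_N} -> fn),
    (forall K L, smooth_near p (coef K L)) /\
    \forall q \near p, forall a b, smooth_near q a -> smooth_near q b ->
      Cr r a b q = \sum_K \sum_L coef K L q * mpartial c id K a q * mpartial c id L b q.
Proof.
move=> hc cp; have [U [N [coef [oU Up Uc sc H]]]] := star_bidifferential Hstar r hc cp.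
exists N, coef; split=> [K L|]; first exact: smooth_on_near (sc K L).
by apply: filterS (open_near oU Up) => q Uq a b; exact: H.
Qed.

Lemma smooth_near_Cr r p a b : smooth_near p a -> smooth_near p b -> smooth_near p (Cr r a b).
Proof.
move=> sa sb; have [c hc cp] := holo_cover p.
have [N [coef [sc H]]] := Cr_formula r hc cp.
apply: (@smooth_near_eq _ _ _ _
  (fun q => \sum_K \sum_L coef K L q * mpartial c id K a q * mpartial c id L b q)).
  apply: filterS (filterI H (filterI (smooth_near_open sa) (smooth_near_open sb))).
  by move=> q [Hq [sqa sqb]]; rewrite Hq.
apply: smooth_near_sum => K _; apply: smooth_near_sum => L _.
apply: smooth_nearM; last exact: smooth_near_mpartial.
by apply: smooth_nearM; [exact: sc|exact: smooth_near_mpartial].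
Qed.

Lemma Cr_eq r p a a' b b' : smooth_near p a -> smooth_near p b ->
  (\forall q \near p, a q = a' q) -> (\forall q \near p, b q = b' q) ->
  Cr r a b p = Cr r a' b' p.
Proof.
move=> sa sb ea eb; have [c hc cp] := holo_cover p.
have [N [coef [sc /nbhs_singleton H]]] := Cr_formula r hc cp.
rewrite !H//; [|exact: smooth_near_eq sa|exact: smooth_near_eq sb].
apply: eq_bigr => K _; apply: eq_bigr => L _.
by rewrite (nbhs_singleton (mpartial_eq id cp K ea)) (nbhs_singleton (mpartial_eq id cp L eb)).
Qed.

Lemma Cr_near r p a a' b b' : smooth_near p a -> smooth_near p b ->
  (\forall q \near p, a q = a' q) -> (\forall q \near p, b q = b' q) ->
  \forall q \near p, Cr r a b q = Cr r a' b' q.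
Proof.
move=> sa sb /near_open[U [oU Up ea]] /near_open[V [oV Vp eb]].
apply: filterS (filterI (filterI (smooth_near_open sa) (smooth_near_open sb))
  (filterI (open_near oU Up) (open_near oV Vp))) => q [[sqa sqb] [Uq Vq]].
apply: Cr_eq => //; first by apply: filterS ea (open_near oU Uq).
by apply: filterS eb (open_near oV Vq).
Qed.

Lemma CrDl r p a a' b : smooth_near p a -> smooth_near p a' -> smooth_near p b ->
  Cr r (fun q => a q + a' q) b p = Cr r a b p + Cr r a' b p.
Proof.
move=> sa sa' sb; have [c hc cp] := holo_cover p.
have [N [coef [sc /nbhs_singleton H]]] := Cr_formula r hc cp.
rewrite !H//; last exact: smooth_nearD.
rewrite -big_split; apply: eq_bigr => K _; rewrite -big_split; apply: eq_bigr => L _ /=.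
by rewrite (nbhs_singleton (mpartialD id hc cp K sa sa')) mulrDr mulrDl.
Qed.

Lemma CrDr r p a b b' : smooth_near p a -> smooth_near p b -> smooth_near p b' ->
  Cr r a (fun q => b q + b' q) p = Cr r a b p + Cr r a b' p.
Proof.
move=> sa sb sb'; have [c hc cp] := holo_cover p.
have [N [coef [sc /nbhs_singleton H]]] := Cr_formula r hc cp.
rewrite !H//; last exact: smooth_nearD.
rewrite -big_split; apply: eq_bigr => K _; rewrite -big_split; apply: eq_bigr => L _ /=.
by rewrite (nbhs_singleton (mpartialD id hc cp L sb sb')) mulrDr.
Qed.

Lemma Cr0l r p b : smooth_near p b -> Cr r (fun _ => 0) b p = 0.
Proof.
move=> sb; have s0 := smooth_near_cst p (0 : C).
have := CrDl r s0 s0 sb; rewrite (_ : (fun _ => _) = (fun _ : M => 0 : C)).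
  by move/eqP; rewrite -subr_eq0 opprD addNKr oppr_eq0 => /eqP.
by apply/funext => q; rewrite addr0.
Qed.

Lemma Cr0r r p a : smooth_near p a -> Cr r a (fun _ => 0) p = 0.
Proof.
move=> sa; have s0 := smooth_near_cst p (0 : C).
have := CrDr r sa s0 s0; rewrite (_ : (fun _ => _) = (fun _ : M => 0 : C)).
  by move/eqP; rewrite -subr_eq0 opprD addNKr oppr_eq0 => /eqP.
by apply/funext => q; rewrite addr0.
Qed.

Lemma Cr_sumr r p a (I : Type) (s : seq I) (F : I -> fn) : smooth_near p a ->
  (forall k, smooth_near p (F k)) ->
  Cr r a (fun q => \sum_(k <- s) F k q) p = \sum_(k <- s) Cr r a (F k) p.
Proof.
move=> sa H; have ss (s' : seq I) := smooth_near_sum s' (fun k (_ : true) => H k).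
elim: s => [|k s IH].
  rewrite big_nil -[RHS](Cr0r r sa); apply: Cr_eq; [exact: sa|exact: ss|exact: nearW|].
  by apply: nearW => q; rewrite big_nil.
rewrite big_cons -IH -(CrDr r sa (H k) (ss s)).
apply: Cr_eq; [exact: sa|exact: ss|exact: nearW|].
by apply: nearW => q; rewrite big_cons.
Qed.

(** The second argument is differentiated only along the $\bar z^l$, so a holomorphic factor comes
    out. *)
Lemma Cr_wickr r p c a b h : (0 < r)%N -> holo c -> cdom c p ->
  smooth_near p a -> smooth_near p b -> smooth_near p h ->
  (forall l, \forall q \near p, partial c (inr l) h q = 0) ->
  Cr r a (fun q => h q * b q) p = h p * Cr r a b p.
Proof.
move=> r0 hc cp sa sb sh kh.
have [U [N [coef [oU Up Uc sc H]]]] := Hwick r0 hc cp.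
rewrite !H//; last exact: smooth_nearM.
rewrite mulr_sumr; apply: eq_bigr => K _; rewrite mulr_sumr; apply: eq_bigr => L _.
by rewrite (nbhs_singleton (mpartialM_killed hc cp L sh sb kh)) mulrCA.
Qed.

Lemma Cr_wickl r p c a b h : (0 < r)%N -> holo c -> cdom c p ->
  smooth_near p a -> smooth_near p b -> smooth_near p h ->
  (forall l, \forall q \near p, partial c (inl l) h q = 0) ->
  Cr r (fun q => h q * a q) b p = h p * Cr r a b p.
Proof.
move=> r0 hc cp sa sb sh kh.
have [U [N [coef [oU Up Uc sc H]]]] := Hwick r0 hc cp.
rewrite !H//; last exact: smooth_nearM.
rewrite mulr_sumr; apply: eq_bigr => K _; rewrite mulr_sumr; apply: eq_bigr => L _.
by rewrite (nbhs_singleton (mpartialM_killed hc cp K sh sa kh)) !mulrA [h p * _]mulrC.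
Qed.

End StarLocal.

(** * The star product on germs *)

#[local] Arguments partial : simpl never.

Section StarAlgebra.
Variables (R : realType) (n : nat) (M : complexManifold R n).
Local Notation C := (R[i]).
Local Notation fn := (M -> C).
Variables (omega : tensor2 M) (Cr : nat -> fn -> fn -> fn).
Hypothesis Hstar : star_product omega Cr.
Implicit Types (p q : M) (a b f g h : fn) (c : chart R n M).

Definition cseries (a : fn) : fseries M := fun m => if m is _.+1 then fun _ => 0 else a.

Lemma smooth_on_cseries U a m : smooth_on U a -> smooth_on U (cseries a m).
Proof. by case: m => // m _; exact: smooth_on_cst. Qed.

Lemma smooth_near_cseries p a m : smooth_near p a -> smooth_near p (cseries a m).
Proof. by case: m => // m _; exact: smooth_near_cst. Qed.

Lemma star_cseriesl a (b : fseries M) m p : smooth_near p a -> (forall k,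
  smooth_near p (b k)) ->
  star Cr (cseries a) b m p = \sum_(r < m.+1) Cr r a (b (m - r)%N) p.
Proof.
move=> sa sb; apply: eq_bigr => r _; rewrite big_ord_recl /= subn0 big1 ?addr0// => i _.
exact: (Cr0l Hstar).
Qed.

Lemma star_cseriesr (a : fseries M) b m p : (forall k, smooth_near p (a k)) ->
  smooth_near p b ->
  star Cr a (cseries b) m p = \sum_(r < m.+1) Cr r (a (m - r)%N) b p.
Proof.
move=> sa sb; apply: eq_bigr => r _; rewrite big_ord_recr /= subnn big1 ?add0r// => i _.
have : (0 < m - r - i)%N by rewrite subn_gt0.
by case: (m - r - i)%N => // k _; exact: (Cr0r Hstar).
Qed.

Lemma star_cseries a b m p : smooth_near p a -> smooth_near p b ->
  star Cr (cseries a) (cseries b) m p = Cr m a b p.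
Proof.
move=> sa sb; rewrite star_cseriesl//; last by move=> k; exact: smooth_near_cseries.
rewrite big_ord_recr /= subnn big1 ?add0r// => r _.
have : (0 < m - r)%N by rewrite subn_gt0.
by case: (m - r)%N => // k _; exact: (Cr0r Hstar).
Qed.

Lemma Cr0_mul p a b : smooth_near p a -> smooth_near p b -> Cr 0 a b p = a p * b p.
Proof.
move=> sa sb; have [A sA eA] := smooth_near_extend sa; have [B sB eB] := smooth_near_extend sb.
rewrite -(nbhs_singleton eA) -(nbhs_singleton eB) -(star_C0 Hstar sA sB p).
by apply/esym/(Cr_eq Hstar) => //; exact: smooth_onT_near.
Qed.

Lemma fone_cseries : @fone R n M = cseries (fun _ => 1).
Proof. by apply/funext => -[|m]; apply/funext => p. Qed.

Lemma Cr_1l r p b : (0 < r)%N -> smooth_near p b -> Cr r (fun _ => 1) b p = 0.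
Proof.
move=> r0 sb; have [B sB eB] := smooth_near_extend sb.
have s1 := smooth_near_cst p (1 : C).
have sB' := smooth_onT_near p sB.
have -> : Cr r (fun _ => 1) b p = Cr r (fun _ => 1) B p.
  by apply/esym/(Cr_eq Hstar) => //; exact: nearW.
have := star_1l Hstar (fun m => smooth_on_cseries m sB) r p.
by rewrite fone_cseries star_cseries//; case: (r) r0.
Qed.

Lemma Cr_1r r p a : (0 < r)%N -> smooth_near p a -> Cr r a (fun _ => 1) p = 0.
Proof.
move=> r0 sa; have [A sA eA] := smooth_near_extend sa.
have s1 := smooth_near_cst p (1 : C).
have sA' := smooth_onT_near p sA.
have -> : Cr r a (fun _ => 1) p = Cr r A (fun _ => 1) p.
  by apply/esym/(Cr_eq Hstar) => //; exact: nearW.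
have := star_1r Hstar (fun m => smooth_on_cseries m sA) r p.
by rewrite fone_cseries star_cseries//; case: (r) r0.
Qed.

(** This is the coefficient of $\nu^r$ in associativity for constant series, transferred to germs by
    extension. *)
Lemma Cr_assoc r p a b d : smooth_near p a -> smooth_near p b -> smooth_near p d ->
  \sum_(s < r.+1) Cr s (Cr (r - s)%N a b) d p = \sum_(s < r.+1) Cr s a (Cr (r - s)%N b d) p.
Proof.
move=> sa sb sd; have [A sA eA] := smooth_near_extend sa.
have [B sB eB] := smooth_near_extend sb; have [D sD eD] := smooth_near_extend sd.
have nA q := smooth_onT_near q sA; have nB q := smooth_onT_near q sB.
have nD q := smooth_onT_near q sD.
have E F G (sF : forall q, smooth_near q F) (sG : forall q, smooth_near q G) :
    star Cr (cseries F) (cseries G) = fun m => Cr m F G.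
  by apply/funext => m; apply/funext => q; exact: star_cseries.
have := star_assoc Hstar (fun m => smooth_on_cseries m sA) (fun m => smooth_on_cseries m sB)
  (fun m => smooth_on_cseries m sD) r p.
rewrite (E A B nA nB) (E B D nB nD).
have sCr F G (sF : smooth_near p F) (sG : smooth_near p G) k := smooth_near_Cr Hstar k sF sG.
rewrite star_cseriesr//; last by move=> k; exact: sCr.
rewrite star_cseriesl//; last by move=> k; exact: sCr.
have -> : \sum_(s < r.+1) Cr s (Cr (r - s)%N A B) D p =
  \sum_(s < r.+1) Cr s (Cr (r - s)%N a b) d p.
  apply: eq_bigr => s _; apply: (Cr_eq Hstar) => //; first exact: sCr.
  exact: (Cr_near Hstar).
move=> ->; apply: eq_bigr => s _; apply: (Cr_eq Hstar) => //; first exact: sCr.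
exact: (Cr_near Hstar).
Qed.

(** [Y] is the value at [p] of the Hamiltonian field of [w]. The axiom on $C_1$ yields a field for
    each pair of functions; nondegeneracy makes one [Y] serve all [b]. *)
Lemma Cr1_poisson p w c : Defs.nondegenerate omega -> holo c -> cdom c p -> smooth_near p w ->
  exists2 Y : cindex n -> C,
    (forall j, \sum_i Y i * omega c i j p = partial c j w p) &
    forall b, smooth_near p b -> Cr 1 w b p - Cr 1 b w p = - \sum_i Y i * partial c i b p.
Proof.
move=> ndeg hc cp sw.
have H b : smooth_near p b -> exists2 Y : cindex n -> C,
    (forall j, \sum_i Y i * omega c i j p = partial c j w p) &
    Cr 1 w b p - Cr 1 b w p = - \sum_i Y i * partial c i b p.
  move=> sb; have [W sW eW] := smooth_near_extend sw.
  have [B sB eB] := smooth_near_extend sb.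
  have nW := smooth_onT_near p sW; have nB := smooth_onT_near p sB.
  have [X [HX eX]] := star_C1 Hstar sW sB.
  exists (fun i => vcomp X c i p) => [j|].
    by rewrite (HX c j p hc cp); exact: partial_eq.
  rewrite -(Cr_eq Hstar 1 nW nB eW eB) -(Cr_eq Hstar 1 nB nW eB eW) eX (vfield_chart X hc cp nB).
  by congr (- _); apply: eq_bigr => i _; rewrite (partial_eq i cp eB).
(* The function 1 merely serves to produce some [Y], with which the field obtained for [b] is then
   identified. *)
have [Y HY _] := H _ (smooth_near_cst p 1).
exists Y => // b sb; have [Z HZ ->] := H b sb.
congr (- _); apply: eq_bigr => i _; congr (_ * _).
apply/eqP; rewrite -subr_eq0; apply/eqP.
apply: (ndeg c p hc cp (fun i => Z i - Y i)) => j.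
by under eq_bigr do rewrite mulrBl; rewrite sumrB HZ HY subrr.
Qed.

Variable X : vfield M.

Definition derivation_defect r a b p := X (Cr r a b) p - Cr r (X a) b p - Cr r a (X b) p.

Lemma fmap_cseries a : Defs.fmap X (cseries a) = cseries (X a).
Proof. by apply/funext => -[|m] //; apply/funext => p; rewrite /Defs.fmap /= vfield_cst. Qed.

Lemma derivation_defect_eq r p a a' b b' : smooth_near p a -> smooth_near p b ->
  (\forall q \near p, a q = a' q) -> (\forall q \near p, b q = b' q) ->
  derivation_defect r a b p = derivation_defect r a' b' p.
Proof.
move=> sa sb ea eb; rewrite /derivation_defect.
rewrite (vfield_eq X (smooth_near_Cr Hstar r sa sb) (Cr_near Hstar r sa sb ea eb)).
rewrite (Cr_eq Hstar r (smooth_near_vfield X sa) sb (vfield_near X sa ea) eb).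
by rewrite (Cr_eq Hstar r sa (smooth_near_vfield X sb) ea (vfield_near X sb eb)).
Qed.

(** On constant series the product has $C_r(a,b)$ as its coefficient of order [r]; conversely every
    coefficient of a product is a sum of values $C_r(a_i,b_j)$. *)
Lemma star_derivationP : star_derivation Cr X <->
  forall r p a b, smooth_near p a -> smooth_near p b -> derivation_defect r a b p = 0.
Proof.
split=> [H r p a b sa sb|H a b sa sb m p].
  have [A sA eA] := smooth_near_extend sa; have [B sB eB] := smooth_near_extend sb.
  have nA q := smooth_onT_near q sA; have nB q := smooth_onT_near q sB.
  rewrite -(derivation_defect_eq r (nA p) (nB p) eA eB).
  have := H _ _ (fun m => smooth_on_cseries m sA) (fun m => smooth_on_cseries m sB) r p.
  rewrite !fmap_cseries /fadd !star_cseries//; try exact: smooth_near_vfield.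
  have -> : Defs.fmap X (star Cr (cseries A) (cseries B)) r p = X (Cr r A B) p.
    rewrite /Defs.fmap; apply: vfield_eq.
      apply: smooth_near_eq (smooth_near_Cr Hstar r (nA p) (nB p)).
      by apply: nearW => q; rewrite star_cseries.
    by apply: nearW => q; rewrite star_cseries.
  by move=> e; rewrite /derivation_defect e addrAC addrK subrr.
have na k q : smooth_near q (a k) by exact: smooth_onT_near.
have nb k q : smooth_near q (b k) by exact: smooth_onT_near.
rewrite /Defs.fmap /fadd /star (vfield_sum X); last first.
  by move=> r _; apply: smooth_near_sum => i _; exact: (smooth_near_Cr Hstar).
rewrite -big_split; apply: eq_bigr => r _ /=; rewrite (vfield_sum X); last first.
  by move=> i _; exact: (smooth_near_Cr Hstar).
rewrite -big_split; apply: eq_bigr => i _ /=.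
have := H r p _ _ (na i p) (nb (m - r - i)%N p).
by move/eqP; rewrite /derivation_defect -addrA -opprD subr_eq0 => /eqP.
Qed.

End StarAlgebra.

(** * Holomorphic functions and potentials *)

Section HolomorphicFunctions.
Variables (R : realType) (n : nat) (M : complexManifold R n).
Local Notation C := (R[i]).
Local Notation fn := (M -> C).
Variables (omega : tensor2 M) (Cr : nat -> fn -> fn -> fn).
Hypothesis Homega : pseudo_kahler omega.
Hypotheses (Hstar : star_product omega Cr) (Hwick : wick_type Cr).
Variables (c : chart R n M).
Hypothesis hc : holo c.
Implicit Types (p q : M) (a b f g h : fn).

(** Writing $h = h\cdot 1$, the factor [h] comes out and leaves $C_r(a,1) = 0$. *)
Lemma Cr_holomorphic r p a h : (0 < r)%N -> cdom c p -> smooth_near p a -> smooth_near p h ->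
  (forall l, \forall q \near p, partial c (inr l) h q = 0) -> Cr r a h p = 0.
Proof.
move=> r0 cp sa sh kh; have s1 := smooth_near_cst p (1 : C).
have := Cr_wickr Hwick r0 hc cp sa s1 sh kh; rewrite (Cr_1r Hstar r0 sa) mulr0 => <-.
by apply: (Cr_eq Hstar) => //; [exact: nearW|apply: nearW => q; rewrite mulr1].
Qed.

Lemma Cr_antiholomorphic r p h b : (0 < r)%N -> cdom c p -> smooth_near p b ->
  smooth_near p h ->
  (forall l, \forall q \near p, partial c (inl l) h q = 0) -> Cr r h b p = 0.
Proof.
move=> r0 cp sb sh kh; have s1 := smooth_near_cst p (1 : C).
have := Cr_wickl Hwick r0 hc cp s1 sb sh kh; rewrite (Cr_1l Hstar r0 sb) mulr0 => <-.
by apply: (Cr_eq Hstar) => //; [apply: nearW => q; rewrite mulr1|exact: nearW].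
Qed.

Lemma coordf_killed p i j : i != j -> cdom c p -> \forall q \near p,
  partial c i (coordf c j) q = 0.
Proof.
by move=> ij cp; apply: filterS (cdom_near cp) => q cq; rewrite partial_coordf// (negbTE ij).
Qed.

Lemma sum_partial_coordf p (Y : cindex n -> C) j : cdom c p ->
  \sum_i Y i * partial c i (coordf c j) p = Y j.
Proof.
move=> cp; rewrite (bigD1 j)//= partial_coordf// eqxx mulr1 big1 ?addr0// => i ij.
by rewrite partial_coordf// (negbTE ij) mulr0.
Qed.

(** By type (1,1), $\bar\partial_l w$ involves only the components of the Hamiltonian field of [w]
    along the $Z_j$, and these are, up to sign, its brackets with the $z^j$. *)
Lemma poisson_holomorphic p w : cdom c p -> smooth_near p w ->
  (forall j, Cr 1 w (coordf c (inl j)) p = Cr 1 (coordf c (inl j)) w p) ->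
  forall l, partial c (inr l) w p = 0.
Proof.
have [_ _ ndeg _ t11] := Homega.
move=> cp sw H l; have [Y HY Hb] := Cr1_poisson Hstar ndeg hc cp sw.
rewrite -HY big1// => -[j|j] _.
  have := Hb _ (smooth_near_coordf (inl j) hc cp).
  rewrite H subrr sum_partial_coordf// => /eqP; rewrite eq_sym oppr_eq0 => /eqP ->.
  by rewrite mul0r.
by rewrite t11// mulr0.
Qed.

Lemma poisson_antiholomorphic p w : cdom c p -> smooth_near p w ->
  (forall j, Cr 1 w (coordf c (inr j)) p = Cr 1 (coordf c (inr j)) w p) ->
  forall l, partial c (inl l) w p = 0.
Proof.
have [_ _ ndeg _ t11] := Homega.
move=> cp sw H l; have [Y HY Hb] := Cr1_poisson Hstar ndeg hc cp sw.
rewrite -HY big1// => -[j|j] _; first by rewrite t11// mulr0.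
have := Hb _ (smooth_near_coordf (inr j) hc cp).
rewrite H subrr sum_partial_coordf// => /eqP; rewrite eq_sym oppr_eq0 => /eqP ->.
by rewrite mul0r.
Qed.

(** The coefficient of $\nu^m$ in $a \star w - aw$ for a single function [a]. *)
Definition higher_product (a : fn) (w : fseries M) (m : nat) : fn := fun p =>
  \sum_(r < m) Cr r.+1 a (w (m - r.+1)%N) p.

Lemma higher_product_holomorphic p a w m : cdom c p -> smooth_near p a ->
  (forall k, smooth_near p (w k)) ->
  (forall k l, \forall q \near p, partial c (inr l) (w k) q = 0) -> higher_product a w m p = 0.
Proof. by move=> cp sa sw kw; apply: big1 => r _; exact: Cr_holomorphic. Qed.

(** Strong induction on [m], testing with $a = z^j$ at order $m+1$: the terms $C_r(z^j, w_{m+1-r})$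
    with $r \ge 2$ vanish because lower coefficients are already holomorphic. What remains is
    $C_1(z^j, w_m) = 0$, while $C_1(w_m, z^j) = 0$ by Wick type, so the bracket of $w_m$ with every
    $z^j$ is zero. *)
Lemma holomorphic_of_higher_product w :
  (forall m p, cdom c p -> smooth_near p (w m)) ->
  (forall a m p, cdom c p -> smooth_near p a -> higher_product a w m p = 0) ->
  forall m p l, cdom c p -> partial c (inr l) (w m) p = 0.
Proof.
move=> sw H; elim/ltn_ind => m IH p l cp.
apply: poisson_holomorphic (cp) (sw m p cp) _ l => j.
have sz := smooth_near_coordf (inl j) hc cp.
rewrite Cr_holomorphic//; [|exact: sw|by move=> l; exact: coordf_killed].
have := H _ m.+1 p cp sz; rewrite /higher_product big_ord_recl /= subn1 /= big1 ?addr0// =>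
  r _.
rewrite /bump /= add1n subSS; apply: Cr_holomorphic => //; first exact: sw.
move=> l'; apply: filterS (cdom_near cp) => q; apply: IH.
by rewrite ltn_subrL /=; exact: leq_ltn_trans (leq0n r) (ltn_ord r).
Qed.

End HolomorphicFunctions.

(** * Karabegov potentials and their transport along the vector field *)

Section Potentials.
Variables (R : realType) (n : nat) (M : complexManifold R n).
Local Notation C := (R[i]).
Local Notation fn := (M -> C).
Variables (omega : tensor2 M) (Cr : nat -> fn -> fn -> fn).
Hypotheses (Hstar : star_product omega Cr) (Hwick : wick_type Cr).
Variables (c : chart R n M).
Hypothesis hc : holo c.
Variable u : 'I_n -> fseries M.
Hypothesis Hu : left_potentials Cr c u.
Implicit Types (p q : M) (a b f g h : fn).

Lemma smooth_near_potential p k m : cdom c p -> smooth_near p (u k m).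
Proof. by move=> cp; apply: smooth_on_near ((Hu k).1 m); [exact: chart_dom_open|]. Qed.

Lemma higher_product_potential p a k m : cdom c p -> smooth_near p a ->
  higher_product Cr a (u k) m p = if m == 1%N then partial c (inl k) a p else 0.
Proof.
move=> cp sa; have [A sA eA] := smooth_near_extend sa.
have nA := smooth_onT_near p sA; have su j := smooth_near_potential k j cp.
have -> : higher_product Cr a (u k) m p = higher_product Cr A (u k) m p.
  by apply: eq_bigr => r _; apply/esym/(Cr_eq Hstar) => //; exact: nearW.
have sAU j : smooth_on (cdom c) (cseries A j).
  by apply: smooth_on_cseries; exact: smooth_on_sub sA.
have := (Hu k).2 _ sAU m p cp.
rewrite (star_cseriesl Hstar)// big_ord_recl /= subn0 (Cr0_mul Hstar nA)//.
rewrite /fadd /fmul big_ord_recl /= subn0 [X in _ * _ + X]big1 ?addr0; last first.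
  by move=> i _; rewrite mul0r.
move=> /addrI; rewrite /higher_product => ->.
case: m => [|[|m]]; [by []| |exact: partial_cst].
by rewrite eqxx; exact: partial_eq.
Qed.

Variable X : vfield M.
Hypothesis X_holo : forall p k l, cdom c p -> partial c (inr l) (vcomp X c (inl k)) p = 0.
Hypothesis X_anti : forall p k l, cdom c p -> partial c (inl k) (vcomp X c (inr l)) p = 0.

(** These are the components of $\mathcal L_X(u_k\,dz^k)$, a (1,0)-form when $X$ preserves the
    complex structure. *)
Definition transported_potential k : fseries M := fun m q =>
  X (u k m) q + \sum_l partial c (inl k) (vcomp X c (inl l)) q * u l m q.

Lemma smooth_near_coef p k l : cdom c p ->
  smooth_near p (partial c (inl k) (vcomp X c (inl l))).
Proof. by move=> cp; apply: smooth_near_partial => //; exact: smooth_near_vcomp. Qed.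

Lemma coef_holomorphic p k l l' : cdom c p ->
  partial c (inr l') (partial c (inl k) (vcomp X c (inl l))) p = 0.
Proof.
move=> cp; rewrite partial_comm//; last exact: smooth_near_vcomp.
rewrite -[RHS](partial_cst c (inl k) 0 p); apply: partial_eq => //.
by apply: filterS (cdom_near cp) => q cq; exact: X_holo.
Qed.

Lemma smooth_near_transported p k m : cdom c p -> smooth_near p (transported_potential k m).
Proof.
move=> cp; apply: smooth_nearD; first by apply: smooth_near_vfield;
  exact: smooth_near_potential.
apply: smooth_near_sum => l _; apply: smooth_nearM; first exact: smooth_near_coef.
exact: smooth_near_potential.
Qed.

(** The pivot of both directions: it measures by the defects how far [a] times the transported
    potential is from the pointwise product. *)
Lemma higher_product_transported p a k m : cdom c p -> smooth_near p a ->
  higher_product Cr a (transported_potential k) m p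
    + \sum_(r < m) derivation_defect Cr X r.+1 a (u k (m - r.+1)%N) p = 0.
Proof.
move=> cp sa; have su j l := smooth_near_potential l j cp.
have sc l := smooth_near_coef k l cp.
have sX := smooth_near_vfield X sa.
(* Each $C_r(a, Xu)$ is rewritten as $X\,C_r(a,u) - C_r(Xa,u) - D_r(a,u)$, so that the defects
   cancel, and the holomorphic coefficients are taken out of $C_r$. *)
transitivity (X (higher_product Cr a (u k) m) p - higher_product Cr (X a) (u k) m p
  + \sum_l partial c (inl k) (vcomp X c (inl l)) p * higher_product Cr a (u l) m p).
  rewrite /higher_product (vfield_sum X); last by move=> r _; exact: (smooth_near_Cr Hstar).
  under [X in _ = _ + X]eq_bigr do rewrite mulr_sumr.
  rewrite exchange_big -sumrB -!big_split; apply: eq_bigr => r _ /=.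
  rewrite /transported_potential (CrDr Hstar)//; [|exact: smooth_near_vfield|]; last first.
    by apply: smooth_near_sum => l _; exact: smooth_nearM.
  rewrite (Cr_sumr Hstar)//; last by move=> l; exact: smooth_nearM.
  rewrite /derivation_defect.
  have -> : \sum_l Cr r.+1 a (fun q =>
    partial c (inl k) (vcomp X c (inl l)) q * u l (m - r.+1)%N q) p =
      \sum_l partial c (inl k) (vcomp X c (inl l)) p * Cr r.+1 a (u l (m - r.+1)%N) p.
    apply: eq_bigr => l _; rewrite (Cr_wickr Hwick _ hc cp sa (su _ l) (sc l))// => l'.
    by apply: filterS (cdom_near cp) => q cq; exact: coef_holomorphic.
  by rewrite addrAC [X in X + _]addrC subrK.
have -> : X (higher_product Cr a (u k) m) p =
    if m == 1%N then X (partial c (inl k) a) p else 0.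
  rewrite -(vfield_cst X p 0); case: eqP => m1.
    apply/esym/vfield_eq; first exact: smooth_near_partial.
    apply: filterS (filterI (cdom_near cp) (smooth_near_open sa)) => q [cq sq].
    by rewrite higher_product_potential// m1.
  apply/esym/vfield_eq; first exact: smooth_near_cst.
  apply: filterS (filterI (cdom_near cp) (smooth_near_open sa)) => q [cq sq].
  by rewrite higher_product_potential//; case: eqP.
rewrite higher_product_potential//.
under eq_bigr do rewrite higher_product_potential//.
(* Away from order 1 every term is zero. At order 1 there remains $X\partial_k a - \partial_k X a +
   (\partial_k X^l)\partial_l a$, where the commutator has no $\bar z$-components by [X_anti]. *)
case: eqP => _; last by rewrite subrr add0r big1// => l _; rewrite mulr0.
rewrite (partial_vfield X _ hc cp sa) opprD addNKr big_sumType /=.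
rewrite [X in - (_ + X)]big1 ?addr0; last by move=> l _; rewrite X_anti// mul0r.
by rewrite addNr.
Qed.

Variable K : nat -> tensor2 M.
Hypotheses (HK : karabegov_form Cr K) (cc : contractible_set R (cdom c)).

Lemma karabegov_mixed p m k l : cdom c p -> K m c (inl k) (inr l) p =
  partial c (inr l) (u k m) p.
Proof.
move=> cp; rewrite (karabegov_left HK hc cc Hu _ _ _ cp) /delbar /= sub0r.
by rewrite partialN ?opprK//; exact: smooth_near_potential.
Qed.

Lemma karabegov_pure p m i j : cdom c p ->
  is_antiholomorphic_index i = is_antiholomorphic_index j -> K m c i j p = 0.
Proof.
move=> cp; rewrite (karabegov_left HK hc cc Hu _ _ _ cp) /delbar.
by case: i j => k [] l //= _; rewrite ?subr0// !partial_cst subr0.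
Qed.

Lemma karabegov_pure_vfield p m i j : cdom c p ->
  is_antiholomorphic_index i = is_antiholomorphic_index j -> X (K m c i j) p = 0.
Proof.
move=> cp ij; rewrite -(vfield_cst X p 0); apply/esym/vfield_eq; first exact: smooth_near_cst.
by apply: filterS (cdom_near cp) => q cq; rewrite karabegov_pure.
Qed.

(** The form has type (1,1) on this chart, and [X] preserves the splitting of the tangent bundle,
    hence the type. *)
Lemma lie_form_pure p m i j : cdom c p ->
  is_antiholomorphic_index i = is_antiholomorphic_index j -> lie_form X (K m) c i j p = 0.
Proof.
move=> cp ij; rewrite /lie_form karabegov_pure_vfield// add0r.
rewrite !big1 ?addr0// => l _.
- case: (boolP (is_antiholomorphic_index i == is_antiholomorphic_index l)) => [/eqP il|il].
    by rewrite karabegov_pure ?mul0r.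
  case: j l i ij il => j [] l [] i //= _ _; by rewrite ?X_holo ?X_anti// mulr0.
- case: (boolP (is_antiholomorphic_index l == is_antiholomorphic_index j)) => [/eqP il|il].
    by rewrite karabegov_pure ?mul0r.
  case: j l i ij il => j [] l [] i //= _ _; by rewrite ?X_holo ?X_anti// mulr0.
Qed.

(** In effect $\mathcal L_X$ commutes with $\bar\partial$ for such [X], and it is applied to
    $\bar\partial(-u_k\,dz^k)$. *)
Lemma lie_form_mixed p m k l : cdom c p ->
  lie_form X (K m) c (inl k) (inr l) p = partial c (inr l) (transported_potential k m) p.
Proof.
move=> cp; have su j := smooth_near_potential j m cp; have sc j := smooth_near_coef k j cp.
rewrite partialD//; [|exact: smooth_near_vfield|]; last first.
  by apply: smooth_near_sum => j _; exact: smooth_nearM.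
rewrite partial_sum//; last by move=> j _; exact: smooth_nearM.
rewrite (partial_vfield X _ hc cp (su k)) /lie_form big_sumType /=.
rewrite [X in _ + (_ + X) + _]big1 ?addr0; last by move=> j _; rewrite karabegov_pure ?mul0r.
rewrite [X in _ + X = _]big_sumType /= [X in _ + (X + _) = _]big1 ?add0r; last first.
  by move=> j _; rewrite karabegov_pure ?mul0r.
rewrite [X in _ = _ + X + _]big_sumType /= [X in _ = _ + (X + _) + _]big1 ?add0r; last first.
  by move=> j _; rewrite X_holo ?mul0r.
rewrite -!addrA; congr (_ + _).
  apply: vfield_eq; last by apply: filterS (cdom_near cp) => q cq; exact: karabegov_mixed.
  apply: smooth_near_eq (smooth_near_partial (inr l) hc cp (su k)).
  by apply: filterS (cdom_near cp) => q cq; rewrite karabegov_mixed.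
rewrite addrC; congr (_ + _); apply: eq_bigr => j _.
  by rewrite karabegov_mixed// mulrC.
by rewrite partialM// coef_holomorphic// mul0r add0r karabegov_mixed// mulrC.
Qed.

End Potentials.

(** * Functionals of finite order *)

Section VanishingOrder.
Variables (R : realType) (n : nat) (M : complexManifold R n).
Local Notation C := (R[i]).
Local Notation fn := (M -> C).
Variables (c : chart R n M) (p : M).
Hypotheses (hc : holo c) (cp : cdom c p).
Implicit Types (f g h : fn) (i j : cindex n).

Fixpoint vanishing (k : nat) (f : fn) : Prop :=
  if k is k'.+1 then f p = 0 /\ forall i, vanishing k' (partial c i f) else True.

Lemma vanishing_eq k f g : (\forall q \near p, f q = g q) -> vanishing k f -> vanishing k g.
Proof.
elim: k f g => [|k IH] f g e //= [f0 df]; split; first by rewrite -(nbhs_singleton e).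
by move=> i; apply: IH (df i); exact: partial_eq_near.
Qed.

Lemma vanishingW k f : vanishing k.+1 f -> vanishing k f.
Proof.
elim: k f => [|k IH] f; first by [].
by move=> [f0 df]; split => // i; exact: IH (df i).
Qed.

Lemma vanishing_le l k f : (l <= k)%N -> vanishing k f -> vanishing l f.
Proof.
move=> /subnK <-; elim: (k - l)%N => [|m IH]; first by rewrite add0n.
by rewrite addSn => /vanishingW.
Qed.

Lemma vanishing0 k : vanishing k (fun _ => 0).
Proof.
elim: k => [|k IH] //=; split => // i.
by apply: vanishing_eq IH; apply: nearW => q; rewrite partial_cst.
Qed.

Lemma vanishingD k f g : smooth_near p f -> smooth_near p g ->
  vanishing k f -> vanishing k g -> vanishing k (fun q => f q + g q).
Proof.
elim: k f g => [|k IH] f g sf sg; first by [].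
move=> [f0 df] [g0 dg]; split; first by rewrite f0 g0 addr0.
move=> i; have := IH _ _ (smooth_near_partial i hc cp sf) (smooth_near_partial i hc cp sg) (df i) (dg i).
apply: vanishing_eq.
apply: filterS (filterI (cdom_near cp) (filterI (smooth_near_open sf) (smooth_near_open sg))).
by move=> q [cq [sfq sgq]]; rewrite partialD.
Qed.

(** The bound is an inequality so that the truncated predecessors of [l] and [k] in the Leibniz rule
    remain admissible when one of them is 0. *)
Lemma vanishingM m l k f g : (m <= l + k)%N -> smooth_near p f -> smooth_near p g ->
  vanishing l f -> vanishing k g -> vanishing m (fun q => f q * g q).
Proof.
elim: m l k f g => [|m IH] l k f g mlk sf sg vf vg //=; split.
  case: l vf mlk => [_|l [-> _] _]; last by rewrite mul0r.
  by case: k vg => [|k [-> _] _] //; rewrite mulr0.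
move=> i; have si h := smooth_near_partial i hc cp (f := h).
have v1 : vanishing m (fun q => partial c i f q * g q).
  apply: (IH l.-1 k) => //; [|exact: si|].
    by case: (l) mlk => [|l'] /=; [rewrite add0n => /ltnW|rewrite addSn ltnS].
  by case: (l) vf => //= l' [].
have v2 : vanishing m (fun q => f q * partial c i g q).
  apply: (IH l k.-1) => //; [|exact: si|].
    by case: (k) mlk => [|k']; rewrite /= ?addn0 ?addnS//; exact: ltnW.
  by case: (k) vg => //= k' [].
have := vanishingD (smooth_nearM (si f sf) sg) (smooth_nearM sf (si g sg)) v1 v2.
apply: vanishing_eq.
apply: filterS (filterI (cdom_near cp) (filterI (smooth_near_open sf) (smooth_near_open sg))).
by move=> q [cq [sfq sgq]]; rewrite partialM.
Qed.

Lemma vanishing_sum k (I : Type) (r : seq I) (F : I -> fn) :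
  (forall s, smooth_near p (F s)) -> (forall s, vanishing k (F s)) ->
  vanishing k (fun q => \sum_(s <- r) F s q).
Proof.
move=> sF vF; elim: r => [|s r IH].
  by apply: vanishing_eq (vanishing0 k); apply: nearW => q; rewrite big_nil.
apply: vanishing_eq (vanishingD (sF s) (smooth_near_sum r (fun s _ => sF s)) (vF s) IH).
by apply: nearW => q; rewrite big_cons.
Qed.

Definition centered j : fn := fun q => coordf c j q - coordf c j p.

Lemma smooth_near_centered j : smooth_near p (centered j).
Proof.
apply: smooth_nearD; first exact: smooth_near_coordf.
exact: smooth_near_cst.
Qed.

Lemma partial_shift q i f (a : C) : cdom c q -> smooth_near q f ->
  partial c i (fun q => f q - a) q = partial c i f q.
Proof.
move=> cq sf; rewrite (partialD i hc cq sf (smooth_near_cst q (- a))) partial_cst addr0//.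
Qed.

Lemma vanishing_centered f : smooth_near p f -> vanishing 1 (fun q => f q - f p).
Proof. by move=> sf; split => //; exact: subrr. Qed.

(* Euler's identity: the Euler operator acts as [k] on the leading Taylor
   coefficients of a function vanishing to order [k]. *)
Lemma vanishing_euler k f : smooth_near p f -> vanishing k f ->
  vanishing k.+1 (fun q => k%:R * f q - \sum_j centered j q * partial c j f q).
Proof.
have at_p g : \sum_j centered j p * partial c j g p = 0.
  by apply: big1 => j _; rewrite /centered subrr mul0r.
have sE g : smooth_near p g -> forall q, cdom c q -> smooth_near q g ->
    smooth_near q (fun q => \sum_j centered j q * partial c j g q).
  move=> sg q cq sq; apply: smooth_near_sum => j _; apply: smooth_nearM.
    by apply: smooth_nearD; [exact: smooth_near_coordf|exact: smooth_near_cst].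
  exact: smooth_near_partial.
elim: k f => [|k IH] f sf vf.
  by split => //; rewrite mul0r at_p subr0.
split; first by case: vf => -> _; rewrite mulr0 at_p subr0.
move=> i; have si := smooth_near_partial i hc cp sf.
have := IH _ si (vf.2 i); apply: vanishing_eq.
apply: filterS (filterI (cdom_near cp) (smooth_near_open sf)) => q [cq sq].
have sqc j : smooth_near q (centered j).
  by apply: smooth_nearD; [exact: smooth_near_coordf|exact: smooth_near_cst].
have sqp j := smooth_near_partial j hc cq sq.
have skf : smooth_near q (fun q => k.+1%:R * f q) by apply: smooth_nearM => //;
  exact: smooth_near_cst.
rewrite (partialD i hc cq skf (smooth_nearN (sE _ sf q cq sq))) partialN//; last exact: sE.
rewrite partialZ// partial_sum//; last by move=> j _; exact: smooth_nearM.
have -> : \sum_j partial c i (fun q => centered j q * partial c j f q) q =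
    partial c i f q + \sum_j centered j q * partial c j (partial c i f) q.
  have -> : \sum_j partial c i (fun q => centered j q * partial c j f q) q =
      \sum_j ((i == j)%:R * partial c j f q + centered j q * partial c j (partial c i f) q).
    apply: eq_bigr => j _; rewrite partialM// partial_comm// partial_shift ?partial_coordf//.
    exact: smooth_near_coordf.
  rewrite big_split /=; congr (_ + _); rewrite (bigD1 i)//= eqxx mul1r big1 ?addr0// => j.
  by rewrite eq_sym => /negbTE ->; rewrite mul0r.
by rewrite -[in RHS]natr1 mulrDl mul1r opprD addrA addrK.
Qed.

(** Each of the [#|T|] coordinates is differentiated fewer than [N] times. *)
Lemma vanishing_mpartial (T : finType) (e : T -> cindex n) (N : nat) k (L : {ffun T ->
  'I_N}) f :
  vanishing (k + #|T| * N) f -> vanishing k (mpartial c e L f).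
Proof.
rewrite /mpartial cardE; elim: (enum T) k => [|t s IH] k /=; first by rewrite mul0n addn0.
rewrite mulSn => vf.
suff H m g : vanishing (k + m) g -> vanishing k (iter m (partial c (e t)) g).
  apply: H; apply: IH; apply: vanishing_le vf.
  by rewrite -addnA leq_add2l leq_add2r ltnW.
elim: m k g {IH vf} => [|m IH] k g; first by rewrite addn0.
move=> vg; rewrite iterSr; apply: IH.
by move: vg; rewrite addnS => -[_ /(_ (e t))].
Qed.

(* A functional of finite order whose kernel contains the ideal generated by
   functions spanning the cotangent space kills the maximal ideal: the order
   is lowered one step at a time with Euler's identity. *)
Lemma functional_eq0 (Lam : fn -> C) (I : finType) (w : I -> fn)
    (A : cindex n -> I -> C) (N : nat) :
  (forall f g, smooth_near p f -> (\forall q \near p, f q = g q) -> Lam f = Lam g) ->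
  (forall f g, smooth_near p f -> smooth_near p g -> Lam (fun q => f q + g q) = Lam f +
    Lam g) ->
  (forall (a : C) f, smooth_near p f -> Lam (fun q => a * f q) = a * Lam f) ->
  (forall f, smooth_near p f -> vanishing N f -> Lam f = 0) ->
  (forall s, smooth_near p (w s)) ->
  (forall s f, smooth_near p f -> Lam (fun q => w s q * f q) = 0) ->
  (forall j, vanishing 2 (fun q => centered j q - \sum_s A j s * w s q)) ->
  forall f, smooth_near p f -> vanishing 1 f -> Lam f = 0.
Proof.
move=> Leq LD LZ LN sw Lw span.
have Lsum (J : Type) (r : seq J) (F : J -> fn) : (forall s, smooth_near p (F s)) ->
    (forall s, Lam (F s) = 0) -> Lam (fun q => \sum_(s <- r) F s q) = 0.
  move=> sF F0; elim: r => [|s r IH].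
    have s0 := smooth_near_cst p (0 : C).
    rewrite -[RHS](mul0r (Lam (fun _ => 0))) -(LZ 0 _ s0); apply: Leq.
      by apply: smooth_near_eq s0; apply: nearW => q; rewrite big_nil.
    by apply: nearW => q; rewrite big_nil mul0r.
  have sr := smooth_near_sum r (fun s (_ : true) => sF s).
  transitivity (Lam (F s) + Lam (fun q => \sum_(s <- r) F s q)); last by rewrite F0 IH addr0.
  rewrite -(LD _ _ (sF s) sr); apply/esym/Leq; first exact: smooth_nearD.
  by apply: nearW => q; rewrite big_cons.
suff step k : (forall f, smooth_near p f -> vanishing k.+2 f -> Lam f = 0) ->
    forall f, smooth_near p f -> vanishing k.+1 f -> Lam f = 0.
  have {LN} : forall f, smooth_near p f -> vanishing N.+1 f -> Lam f = 0.
    by move=> f sf /vanishingW; exact: LN.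
  by elim: (N) => // k IH /step.
move=> Lk f sf vf.
have sp j := smooth_near_partial j hc cp sf.
have scp j := smooth_nearM (smooth_near_centered j) (sp j).
pose rest j : fn := fun q => centered j q - \sum_s A j s * w s q.
have sAw j : smooth_near p (fun q => \sum_s A j s * w s q).
  by apply: smooth_near_sum => s _; apply: smooth_nearM => //; exact: smooth_near_cst.
have srest j : smooth_near p (rest j).
  exact: smooth_nearD (smooth_near_centered j) (smooth_nearN (sAw j)).
(* Modulo order 2 the centred coordinate is a combination of the generators [w]. The generator part
   lies in the ideal killed by [Lam]; the remainder, times a derivative vanishing to order [k],
   vanishes to order $k+2$. *)
have Lj j : Lam (fun q => centered j q * partial c j f q) = 0.
  have s1 := smooth_nearM (srest j) (sp j).
  have s2 s : smooth_near p (fun q => w s q * (A j s * partial c j f q)).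
    by apply: smooth_nearM => //; apply: smooth_nearM => //; exact: smooth_near_cst.
  have s3 := smooth_near_sum (index_enum I) (fun s (_ : true) => s2 s).
  transitivity (Lam (fun q => rest j q * partial c j f q) +
      Lam (fun q => \sum_s w s q * (A j s * partial c j f q))).
    rewrite -(LD _ _ s1 s3); apply: Leq => //; apply: nearW => q.
    have -> : \sum_s w s q * (A j s * partial c j f q) =
      (\sum_s A j s * w s q) * partial c j f q.
      by rewrite mulr_suml; apply: eq_bigr => s _; rewrite mulrCA mulrA.
    by rewrite -mulrDl /rest subrK.
  rewrite Lk ?add0r//; first by apply: Lsum => // s; apply: Lw; apply: smooth_nearM => //;
    exact: smooth_near_cst.
  exact: (vanishingM (m := k.+2) (l := 2) (k := k) _ (srest j) (sp j) (span j) (proj2 vf j)).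
have sS := smooth_near_sum (index_enum (cindex n)) (fun j (_ : true) => scp j).
have skf : smooth_near p (fun q => k.+1%:R * f q) by apply: smooth_nearM => //;
  exact: smooth_near_cst.
have sE := smooth_nearD skf (smooth_nearN sS).
(* $(k+1)f$ differs from the Euler sum by a function vanishing to order $k+2$, which [Lam] kills,
   and $k+1$ is invertible. *)
have e : k.+1%:R * Lam f = 0.
  have e1 := Lk _ sE (vanishing_euler sf vf).
  have e2 := Lsum _ (index_enum (cindex n)) _ scp Lj.
  rewrite -(LZ _ _ sf); move: (LD _ _ sE sS); rewrite e1 e2 addr0 => <-; apply: Leq => //.
  by apply: nearW => q; rewrite subrK.
by move/eqP: e; rewrite mulf_eq0 pnatr_eq0 /= => /eqP.
Qed.

End VanishingOrder.

(** * The derivation defect *)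

Section DefectIdentities.
Variable K : comRingType.

Fact defect_additivity (x x' y y' z z' : K) :
  x + x' - y - y' - z - z' = x - y - z + x' - y' - z'.
Proof. ring. Qed.

Fact defect_homogeneity (h d x y z t : K) :
  d * t + h * x - h * y - (d * t + h * z) = h * (x - y - z).
Proof. ring. Qed.

Fact sum_exchange (x p d q t : K) : x + p + (d + q + t) = x + d + (p + q + t).
Proof. ring. Qed.

End DefectIdentities.

Section Defect.
Variables (R : realType) (n : nat) (M : complexManifold R n).
Local Notation C := (R[i]).
Local Notation fn := (M -> C).
Variables (omega : tensor2 M) (Cr : nat -> fn -> fn -> fn).
Hypotheses (Hstar : star_product omega Cr) (Hwick : wick_type Cr).
Variable X : vfield M.
Implicit Types (p q : M) (a b d f g h : fn).

Lemma smooth_near_defect r p a b : smooth_near p a -> smooth_near p b ->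
  smooth_near p (derivation_defect Cr X r a b).
Proof.
move=> sa sb; have sX f := smooth_near_vfield X (f := f).
have sC f g := smooth_near_Cr Hstar r (a := f) (b := g).
apply: smooth_nearD; last by apply: smooth_nearN; apply: sC => //; exact: sX.
apply: smooth_nearD; first by apply: sX; exact: sC.
by apply: smooth_nearN; apply: sC => //; exact: sX.
Qed.

Lemma vfield_Cr r p a b : X (Cr r a b) p =
  derivation_defect Cr X r a b p + Cr r (X a) b p + Cr r a (X b) p.
Proof. by rewrite /derivation_defect [X in _ = X + _]addrAC !subrK. Qed.

Lemma vfield_Cr_Crl r s p a b d : smooth_near p a -> smooth_near p b -> smooth_near p d ->
  X (Cr s (Cr r a b) d) p = derivation_defect Cr X s (Cr r a b) d p
    + (Cr s (derivation_defect Cr X r a b) d p + Cr s (Cr r (X a) b) d p +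
      Cr s (Cr r a (X b)) d p)
    + Cr s (Cr r a b) (X d) p.
Proof.
move=> sa sb sd; have sX f := smooth_near_vfield X (f := f).
have sC f g := smooth_near_Cr Hstar r (a := f) (b := g) (p := p).
have sD := smooth_near_defect r sa sb.
have s1 := sC _ _ (sX p a sa) sb; have s2 := sC _ _ sa (sX p b sb).
rewrite vfield_Cr; congr (_ + _ + _).
rewrite -(CrDl Hstar s sD s1 sd) -(CrDl Hstar s (smooth_nearD sD s1) s2 sd).
by apply: (Cr_eq Hstar) => //; [apply: sX; exact: sC|apply: nearW => q;
  exact: vfield_Cr|exact: nearW].
Qed.

Lemma vfield_Cr_Crr r s p a b d : smooth_near p a -> smooth_near p b -> smooth_near p d ->
  X (Cr s a (Cr r b d)) p = derivation_defect Cr X s a (Cr r b d) p + Cr s (X a) (Cr r b d) p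
    + (Cr s a (derivation_defect Cr X r b d) p + Cr s a (Cr r (X b) d) p +
      Cr s a (Cr r b (X d)) p).
Proof.
move=> sa sb sd; have sX f := smooth_near_vfield X (f := f).
have sC f g := smooth_near_Cr Hstar r (a := f) (b := g) (p := p).
have sD := smooth_near_defect r sb sd.
have s1 := sC _ _ (sX p b sb) sd; have s2 := sC _ _ sb (sX p d sd).
rewrite vfield_Cr; congr (_ + _ + _).
rewrite -(CrDr Hstar s sa sD s1) -(CrDr Hstar s sa (smooth_nearD sD s1) s2).
by apply: (Cr_eq Hstar) => //; [apply: sX; exact: sC|exact: nearW|apply: nearW => q;
  exact: vfield_Cr].
Qed.

(** [X] is applied to both sides of associativity at order [r]. The terms in which [X] reaches only
    [a], [b] or [d] cancel by associativity for the triples containing [X a], [X b] or [X d]; the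
    defects are what remains. *)
Lemma defect_assoc r p a b d : smooth_near p a -> smooth_near p b -> smooth_near p d ->
  \sum_(s < r.+1) derivation_defect Cr X s (Cr (r - s)%N a b) d p
    + \sum_(s < r.+1) Cr s (derivation_defect Cr X (r - s)%N a b) d p =
  \sum_(s < r.+1) derivation_defect Cr X s a (Cr (r - s)%N b d) p
    + \sum_(s < r.+1) Cr s a (derivation_defect Cr X (r - s)%N b d) p.
Proof.
rewrite -[LHS]big_split -[RHS]big_split /=.
move=> sa sb sd; have sX f := smooth_near_vfield X (f := f) (p := p).
have sC k f g := smooth_near_Cr Hstar k (a := f) (b := g).
have E : X (fun q => \sum_(s < r.+1) Cr s (Cr (r - s)%N a b) d q) p =
         X (fun q => \sum_(s < r.+1) Cr s a (Cr (r - s)%N b d) q) p.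
  apply: vfield_eq; first by apply: smooth_near_sum => s _; apply: (sC) => //; exact: sC.
  apply: filterS (filterI (smooth_near_open sa) (filterI (smooth_near_open sb) (smooth_near_open sd))).
  by move=> q [sqa [sqb sqd]]; exact: (Cr_assoc Hstar).
rewrite !(vfield_sum X) in E; last first.
- by move=> s _; apply: (sC) => //; exact: sC.
- by move=> s _; apply: (sC) => //; exact: sC.
have EL : \sum_(s < r.+1) X (Cr s (Cr (r - s)%N a b) d) p =
    \sum_(s < r.+1) (derivation_defect Cr X s (Cr (r - s)%N a b) d p
      + Cr s (derivation_defect Cr X (r - s)%N a b) d p)
    + (\sum_(s < r.+1) Cr s (Cr (r - s)%N (X a) b) d p
     + \sum_(s < r.+1) Cr s (Cr (r - s)%N a (X b)) d p
     + \sum_(s < r.+1) Cr s (Cr (r - s)%N a b) (X d) p).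
  rewrite -!big_split; apply: eq_bigr => s _; rewrite (vfield_Cr_Crl _ _ sa sb sd) /=.
  by rewrite !addrA.
have ER : \sum_(s < r.+1) X (Cr s a (Cr (r - s)%N b d)) p =
    \sum_(s < r.+1) (derivation_defect Cr X s a (Cr (r - s)%N b d) p
      + Cr s a (derivation_defect Cr X (r - s)%N b d) p)
    + (\sum_(s < r.+1) Cr s (X a) (Cr (r - s)%N b d) p
     + \sum_(s < r.+1) Cr s a (Cr (r - s)%N (X b) d) p
     + \sum_(s < r.+1) Cr s a (Cr (r - s)%N b (X d)) p).
  rewrite -!big_split; apply: eq_bigr => s _; rewrite (vfield_Cr_Crr _ _ sa sb sd) /=.
  exact: sum_exchange.
move: E; rewrite EL ER.
rewrite (Cr_assoc Hstar r (sX _ sa) sb sd) (Cr_assoc Hstar r sa (sX _ sb) sd).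
by rewrite (Cr_assoc Hstar r sa sb (sX _ sd)) => /addIr.
Qed.

Lemma defectDr r p a b b' : smooth_near p a -> smooth_near p b -> smooth_near p b' ->
  derivation_defect Cr X r a (fun q => b q + b' q) p =
  derivation_defect Cr X r a b p + derivation_defect Cr X r a b' p.
Proof.
move=> sa sb sb'; have sX f := smooth_near_vfield X (f := f) (p := p).
have sC f g := smooth_near_Cr Hstar r (a := f) (b := g) (p := p).
have sbb := smooth_nearD sb sb'.
have -> : derivation_defect Cr X r a (fun q => b q + b' q) p =
    X (fun q => Cr r a b q + Cr r a b' q) p - (Cr r (X a) b p + Cr r (X a) b' p)
    - (Cr r a (X b) p + Cr r a (X b') p).
  rewrite /derivation_defect (CrDr Hstar r (sX _ sa) sb sb'); congr (_ - _ - _).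
    apply: vfield_eq; first exact: sC.
    apply: filterS (filterI (smooth_near_open sa) (filterI (smooth_near_open sb) (smooth_near_open sb'))).
    by move=> q [sqa [sqb sqb']]; exact: (CrDr Hstar).
  rewrite -(CrDr Hstar r sa (sX _ sb) (sX _ sb')); apply: (Cr_eq Hstar) => //;
    [exact: sX|exact: nearW|].
  apply: filterS (filterI (smooth_near_open sb) (smooth_near_open sb')) => q [sqb sqb'].
  exact: vfieldD.
rewrite (vfieldD X (sC _ _ sa sb) (sC _ _ sa sb')) /derivation_defect !opprD !addrA.
exact: defect_additivity.
Qed.

Section Chart.
Variable c : chart R n M.
Hypothesis hc : holo c.
Hypothesis X_holo : forall p k l, cdom c p -> partial c (inr l) (vcomp X c (inl k)) p = 0.

(** $C_r(a,\cdot)$ is linear over holomorphic functions and [X] preserves these, so the two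
    contributions $(Xh)\,C_r(a,b)$ cancel. *)
Lemma defect_holomorphic r p a b h : (0 < r)%N -> cdom c p ->
  smooth_near p a -> smooth_near p b -> smooth_near p h ->
  (forall l, \forall q \near p, partial c (inr l) h q = 0) ->
  derivation_defect Cr X r a (fun q => h q * b q) p = h p * derivation_defect Cr X r a b p.
Proof.
move=> r0 cp sa sb sh kh; have sX f := smooth_near_vfield X (f := f) (p := p).
have sC f g := smooth_near_Cr Hstar r (a := f) (b := g) (p := p).
have kXh l : \forall q \near p, partial c (inr l) (X h) q = 0.
  have [V [oV Vp sV]] : exists V, [/\ open V, V p & forall q, V q ->
      smooth_near q h /\ forall l, partial c (inr l) h q = 0].
    apply: near_open; apply: filterI; first exact: smooth_near_open.
    exact: filter_forall.
  apply: filterS (filterI (cdom_near cp) (open_near oV Vp)) => q [cq Vq].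
  rewrite (partial_vfield X (inr l) hc cq (sV q Vq).1).
  have -> : X (partial c (inr l) h) q = 0.
    rewrite -(vfield_cst X q 0); apply: vfield_eq.
      exact: smooth_near_partial (sV q Vq).1.
    by apply: filterS (open_near oV Vq) => q' Vq'; rewrite (sV q' Vq').2.
  rewrite add0r big_sumType /= big1 ?add0r; last by move=> j _; rewrite X_holo// mul0r.
  by apply: big1 => j _; rewrite (sV q Vq).2 mulr0.
have e1 : X (Cr r a (fun q => h q * b q)) p = X h p * Cr r a b p + h p * X (Cr r a b) p.
  rewrite -(vfieldM X sh (sC _ _ sa sb)); apply: vfield_eq; first exact/sC/smooth_nearM.
  have [V [oV Vp sV]] : exists V, [/\ open V, V p & forall q, V q ->
      [/\ smooth_near q a, smooth_near q b, smooth_near q h & forall l,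
        partial c (inr l) h q = 0]].
    apply: near_open.
    have khall : \forall q \near p, forall l, partial c (inr l) h q =
      0 by exact: filter_forall.
    apply: filterS (filterI (filterI (smooth_near_open sa) (smooth_near_open sb)) (filterI (smooth_near_open sh) khall)).
    by move=> q [[? ?] [? ?]]; split.
  apply: filterS (filterI (cdom_near cp) (open_near oV Vp)) => q [cq Vq].
  have [sqa sqb sqh _] := sV q Vq.
  apply: (Cr_wickr Hwick r0 hc cq sqa sqb sqh) => l.
  by apply: filterS (open_near oV Vq) => q' /sV[].
have e2 : Cr r (X a) (fun q => h q * b q) p = h p * Cr r (X a) b p.
  exact: (Cr_wickr Hwick r0 hc cp (sX _ sa) sb sh kh).
have e3 : Cr r a (X (fun q => h q * b q)) p = X h p * Cr r a b p + h p * Cr r a (X b) p.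
  rewrite -(Cr_wickr Hwick r0 hc cp sa sb (sX _ sh) kXh) -(Cr_wickr Hwick r0 hc cp sa (sX _ sb) sh kh).
  rewrite -(CrDr Hstar r sa (smooth_nearM (sX _ sh) sb) (smooth_nearM sh (sX _ sb))).
  apply: (Cr_eq Hstar) => //; [exact/sX/smooth_nearM|exact: nearW|].
  by apply: filterS (filterI (smooth_near_open sb) (smooth_near_open sh)) => q [sqb sqh];
    exact: vfieldM.
rewrite /derivation_defect e1 e2 e3; exact: defect_homogeneity.
Qed.

Lemma defect_1 r p a : (0 < r)%N -> smooth_near p a ->
  derivation_defect Cr X r a (fun _ => 1) p = 0.
Proof.
move=> r0 sa; have s1 q := smooth_near_cst q (1 : C).
rewrite /derivation_defect (Cr_1r Hstar r0 (smooth_near_vfield X sa)).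
have -> : Cr r a (X (fun _ => 1)) p = 0.
  rewrite -(Cr0r Hstar r sa); apply: (Cr_eq Hstar) => //;
    [exact: smooth_near_vfield|exact: nearW|].
  by apply: nearW => q; rewrite vfield_cst.
rewrite !subr0 -(vfield_cst X p 0); apply: vfield_eq; first exact: (smooth_near_Cr Hstar).
by apply: filterS (smooth_near_open sa) => q sq; rewrite (Cr_1r Hstar r0 sq).
Qed.

Lemma Cr_vanishing r p a : cdom c p -> smooth_near p a -> exists N, forall k b,
  smooth_near p b -> vanishing c p (k + N) b -> vanishing c p k (Cr r a b).
Proof.
move=> cp sa; have [N [coef [sc H]]] := Cr_formula Hstar r hc cp.
exists (#|{: cindex n}| * N)%N => k b sb vb.
have sm e L f := smooth_near_mpartial e hc cp L (f := f).
apply: (@vanishing_eq _ _ _ _ _ cp _ (fun q =>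
  \sum_K \sum_L coef K L q * mpartial c id K a q * mpartial c id L b q)).
  apply: filterS (filterI H (filterI (smooth_near_open sa) (smooth_near_open sb))).
  by move=> q [Hq [sqa sqb]]; rewrite Hq.
have s1 K L : smooth_near p (fun q => coef K L q * mpartial c id K a q).
  by apply: smooth_nearM; [exact: sc|exact: sm].
have s2 K L : smooth_near p (fun q => coef K L q * mpartial c id K a q * mpartial c id L b q).
  by apply: smooth_nearM; [exact: s1|exact: sm].
apply: vanishing_sum => // K; first by apply: smooth_near_sum => L _.
apply: vanishing_sum => // L.
apply: (vanishingM hc cp (m := k) (l := 0) (k := k)) => //; first exact: sm.
exact: vanishing_mpartial.
Qed.

Lemma vfield_vanishing k p b : cdom c p -> smooth_near p b ->
  vanishing c p k.+1 b -> vanishing c p k (X b).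
Proof.
move=> cp sb vb.
apply: (@vanishing_eq _ _ _ _ _ cp _ (fun q => \sum_j vcomp X c j q * partial c j b q)).
  apply: filterS (filterI (cdom_near cp) (smooth_near_open sb)) => q [cq sq].
  by rewrite (vfield_chart X hc cq sq).
have sv j := smooth_near_vcomp X j hc cp; have sp j := smooth_near_partial j hc cp sb.
apply: vanishing_sum => // j; first exact: smooth_nearM.
by apply: (vanishingM hc cp (m := k) (l := 0) (k := k)) => //; exact: (proj2 vb j).
Qed.

Lemma defect_vanishing r p a : cdom c p -> smooth_near p a -> exists N, forall b,
  smooth_near p b -> vanishing c p N b -> derivation_defect Cr X r a b p = 0.
Proof.
move=> cp sa; have [N1 H1] := Cr_vanishing r cp sa.
have [N2 H2] := Cr_vanishing r cp (smooth_near_vfield X sa).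
(* Applying [X] costs one order and $C_r(a,\cdot)$ costs [N1], so $2 + N_1$ leaves order 1 for both
   terms combining them; $C_r(Xa,\cdot)$ needs $1 + N_2$. *)
exists (2 + N1 + N2)%N => b sb vb.
have v1 : vanishing c p 1 (X (Cr r a b)).
  apply: vfield_vanishing => //; first exact: (smooth_near_Cr Hstar).
  by apply: H1 => //; apply: vanishing_le vb; rewrite leq_addr.
have v2 : vanishing c p 1 (Cr r (X a) b).
  by apply: H2 => //; apply: vanishing_le vb; rewrite leq_add2r.
have v3 : vanishing c p 1 (Cr r a (X b)).
  apply: H1; first exact: smooth_near_vfield.
  by apply: vfield_vanishing => //; apply: vanishing_le vb; rewrite leq_addr.
by rewrite /derivation_defect (proj1 v1) (proj1 v2) (proj1 v3) !subr0.
Qed.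

End Chart.
End Defect.

Lemma sum_inl_delta (K : pzRingType) (n : nat) (F : 'I_n -> K) (m : 'I_n) :
  \sum_i F i * (inl m == inl i :> cindex n)%:R = F m.
Proof.
rewrite (bigD1 m)//= eqxx mulr1 big1 ?addr0// => i im.
rewrite (_ : (inl m == inl i :> cindex n) = false) ?mulr0//.
by apply/negbTE; apply: contra im => /eqP[->].
Qed.

(** * Vanishing of the derivation defect *)

Section DefectVanishes.
Variables (R : realType) (n : nat) (M : complexManifold R n).
Local Notation C := (R[i]).
Local Notation fn := (M -> C).
Variables (omega : tensor2 M) (Cr : nat -> fn -> fn -> fn).
Hypothesis Homega : pseudo_kahler omega.
Hypotheses (Hstar : star_product omega Cr) (Hwick : wick_type Cr).
Variable X : vfield M.
Variable c : chart R n M.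
Hypothesis hc : holo c.
Hypothesis X_holo : forall p k l, cdom c p -> partial c (inr l) (vcomp X c (inl k)) p = 0.
Hypothesis X_anti : forall p k l, cdom c p -> partial c (inl k) (vcomp X c (inr l)) p = 0.
Variable u : 'I_n -> fseries M.
Hypothesis Hu : left_potentials Cr c u.
Implicit Types (p q : M) (a b d f g h : fn).

(** The Hamiltonian field of $u_{k,0}$ has component $\delta_{kj}$ along $Z_j$, because $C_1(z^j,
    u_{k,0}) = \partial_k z^j$ and $C_1(u_{k,0}, z^j) = 0$; contraction with the (1,1)-form $\omega$
    then selects $\omega_{k\bar l}$. *)
Lemma potential_derivative p k l : cdom c p ->
  partial c (inr l) (u k 0%N) p = omega c (inl k) (inr l) p.
Proof.
move=> cp; have [_ _ ndeg _ t11] := Homega.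
have su := smooth_near_potential Hu k 0 cp.
have [Y HY Hb] := Cr1_poisson Hstar ndeg hc cp su.
have Yk j : Y (inl j) = (k == j)%:R.
  have sz := smooth_near_coordf (inl j) hc cp.
  have := Hb _ sz; rewrite sum_partial_coordf//.
  rewrite (Cr_holomorphic Hstar Hwick hc)//; last by move=> l'; exact: coordf_killed.
  have := higher_product_potential Hstar Hu k 1 cp sz.
  rewrite /higher_product big_ord_recl big_ord0 addr0 /= subnn => ->.
  by rewrite partial_coordf// sub0r => /oppr_inj <-.
rewrite -HY big_sumType /= [X in _ + X]big1 ?addr0; last first.
  by move=> j _; rewrite t11// mulr0.
rewrite (bigD1 k)//= Yk eqxx mul1r big1 ?addr0// => j.
by rewrite Yk eq_sym => /negbTE ->; rewrite mul0r.
Qed.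

(** A row vector in the kernel, extended by zero along the $\bar Z_l$, lies in the kernel of
    $\omega$ because $\omega$ has type (1,1). *)
Lemma potential_derivative_inverse p : cdom c p -> exists B : 'M[C]_n, forall l m,
  \sum_k B l k * partial c (inr m) (u k 0%N) p = (l == m)%:R.
Proof.
move=> cp; have [_ _ ndeg _ t11] := Homega.
pose W : 'M[C]_n := \matrix_(k, m) partial c (inr m) (u k 0%N) p.
have Wu : W \in unitmx.
  rewrite -row_free_unit -kermx_eq0; apply/eqP/row_matrixP => r; rewrite row0.
  set v := row r (kermx W).
  have vW : v *m W = 0 by rewrite -row_mul mulmx_ker row0.
  pose v' (i : cindex n) : C := if i is inl k then v 0 k else 0.
  have H : forall i, v' i = 0.
    apply: (ndeg c p hc cp) => -[m|m]; rewrite big_sumType /= [X in _ + X]big1 ?addr0.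
    - by apply: big1 => k _; rewrite t11// mulr0.
    - by move=> k _; rewrite mul0r.
    - have := congr1 (fun A : 'rV[C]_n => A 0 m) vW; rewrite !mxE => e; rewrite -[RHS]e.
      by apply: eq_bigr => k _; rewrite [W _ _]mxE potential_derivative.
    - by move=> k _; rewrite mul0r.
  by apply/rowP => k; rewrite [RHS]mxE; exact: (H (inl k)).
exists (invmx W) => l m.
have := congr1 (fun A : 'M[C]_n => A l m) (mulVmx Wu); rewrite !mxE => <-.
by apply: eq_bigr => k _; rewrite mxE.
Qed.

Definition cotangent_generator p (s : cindex n) : fn :=
  match s with
  | inl k => centered c p (inl k)
  | inr k => fun q => u k 0%N q - u k 0%N p
  end.

Lemma smooth_near_generator p s : cdom c p -> smooth_near p (cotangent_generator p s).
Proof.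
move=> cp; case: s => k /=; first exact: smooth_near_centered.
apply: smooth_nearD; [exact: smooth_near_potential|exact: smooth_near_cst].
Qed.

Lemma cotangent_span p : cdom c p -> exists A : cindex n -> cindex n -> C, forall j,
  vanishing c p 2 (fun q => centered c p j q - \sum_s A j s * cotangent_generator p s q).
Proof.
move=> cp; have [B HB] := potential_derivative_inverse cp.
pose du k m := partial c (inl m) (u k 0%N) p.
(* The last two cases solve $du_k = \partial_m u_k\,dz^m + \bar\partial_m u_k\,d\bar z^m$ for $d\bar
   z^l = B_{lk}\,(du_k - \partial_m u_k\,dz^m)$ at [p]. *)
pose A (j s : cindex n) : C :=
  match j, s with
  | inl k, inl m => (k == m)%:R
  | inl k, inr m => 0
  | inr l, inr k => B l k
  | inr l, inl m => - \sum_k B l k * du k m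
  end.
have sg s := smooth_near_generator s cp.
have sAg j s : smooth_near p (fun q => A j s * cotangent_generator p s q).
  by apply: smooth_nearM => //; exact: smooth_near_cst.
have sS j := smooth_near_sum (index_enum (cindex n)) (fun s (_ : true) => sAg j s).
have scj j := smooth_near_centered hc cp j.
exists A => j; split.
  rewrite {1}/centered subrr sub0r big1 ?oppr0// => s _.
  by case: s => k /=; rewrite /centered subrr mulr0.
move=> i; split => //.
rewrite (partialD i hc cp (scj j) (smooth_nearN (sS j))) (partialN i hc cp (sS j)).
rewrite (partial_sum i _ hc cp (fun s _ => sAg j s)).
rewrite (partial_shift hc i _ cp (smooth_near_coordf j hc cp)) partial_coordf//.
have dg s : partial c i (fun q => A j s * cotangent_generator p s q) p = A j s *
    match s with inl k => (i == inl k)%:R | inr k => partial c i (u k 0%N) p end.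
  rewrite (partialZ i _ hc cp (sg s)); congr (_ * _); case: s => k.
    by rewrite (partial_shift hc i _ cp (smooth_near_coordf (inl k) hc cp)) partial_coordf.
  by rewrite (partial_shift hc i _ cp (smooth_near_potential Hu k 0 cp)).
rewrite (eq_bigr _ (fun s _ => dg s)) big_sumType /=.
apply/eqP; rewrite subr_eq0; apply/eqP.
case: j {sAg sS scj dg} => k; case: i => m /=.
- rewrite [X in _ + X]big1 ?addr0; last by move=> s _; rewrite mul0r.
  rewrite (bigD1 k)//= eqxx mul1r big1 ?addr0//.
    by move=> s; rewrite eq_sym => /negbTE ->; rewrite mul0r.
- rewrite [X in _ + X]big1 ?addr0; last by move=> s _; rewrite mul0r.
  by rewrite big1// => s _; rewrite mulr0.
- by rewrite (sum_inl_delta (fun i => - \sum_(k0 < n) B k k0 * du k0 i)) addNr.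
- rewrite big1 ?add0r; last by move=> s _; rewrite mulr0.
  by rewrite HB eq_sym.
Qed.

Hypothesis u_holo : forall p k m l, cdom c p ->
  partial c (inr l) (transported_potential c u X k m) p = 0.

Lemma defect_potential_sum p a k m : cdom c p -> smooth_near p a ->
  \sum_(r < m) derivation_defect Cr X r.+1 a (u k (m - r.+1)%N) p = 0.
Proof.
move=> cp sa; rewrite -[RHS](higher_product_transported Hstar Hwick hc Hu X_holo X_anti k m cp sa).
rewrite (higher_product_holomorphic Hstar Hwick hc m cp sa) ?add0r//.
- by move=> j; exact: (smooth_near_transported hc Hu).
- by move=> j l; apply: filterS (cdom_near cp) => q cq; exact: u_holo.
Qed.

Lemma defect_eq0 r p a b : cdom c p -> smooth_near p a -> smooth_near p b ->
  derivation_defect Cr X r a b p = 0.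
Proof.
elim/ltn_ind: r p a b => -[_|r IH] p a b cp sa sb.
  rewrite /derivation_defect (Cr0_mul Hstar (smooth_near_vfield X sa) sb).
  rewrite (Cr0_mul Hstar sa (smooth_near_vfield X sb)).
  have -> : X (Cr 0 a b) p = X (fun q => a q * b q) p.
    apply: vfield_eq; first exact: (smooth_near_Cr Hstar).
    apply: filterS (filterI (smooth_near_open sa) (smooth_near_open sb)) => q [sqa sqb].
    exact: (Cr0_mul Hstar).
  by rewrite (vfieldM X sa sb) addrAC addrK subrr.
have near0 s f g : (s < r.+1)%N -> smooth_near p f -> smooth_near p g ->
    \forall q \near p, derivation_defect Cr X s f g q = 0.
  move=> sr sf sg.
  apply: filterS (filterI (cdom_near cp) (filterI (smooth_near_open sf) (smooth_near_open sg))).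
  by move=> q [cq [sqf sqg]]; exact: IH.
have sC k f g := smooth_near_Cr Hstar k (a := f) (b := g) (p := p).
have sD k f g := smooth_near_defect Hstar X k (a := f) (b := g) (p := p).
have cocycle f g d : smooth_near p f -> smooth_near p g -> smooth_near p d ->
    derivation_defect Cr X r.+1 (fun q => f q * g q) d p +
      derivation_defect Cr X r.+1 f g p * d p =
    derivation_defect Cr X r.+1 f (fun q => g q * d q) p +
      f p * derivation_defect Cr X r.+1 g d p.
  move=> sf sg sd; have := defect_assoc Hstar X r.+1 sf sg sd.
  (* On each side the two terms pairing $D_{r+1}$ with $C_0$ are isolated: the last of one sum and
     the first of the other. Every other term contains a defect of order at most [r]. *)
  rewrite [X in X + _ = _]big_ord_recr [X in _ + X = _]big_ord_recl.
  rewrite [X in _ = X + _]big_ord_recr [X in _ = _ + X]big_ord_recl /= !subn0 !subnn.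
  have z1 f' g' d' : smooth_near p f' -> smooth_near p g' -> smooth_near p d' ->
      \sum_(i < r.+1) derivation_defect Cr X i (Cr (r.+1 - i) f' g') d' p = 0 /\
      \sum_(i < r.+1) derivation_defect Cr X i d' (Cr (r.+1 - i) f' g') p = 0.
    move=> sf' sg' sd'; split; apply: big1 => i _.
      exact: (nbhs_singleton (near0 _ _ _ (ltn_ord i) (sC _ _ _ sf' sg') sd')).
    exact: (nbhs_singleton (near0 _ _ _ (ltn_ord i) sd' (sC _ _ _ sf' sg'))).
  rewrite (z1 f g d sf sg sd).1 (z1 g d f sg sd sf).2 !add0r.
  have lt i : (r.+1 - bump 0 i < r.+1)%N by rewrite /bump /= add1n subSS ltnS leq_subr.
  rewrite [X in _ + (_ + X) = _]big1 ?addr0; last first.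
    move=> i _; rewrite -(Cr0l Hstar (bump 0 i) sd); apply: (Cr_eq Hstar) => //;
      first exact: sD.
      exact: near0.
    exact: nearW.
  rewrite [X in _ = _ + (_ + X)]big1 ?addr0; last first.
    move=> i _; rewrite -(Cr0r Hstar (bump 0 i) sf); apply: (Cr_eq Hstar) => //;
      first exact: sD.
      exact: nearW.
    exact: near0.
  rewrite (Cr0_mul Hstar (sD _ _ _ sf sg) sd) (Cr0_mul Hstar sf (sD _ _ _ sg sd)).
  have prod f' g' : smooth_near p f' -> smooth_near p g' -> \forall q \near p,
    Cr 0 f' g' q = f' q * g' q.
    move=> sf' sg'; apply: filterS (filterI (smooth_near_open sf') (smooth_near_open sg')).
    by move=> q [? ?]; exact: (Cr0_mul Hstar).
  rewrite (derivation_defect_eq Hstar X r.+1 (sC _ _ _ sf sg) sd (prod _ _ sf sg) (nearW _ (fun=> erefl))).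
  by rewrite (derivation_defect_eq Hstar X r.+1 sf (sC _ _ _ sg sd) (nearW _ (fun=>
    erefl)) (prod _ _ sg sd)).
have su k := smooth_near_potential Hu k 0 cp.
(* In the sum of defects against $u_k$ the lower orders vanish by induction, leaving $D_{r+1}(f,
   u_{k,0})$. *)
have Du f k : smooth_near p f -> derivation_defect Cr X r.+1 f (u k 0%N) p = 0.
  move=> sf; have := defect_potential_sum k r.+1 cp sf.
  rewrite big_ord_recr /= subnn big1 ?add0r// => i _.
  by apply: IH => //; [rewrite ltnS|exact: (smooth_near_potential Hu)].
(* In the cocycle identity with $u_{k,0}$ as third argument, both defects against $u_{k,0}$ drop
   out, so $D_{r+1}(f,\cdot)$ commutes with multiplication by $u_{k,0}$. *)
have Dmulu f g k : smooth_near p f -> smooth_near p g ->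
    derivation_defect Cr X r.+1 f (fun q => g q * u k 0%N q) p =
      derivation_defect Cr X r.+1 f g p * u k 0%N p.
  move=> sf sg; have := cocycle f g _ sf sg (su k).
  by rewrite (Du _ k (smooth_nearM sf sg)) (Du _ k sg) mulr0 addr0 add0r => ->.
(* Constants are holomorphic, so homogeneity is a case of linearity over holomorphic functions. *)
have DZ (e : C) g : smooth_near p g ->
    derivation_defect Cr X r.+1 a (fun q => e * g q) p = e * derivation_defect Cr X r.+1 a g p.
  move=> sg; apply: (defect_holomorphic Hstar Hwick hc X_holo (ltn0Sn r) cp sa sg (smooth_near_cst p e)).
  by move=> l; apply: nearW => q; exact: partial_cst.
have [A span] := cotangent_span cp.
have [N HN] := defect_vanishing Hstar X hc r.+1 cp sa.
have key f : smooth_near p f -> vanishing c p 1 f -> derivation_defect Cr X r.+1 a f p = 0.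
  apply: (functional_eq0 hc cp (Lam := fun f => derivation_defect Cr X r.+1 a f p)
    (w := cotangent_generator p) (A := A) (N := N)) => //.
  - by move=> f' g sf' e; apply: (derivation_defect_eq Hstar) => //; exact: nearW.
  - by move=> f' g sf' sg; exact: (defectDr Hstar).
  - by move=> s; exact: smooth_near_generator.
  - move=> [k|k] g sg /=.
      rewrite (defect_holomorphic Hstar Hwick hc X_holo (ltn0Sn r) cp sa sg (smooth_near_centered hc cp (inl k))).
        by rewrite /centered subrr mul0r.
      move=> l; apply: filterS (cdom_near cp) => q cq.
      by rewrite (partial_shift hc (inr l) _ cq (smooth_near_coordf (inl k) hc cq)) partial_coordf.
    have s1 := smooth_nearM sg (su k).
    have s2 : smooth_near p (fun q => - u k 0%N p * g q) by apply: smooth_nearM => //;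
      exact: smooth_near_cst.
    transitivity (derivation_defect Cr X r.+1 a (fun q => g q * u k 0%N q +
      - u k 0%N p * g q) p).
      apply: (derivation_defect_eq Hstar) => //; [|exact: nearW|].
        by apply: smooth_nearM => //; exact: (smooth_near_generator (inr k) cp).
      by apply: nearW => q; rewrite mulrBl mulNr [u k 0%N q * _]mulrC.
    by rewrite (defectDr Hstar X r.+1 sa s1 s2) Dmulu// DZ// mulNr [_ * u _ _ _]mulrC subrr.
have s1 : smooth_near p (fun q => b q - b p) by apply: smooth_nearD => //;
  exact: smooth_near_cst.
have s2 : smooth_near p (fun q => b p * 1) by exact: smooth_near_cst.
transitivity (derivation_defect Cr X r.+1 a (fun q => (b q - b p) + b p * 1) p).
  by apply: (derivation_defect_eq Hstar) => //; [exact: nearW|apply: nearW => q;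
    rewrite mulr1 subrK].
rewrite (defectDr Hstar X r.+1 sa s1 s2) (key _ s1 (vanishing_centered c sb)) add0r.
rewrite DZ; last exact: smooth_near_cst.
by rewrite (defect_1 Hstar X (ltn0Sn r) sa) mulr0.
Qed.

End DefectVanishes.

(** * Lie derivatives *)

Section TensorIdentities.
Variable K : comRingType.

Fact pullback_reorder_left (a x y z : K) : a * x * y * z = a * (z * x) * y.
Proof. ring. Qed.

Fact pullback_reorder_right (a x y z : K) : a * x * y * z = a * x * (z * y).
Proof. ring. Qed.

Fact contraction_reorder_left (a d x y : K) : a * d * x * y = a * (x * d) * y.
Proof. ring. Qed.

Fact contraction_reorder_right (a d x y : K) : a * d * x * y = a * x * (y * d).
Proof. ring. Qed.

Fact tensor_leibniz_collect (t a x y s s' e e' : K) :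
  t + a * s * y + a * x * s' + a * e * y + a * x * e' =
  t + a * (s + e) * y + a * x * (s' + e').
Proof. ring. Qed.

End TensorIdentities.

Section LieDerivatives.
Variables (R : realType) (n : nat) (M : complexManifold R n) (X : vfield M).
Local Notation C := (R[i]).
Implicit Types (p q : M) (c : chart R n M) (i j k l m : cindex n).

Lemma lie_form_antisymmetric (alpha : tensor2 M) c i j p : two_form alpha -> holo c ->
  cdom c p ->
  lie_form X alpha c i j p = - lie_form X alpha c j i p.
Proof.
move=> [sm anti _] hc cp; rewrite /lie_form !opprD -!sumrN.
have -> : X (alpha c i j) p = - X (alpha c j i) p.
  have sa : smooth_near p (alpha c j i) by apply: smooth_on_near (sm c j i hc) => //;
    exact: chart_dom_open.
  rewrite -(vfieldN X sa); apply/esym/vfield_eq; first exact: smooth_nearN.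
  by apply: filterS (cdom_near cp) => q cq; rewrite [RHS]anti.
rewrite addrAC; congr (_ + _ + _); apply: eq_bigr => k _; by rewrite anti// mulNr.
Qed.

(** Potentials exist only on special charts, while vanishing is asked in all of them; tensoriality
    of the Lie derivative carries the result across. *)
Lemma lie_form_transform (alpha : tensor2 M) c c' i j p : two_form alpha ->
  holo c -> holo c' -> cdom c p -> cdom c' p ->
  lie_form X alpha c i j p = \sum_k \sum_l lie_form X alpha c' k l p *
    partial c i (coordf c' k) p * partial c j (coordf c' l) p.
Proof.
move=> [sm _ tr] hc hc' cp c'p.
pose J k i : M -> C := partial c i (coordf c' k).
have sx k : smooth_near p (coordf c' k) by exact: smooth_near_coordf.
have sJ k i' : smooth_near p (J k i') by exact: smooth_near_partial.
have sa k l : smooth_near p (alpha c' k l).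
  by apply: smooth_on_near (sm c' k l hc') => //; exact: chart_dom_open.
have sv k : smooth_near p (vcomp X c' k) by exact: smooth_near_vcomp.
(* The derivative of $X'^k$ is computed twice: by the commutator formula in [c] and by the chain
   rule through [c']. Equating the two removes the terms in which [X] differentiates the
   Jacobian. *)
pose P k i := partial c i (vcomp X c' k) p.
have P1 k i' : P k i' = X (J k i') p + \sum_m partial c i' (vcomp X c m) p * J k m p.
  exact: partial_vfield.
have P2 k i' : P k i' = \sum_m J m i' p * partial c' m (vcomp X c' k) p.
  exact: partial_chain.
have E1 : X (alpha c i j) p = \sum_k \sum_l (X (alpha c' k l) p * J k i p * J l j p +
    alpha c' k l p * X (J k i) p * J l j p + alpha c' k l p * J k i p * X (J l j) p).
  have sT k l : smooth_near p (fun q => alpha c' k l q * J k i q * J l j q).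
    by apply: smooth_nearM => //; exact: smooth_nearM.
  have sTs k := smooth_near_sum (index_enum (cindex n)) (fun l (_ : true) => sT k l).
  have sTT := smooth_near_sum (index_enum (cindex n)) (fun k (_ : true) => sTs k).
  have -> : X (alpha c i j) p = X (fun q =>
    \sum_k \sum_l alpha c' k l q * J k i q * J l j q) p.
    apply/esym/vfield_eq => //; apply: filterS (filterI (cdom_near cp) (cdom_near c'p)) =>
      q [cq c'q].
    by rewrite (tr c c' i j q hc hc' cq c'q).
  rewrite (vfield_sum X _ (fun k _ => sTs k)); apply: eq_bigr => k _.
  rewrite (vfield_sum X _ (fun l _ => sT k l)); apply: eq_bigr => l _.
  by rewrite (vfieldM X (smooth_nearM (sa k l) (sJ k i)) (sJ l j)) (vfieldM X (sa k l) (sJ k i)) mulrDl.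
have E2 : \sum_m alpha c m j p * partial c i (vcomp X c m) p =
    \sum_k \sum_l alpha c' k l p * (\sum_m partial c i (vcomp X c m) p * J k m p) * J l j p.
  under eq_bigr => m _ do rewrite (tr c c' m j p hc hc' cp c'p) mulr_suml.
  rewrite exchange_big; apply: eq_bigr => k _.
  under eq_bigr => m _ do rewrite mulr_suml.
  rewrite exchange_big; apply: eq_bigr => l _.
  rewrite mulr_sumr mulr_suml; apply: eq_bigr => m _.
  exact: pullback_reorder_left.
have E3 : \sum_m alpha c i m p * partial c j (vcomp X c m) p =
    \sum_k \sum_l alpha c' k l p * J k i p * (\sum_m partial c j (vcomp X c m) p * J l m p).
  under eq_bigr => m _ do rewrite (tr c c' i m p hc hc' cp c'p) mulr_suml.
  rewrite exchange_big; apply: eq_bigr => k _.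
  under eq_bigr => m _ do rewrite mulr_suml.
  rewrite exchange_big; apply: eq_bigr => l _.
  rewrite mulr_sumr; apply: eq_bigr => m _.
  exact: pullback_reorder_right.
have F2 : \sum_k \sum_l (\sum_m alpha c' m l p * partial c' k (vcomp X c' m) p) * J k i p * J l j p =
    \sum_k \sum_l alpha c' k l p * P k i * J l j p.
  under eq_bigr => k _ do (under eq_bigr => l _ do rewrite !mulr_suml).
  under [RHS]eq_bigr => k _ do (under eq_bigr => l _ do rewrite P2 mulr_sumr mulr_suml).
  rewrite exchange_big [RHS]exchange_big; apply: eq_bigr => l _.
  rewrite exchange_big; apply: eq_bigr => m _; apply: eq_bigr => k _.
  exact: contraction_reorder_left.
have F3 : \sum_k \sum_l (\sum_m alpha c' k m p * partial c' l (vcomp X c' m) p) * J k i p * J l j p =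
    \sum_k \sum_l alpha c' k l p * J k i p * P l j.
  apply: eq_bigr => k _.
  under eq_bigr => l _ do rewrite !mulr_suml.
  under [RHS]eq_bigr => l _ do rewrite P2 mulr_sumr.
  rewrite exchange_big; apply: eq_bigr => m _; apply: eq_bigr => l _.
  exact: contraction_reorder_right.
transitivity (\sum_k \sum_l X (alpha c' k l) p * J k i p * J l j p
  + \sum_k \sum_l alpha c' k l p * P k i * J l j p +
    \sum_k \sum_l alpha c' k l p * J k i p * P l j).
  rewrite /lie_form E1 E2 E3 -!big_split; apply: eq_bigr => k _; rewrite -!big_split /=.
  by apply: eq_bigr => l _; rewrite !P1; exact: tensor_leibniz_collect.
rewrite -F2 -F3 -!big_split; apply: eq_bigr => k _; rewrite -!big_split; apply: eq_bigr =>
  l _ /=.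
by rewrite /lie_form !mulrDl.
Qed.

(** The components of $I$ are constant and diagonal in the frame, so only derivatives of [X]
    survive; the factor is 0 for equal types and $\pm 2i$ for mixed ones. *)
Lemma lie_endo_complex_structure c i j p :
  lie_endo X (@complex_structure R n M) c i j p =
    (complex_structure c i i p - complex_structure c j j p) * partial c j (vcomp X c i) p.
Proof.
rewrite /lie_endo; have -> : X (complex_structure c i j) p = 0 by exact: vfield_cst.
rewrite sub0r (bigD1 j)//= big1 ?addr0; last first.
  by move=> k kj; rewrite /complex_structure (negbTE kj) mul0r.
rewrite (bigD1 i)//= big1 ?addr0; last first.
  by move=> k; rewrite eq_sym /complex_structure => /negbTE ->; rewrite mul0r.
by rewrite mulrBl addrC.
Qed.

Lemma lie_endo_vanishesP : vanishes (lie_endo X (@complex_structure R n M)) <->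
  forall c p, holo c -> cdom c p -> forall k l : 'I_n,
    partial c (inr l) (vcomp X c (inl k)) p = 0 /\ partial c (inl k) (vcomp X c (inr l)) p = 0.
Proof.
have i2 : ('i%C + 'i%C : C) != 0.
  by rewrite -mulr2n -[_ *+ 2]mulr_natr mulf_neq0 ?pnatr_eq0 ?neq0Ci.
have e1 c p (k : 'I_n) : complex_structure c (inl k) (inl k) p = 'i%C :> C.
  by rewrite /complex_structure eqxx.
have e2 c p (k : 'I_n) : complex_structure c (inr k) (inr k) p = - 'i%C :> C.
  by rewrite /complex_structure eqxx.
split=> [H c p hc cp k l|H c i j p hc cp].
  have := H c (inl k) (inr l) p hc cp; have := H c (inr l) (inl k) p hc cp.
  rewrite !lie_endo_complex_structure !e1 !e2 opprK -opprD mulNr.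
  move=> /eqP; rewrite oppr_eq0 mulf_eq0 (negbTE i2) => /eqP h1.
  by move=> /eqP; rewrite mulf_eq0 (negbTE i2) => /eqP h2.
rewrite lie_endo_complex_structure; case: i j => k [] l.
- by rewrite !e1 subrr mul0r.
- by rewrite (H c p hc cp k l).1 mulr0.
- by rewrite (H c p hc cp l k).2 mulr0.
- by rewrite !e2 subrr mul0r.
Qed.

End LieDerivatives.

(** * Derivations preserve the complex structure and the Karabegov form *)

Section Necessity.
Variables (R : realType) (n : nat) (M : complexManifold R n).
Local Notation C := (R[i]).
Local Notation fn := (M -> C).
Variables (omega : tensor2 M) (Cr : nat -> fn -> fn -> fn).
Hypothesis Homega : pseudo_kahler omega.
Hypotheses (Hstar : star_product omega Cr) (Hwick : wick_type Cr).
Variable X : vfield M.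
Hypothesis HX : forall r p (a b : fn), smooth_near p a -> smooth_near p b ->
  derivation_defect Cr X r a b p = 0.

Lemma derivation_complex_structure c p : holo c -> cdom c p -> forall k l : 'I_n,
  partial c (inr l) (vcomp X c (inl k)) p = 0 /\ partial c (inl k) (vcomp X c (inr l)) p = 0.
Proof.
move=> hc cp k l.
have sz i := smooth_near_coordf i hc cp.
have sX i : smooth_near p (X (coordf c i)) by exact: smooth_near_vfield.
have kz (i j : cindex n) : i != j -> \forall q \near p, partial c i (coordf c j) q = 0.
  by move=> ij; exact: coordf_killed.
have XC0 i j : (\forall q \near p, Cr 1 (coordf c i) (coordf c j) q = 0) ->
    X (Cr 1 (coordf c i) (coordf c j)) p = 0.
  move=> e; rewrite -(vfield_cst X p 0); apply: vfield_eq => //.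
  exact: (smooth_near_Cr Hstar).
split.
- apply: (poisson_holomorphic Homega Hstar hc cp (sX (inl k))) => j.
  rewrite (Cr_holomorphic Hstar Hwick hc)//; last by move=> l'; exact: kz.
  (* In $D_1(z^j, z^k) = 0$ the terms $X\,C_1(z^j,z^k)$ and $C_1(Xz^j, z^k)$ vanish because $z^k$ is
     holomorphic; what is left is $C_1(z^j, Xz^k) = 0$. *)
  have := HX 1 (sz (inl j)) (sz (inl k)); rewrite /derivation_defect XC0; last first.
    apply: filterS (cdom_near cp) => q cq.
    apply: (Cr_holomorphic Hstar Hwick hc) => //; try exact: smooth_near_coordf.
    by move=> l'; exact: coordf_killed.
  rewrite (Cr_holomorphic Hstar Hwick hc _ cp (sX (inl j)) (sz (inl k)))//; last by move=>
    l'; exact: kz.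
  by rewrite subr0 sub0r => /eqP; rewrite oppr_eq0 => /eqP ->.
- apply: (poisson_antiholomorphic Homega Hstar hc cp (sX (inr l))) => j.
  rewrite [RHS](Cr_antiholomorphic Hstar Hwick hc)//; last by move=> l'; exact: kz.
  have := HX 1 (sz (inr l)) (sz (inr j)); rewrite /derivation_defect XC0; last first.
    apply: filterS (cdom_near cp) => q cq.
    apply: (Cr_antiholomorphic Hstar Hwick hc) => //; try exact: smooth_near_coordf.
    by move=> l'; exact: coordf_killed.
  rewrite (Cr_antiholomorphic Hstar Hwick hc _ cp (sX (inr j)) (sz (inr l)))//;
    last by move=> l'; exact: kz.
  by rewrite subr0 sub0r => /eqP; rewrite oppr_eq0 => /eqP ->.
Qed.

Lemma derivation_karabegov (K : nat -> tensor2 M) (HK : karabegov_form Cr K) m :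
  vanishes (lie_form X (K m)).
Proof.
move=> c i j p hc cp.
(* The given chart need not carry potentials, so the form is computed in a chart [c'] around [p]
   that does and is transformed back at the end. *)
have [c' [hc' c'p cc' [u Hu] _]] := karabegov_cover HK p.
have X1 q k l : cdom c' q -> partial c' (inr l) (vcomp X c' (inl k)) q = 0.
  by move=> cq; exact: (derivation_complex_structure hc' cq k l).1.
have X2 q k l : cdom c' q -> partial c' (inl k) (vcomp X c' (inr l)) q = 0.
  by move=> cq; exact: (derivation_complex_structure hc' cq k l).2.
have mixed k l : lie_form X (K m) c' (inl k) (inr l) p = 0.
  rewrite (lie_form_mixed hc' Hu X1 HK cc' m k l c'p).
  apply: (holomorphic_of_higher_product Homega Hstar Hwick hc') (c'p).
    by move=> m' q cq; exact: (smooth_near_transported hc' Hu).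
  move=> a m' q cq sa.
  have := higher_product_transported Hstar Hwick hc' Hu X1 X2 k m' cq sa.
  by rewrite [X in _ + X]big1 ?addr0// => r _; apply: HX => //;
    exact: (smooth_near_potential Hu).
have all0 k l : lie_form X (K m) c' k l p = 0.
  case: k l => k [] l; [|exact: mixed| |].
  - by rewrite (lie_form_pure hc' Hu X1 X2 HK cc' m c'p).
  - by rewrite (lie_form_antisymmetric X _ _ (karabegov_two_form HK m) hc' c'p) mixed oppr0.
  - by rewrite (lie_form_pure hc' Hu X1 X2 HK cc' m c'p).
rewrite (lie_form_transform X _ _ (karabegov_two_form HK m) hc hc' cp c'p).
by apply: big1 => k _; apply: big1 => l _; rewrite all0 !mul0r.
Qed.

End Necessity.

Theorem proposition3p2 (R : realType) (n : nat) (M : complexManifold R n)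
    (omega : tensor2 M) (Homega : pseudo_kahler omega)
    (Cr : nat -> (M -> R[i]%C) -> (M -> R[i]%C) -> (M -> R[i]%C))
    (Hstar : star_product omega Cr) (Hwick : wick_type Cr)
    (K : nat -> tensor2 M) (HK : karabegov_form Cr K) (X : vfield M) :
  star_derivation Cr X <->
  vanishes (lie_endo X (@complex_structure R n M)) /\
  (forall m, vanishes (lie_form X (K m))).
Proof.
rewrite (star_derivationP Hstar) lie_endo_vanishesP; split=> [HX|[HI HL] r p a b sa sb].
  split; first by move=> c p; exact: (derivation_complex_structure Homega Hstar Hwick HX).
  by move=> m; exact: (derivation_karabegov Homega Hstar Hwick HX HK).
(* The defect is tested at one point at a time, so a single chart with potentials around [p] is
   enough. *)
have [c [hc cp cc [u Hu] _]] := karabegov_cover HK p.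
have X1 q k l : cdom c q -> partial c (inr l) (vcomp X c (inl k)) q = 0.
  by move=> cq; have [] := HI c q hc cq k l.
have X2 q k l : cdom c q -> partial c (inl k) (vcomp X c (inr l)) q = 0.
  by move=> cq; have [] := HI c q hc cq k l.
apply: (defect_eq0 Homega Hstar Hwick hc X1 X2 Hu) => // q k m l cq.
by rewrite -(lie_form_mixed hc Hu X1 HK cc m k l cq); exact: HL.
Qed.
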